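(* Consider the map $b:[0,\infty)\to[\alpha,+\infty]$, $b(r):=\sup\{z\in[\alpha,\infty):U(r,z)>1\}$ (with $\sup\varnothing=\alpha$), where $U$ is the value function of the optimal stopping problem defined in the context. Then $r\mapsto b(r)$ is nonincreasing and right-continuous. Moreover, $b(r)>\alpha$ for all $r\ge 0$.
   Context: Fix $\alpha\ge 0$, $\mu>0$, $\sigma>0$ and $k,\theta,\gamma>0$ with $2k\theta\ge\gamma^2$. Let $B,W$ be independent standard Brownian motions on $(\Omega,\mathcal F,\mathsf P)$, and for $r\ge 0$ let $R^r$ be the unique strong solution of $dR_t=k(\theta-R_t)\,dt+\gamma\sqrt{R_t}\,dW_t$, $R_0=r$. The discount rate $\rho:[0,\infty)\to[0,\infty)$ is continuous and: (i) nondecreasing; (ii) there are $c_1,c_2\ge 0$ with $c_1+c_2>0$ and $\rho(r)\ge c_1+c_2r$ for all $r\ge 0$; (iii) there are $c_3>0$ and $q\in\mathbb N$ such that $\rho(r_1)-\rho(r_2)\le c_3(1+r_1^q)(\sqrt{r_1}-\sqrt{r_2})$ for all $r_1>r_2\ge 0$. Let $\overline{\mathcal O}:=[0,\infty)\times[\alpha,\infty)$, $Y_t=-\mu t+\sigma B_t$, $S_t=\sup_{0\le u\le t}Y_u$, $K^z_t=(z-\alpha)\vee S_t-Y_t+\alpha$ for $z\ge\alpha$, $\lambda=2\mu/\sigma^2$, and $$U(r,z)=\sup_{\tau\ge 0}\mathsf E\Big[e^{\lambda((z-\alpha)\vee S_\tau-(z-\alpha))-\int_0^\tau\rho(R^r_s)ds}\Big],\quad(r,z)\in\overline{\mathcal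 O},$$ the supremum being over all stopping times of the filtration generated by $K^z$ and $W$ augmented by null sets (the payoff is $0$ on $\{\tau=\infty\}$). *)

(* Defs.v *)
From HB Require Import structures.
From mathcomp Require Export all_boot all_order all_algebra.
From mathcomp Require Export all_classical all_reals all_analysis.
Export Order.TTheory GRing.Theory Num.Theory.
Export numFieldNormedType.Exports.

Set Implicit Arguments.
Unset Strict Implicit.
Unset Printing Implicit Defensive.

Local Open Scope classical_set_scope.
Local Open Scope ring_scope.

(* Time is the half-line [0, +oo[ of R: processes are indexed by R, but nothing
   is ever required of them, or read from them, at negative times. *)

Section sigma_algebras.
Context {d : measure_display} {Omega : measurableType d} {R : realType}
  (P : probability Omega R).

Definition process_events (T : set R) (X : R -> Omega -> R) : set (set Omega) :=
  \bigcup_(s in T) preimage_set_system setT (X s) measurable.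

(* Measurable null sets; if P is complete these are all the negligible sets. *)
Definition null_sets : set (set Omega) :=
  [set N | measurable N /\ P N = 0%E].

Definition independent_sigma (F G : set (set Omega)) : Prop :=
  forall A C, F A -> G C -> P (A `&` C) = (P A * P C)%E.

Definition independent_processes (X Y : R -> Omega -> R) : Prop :=
  independent_sigma <<s process_events `[0, +oo[ X >>
                    <<s process_events `[0, +oo[ Y >>.

Definition augmented_filtration (X : R -> Omega -> R) (t : R) :
    set (set Omega) :=
  <<s process_events `[0, t] X `|` null_sets >>.

Definition augmented_filtration2 (X Y : R -> Omega -> R) (t : R) :
    set (set Omega) :=
  <<s process_events `[0, t] X `|` process_events `[0, t] Y `|` null_sets >>.

Definition measurable_wrt (F : set (set Omega)) (f : Omega -> R) : Prop :=
  preimage_set_system setT f measurable `<=` F.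

Definition stopping_time (F : R -> set (set Omega)) (tau : Omega -> \bar R) :
    Prop :=
  (forall w, (0 <= tau w)%E) /\
  (forall t : R, 0 <= t -> F t [set w | (tau w <= t%:E)%E]).

Definition cvg_in_probability (X_ : nat -> Omega -> R) (X : Omega -> R) :
    Prop :=
  forall e : R, 0 < e -> P [set w | e <= `|X_ n w - X w|] @[n --> \oo] --> 0%E.

End sigma_algebras.

Section stochastic_processes.
Context {d : measure_display} {Omega : measurableType d} {R : realType}
  (P : probability Omega R).
Implicit Types (W X : R -> {RV P >-> R}) (F : R -> set (set Omega)).

Definition continuous_paths X : Prop :=
  forall w, {within `[0, +oo[, continuous (fun t => X t w)}.

(* The case s = t is left out: the increment is then 0, whereas the library's
   normal_prob 0 0 is not the Dirac mass at 0. *)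
Definition brownian_motion W : Prop :=
  [/\ {ae P, forall w, W 0 w = 0},
      continuous_paths W,
      forall (s t : R) (A : set R), 0 <= s -> s < t -> measurable A ->
        pushforward P (W t \- W s) A = normal_prob 0 (Num.sqrt (t - s)) A &
      forall s t : R, 0 <= s -> s < t ->
        independent_sigma P <<s process_events `[0, s] W >>
          (preimage_set_system setT (W t \- W s) measurable)].

(* The process \sum_(i < sp_size) sp_coef i * 1_]sp_time i, sp_time i.+1]. *)
Record simple_process := SimpleProcess {
  sp_size : nat;
  sp_time : nat -> R;
  sp_coef : nat -> Omega -> R }.

Definition sp_adapted F (H : simple_process) : Prop :=
  [/\ 0 <= sp_time H 0,
      forall i, sp_time H i <= sp_time H i.+1 &
      forall i, (i < sp_size H)%N ->
        measurable_wrt (F (sp_time H i)) (sp_coef H i) /\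
        exists M, forall w, `|sp_coef H i w| <= M].

Definition sp_val (H : simple_process) (s : R) (w : Omega) : R :=
  \sum_(i < sp_size H)
    sp_coef H i w * \1_(`]sp_time H i, sp_time H i.+1]) s.

Definition sp_integral W (H : simple_process) (t : R) (w : Omega) : R :=
  \sum_(i < sp_size H)
    sp_coef H i w *
    (W (Num.min (sp_time H i.+1) t) w - W (Num.min (sp_time H i) t) w).

(* I is (a version of) the Ito integral of H against W over [0, t]: the limit in
   probability of the integrals of simple adapted processes H_n such that
   \int_0^t (H - H_n)^2 ds tends to 0 in probability. *)
Definition is_ito_integral F W (H : R -> Omega -> R) (t : R) (I : Omega -> R) :
    Prop :=
  exists H_ : nat -> simple_process,
    [/\ forall n, sp_adapted F (H_ n),
        cvg_in_probability P
          (fun n w =>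
             \int[lebesgue_measure]_(s in `[0, t])
               (H s w - sp_val (H_ n) s w) ^+ 2)
          (cst 0) &
        cvg_in_probability P (fun n => sp_integral W (H_ n) t) I].

(* X is a strong solution, with values in [0, +oo[ and driven by W, of
   dX_t = k (theta - X_t) dt + gamma sqrt(X_t) dW_t, X_0 = r. *)
Definition cir_strong_solution (k theta gamma : R) W (r : R) X : Prop :=
  [/\ continuous_paths X,
      forall (t : R) w, 0 <= t -> 0 <= X t w,
      forall t : R, 0 <= t -> measurable_wrt (augmented_filtration P W t) (X t),
      {ae P, forall w, X 0 w = r} &
      forall t : R, 0 <= t -> exists2 I : {RV P >-> R},
        is_ito_integral (augmented_filtration P W) W
          (fun s w => gamma * Num.sqrt (X s w)) t I &
        {ae P, forall w,
          X t w =
            r + \int[lebesgue_measure]_(s in `[0, t]) (k * (theta - X s w))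
              + I w}].

End stochastic_processes.

Definition discount_rate {R : realType} (rho : R -> R) : Prop :=
  [/\ {within `[0, +oo[, continuous rho},
      forall r : R, 0 <= r -> 0 <= rho r,
      forall r1 r2 : R, 0 <= r1 -> r1 <= r2 -> rho r1 <= rho r2,
      exists c1 c2 : R, [/\ 0 <= c1, 0 <= c2, 0 < c1 + c2 &
        forall r : R, 0 <= r -> c1 + c2 * r <= rho r] &
      exists (c3 : R) (q : nat), 0 < c3 /\
        forall r1 r2 : R, 0 <= r2 -> r2 < r1 ->
          rho r1 - rho r2 <=
            c3 * (1 + r1 ^+ q) * (Num.sqrt r1 - Num.sqrt r2)].

Section stopping_problem.
Context {d : measure_display} {Omega : measurableType d} {R : realType}
  (P : probability Omega R).
(* Rate r t w is R^r_t(w). *)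
Context (alpha mu sigma : R) (rho : R -> R) (B W : R -> {RV P >-> R})
  (Rate : R -> R -> {RV P >-> R}).

Definition drifted_BM (t : R) (w : Omega) : R := - mu * t + sigma * B t w.

Definition running_sup (t : R) (w : Omega) : R :=
  sup [set drifted_BM u w | u in `[0, t]].

Definition Kprocess (z t : R) (w : Omega) : R :=
  Num.max (z - alpha) (running_sup t w) - drifted_BM t w + alpha.

Definition lam : R := 2 * mu / sigma ^+ 2.

Definition payoff (r z : R) (tau : Omega -> \bar R) (w : Omega) : R :=
  if tau w is t%:E then
    expR (lam * (Num.max (z - alpha) (running_sup t w) - (z - alpha))
          - \int[lebesgue_measure]_(s in `[0, t]) rho (Rate r s w))
  else 0.

Definition value (r z : R) : \bar R :=
  ereal_sup [set 'E_P[payoff r z tau]%E | tau in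
    stopping_time (augmented_filtration2 P (Kprocess z) W)].

(* Adjoining alpha to a subset of [alpha, +oo[ only changes its supremum when it
   is empty, and implements the convention that the supremum is then alpha. *)
Definition boundary (r : R) : \bar R :=
  ereal_sup (alpha%:E |`
    [set z%:E | z in [set z | alpha <= z /\ (1 < value r z)%E]]).

End stopping_problem.

(* Main.v *)
(* Everything rests on a comparison estimate for two solutions X, Y of the CIR
   equation started at x, y and driven by the same Brownian motion:
   E (X_t - Y_t)^+ <= (x - y)^+. It is the Yamada-Watanabe argument: apply Ito's
   formula to smooth approximations of the positive part; the second-order term is
   controlled by (sqrt X - sqrt Y)^2 <= |X - Y| and the drift is decreasing. Ito's
   formula is replaced by a Taylor expansion along the Euler scheme, truncated when
   X or Y becomes large, which approximates X - Y in probability.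
   Monotonicity: the estimate and path continuity give R^r1 <= R^r2 almost surely
   for r1 <= r2, so every payoff, hence U(., z), hence b, is nonincreasing.
   Right-continuity: along r_n decreasing to r the estimate gives
   int_0^T (R^r_n - R^r)^+ ds -> 0 almost surely, so the discount factors converge;
   hence U(r, z) > 1 implies U(r_n, z) > 1 for some n.
   Finally, at z = alpha + t wait until time t or until the accumulated discount
   reaches C t, where C = rho r + 1. The loss is at most a factor exp (- C t), while
   with probability bounded below B gains 2 sqrt t, and sqrt t dominates t for
   small t; hence U(r, alpha + t) > 1. *)

Require Import Defs.
From mathcomp Require Import all_boot all_order all_algebra.
From mathcomp Require Import all_classical all_reals all_analysis.
From HB Require Import structures.
From mathcomp Require Import measurable_realfun ring lra.

Import Order.TTheory GRing.Theory Num.Theory numFieldNormedType.Exports.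

Set Implicit Arguments.
Unset Strict Implicit.
Unset Printing Implicit Defensive.

Local Open Scope classical_set_scope.
Local Open Scope ring_scope.

(** * Expectation, augmented sigma-algebras and independence *)

(** The definition of the Ito integral gives only a limit in probability along unspecified simple
    processes, so neither an isometry nor Ito's formula applies directly to a solution. A Lenglart
    inequality for sums over a finite grid transfers the limit to the explicit left-endpoint
    approximations of the integrand, again in probability; second-moment bounds for the truncated
    scheme then restore the convergence of expectations that the Yamada-Watanabe estimate needs. The
    smooth function used there is even, tends to |x|, and is applied together with the identity,
    because |x| + x = 2 x^+. The parameters are released in the order mesh, smoothing, truncation
    level. The filtration of the stopping problem does not involve r, so values at different r are
    compared along one fixed stopping time. Payoffs are compared through their simple minorants, so
    almost sure inequalities between them suffice. For the last claim the discount is driven by W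
    and the gain by B: independence turns the probability of a large gain with a small discount into
    a product of two factors bounded below. *)

Section expectation.
Context {d : measure_display} {Omega : measurableType d} {R : realType}
  (P : probability Omega R).
Implicit Types (f g : Omega -> R) (A B : set Omega).

Definition intg f : Prop := P.-integrable setT (EFin \o f).
Definition Ex f : R := \int[P]_w f w.
Definition Pr A : R := fine (P A).

Lemma intg_le f g : measurable_fun setT f -> (forall w, `|f w| <= `|g w|) ->
  intg g -> intg f.
Proof.
move=> mf fg; apply: le_integrable => //; first exact/measurable_EFinP.
by move=> x _ /=; rewrite lee_fin.
Qed.

Lemma intg_cst (c : R) : intg (cst c).
Proof. by apply: finite_measure_integrable_cst. Qed.

Lemma intg_bd f (M : R) : measurable_fun setT f -> (forall w, `|f w| <= M) ->
  intg f.
Proof.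
move=> mf fM; apply: (@intg_le _ (cst M)) => //; last exact: intg_cst.
by move=> w; rewrite (le_trans (fM w))//= ler_norm.
Qed.

Lemma intgD f g : intg f -> intg g -> intg (fun w => f w + g w).
Proof. by move=> fi gi; exact: (integrableD measurableT fi gi). Qed.

Lemma intgZ (c : R) f : intg f -> intg (fun w => c * f w).
Proof. by move=> fi; exact: (integrableZl measurableT c fi). Qed.

Lemma intg_sum n (f : nat -> Omega -> R) : (forall i, (i < n)%N -> intg (f i)) ->
  intg (fun w => \sum_(i < n) f i w).
Proof.
elim: n => [|n ih] fi.
  by under [X in intg X]eq_fun do rewrite big_ord0; exact: intg_cst.
under [X in intg X]eq_fun do rewrite big_ord_recr/=.
by apply: intgD; [apply: ih => i /ltnW; exact: fi|exact: fi].
Qed.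

Lemma ExD f g : intg f -> intg g -> Ex (fun w => f w + g w) = Ex f + Ex g.
Proof. by move=> fi gi; exact: RintegralD. Qed.

Lemma ExZ (c : R) f : intg f -> Ex (fun w => c * f w) = c * Ex f.
Proof. by move=> fi; exact: RintegralZl. Qed.

Lemma Ex_cst (c : R) : Ex (cst c) = c.
Proof. by rewrite /Ex Rintegral_cst//= probability_setT mulr1. Qed.

Lemma le_Ex f g : intg f -> intg g -> (forall w, f w <= g w) -> Ex f <= Ex g.
Proof. by move=> fi gi fg; apply: le_Rintegral. Qed.

Lemma Ex_ge0 f : (forall w, 0 <= f w) -> 0 <= Ex f.
Proof. by move=> f0; exact: Rintegral_ge0. Qed.

Lemma eq_Ex f g : (forall w, f w = g w) -> Ex f = Ex g.
Proof. by move=> fg; congr Ex; apply/funext. Qed.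

Lemma EFin_Ex f : intg f -> (Ex f)%:E = (\int[P]_w (f w)%:E)%E.
Proof.
by move=> fi; rewrite /Ex /Rintegral fineK//; exact: integrable_fin_num.
Qed.

Lemma EFin_Pr A : measurable A -> (Pr A)%:E = P A.
Proof. by move=> mA; rewrite /Pr fineK// fin_num_measure. Qed.

Lemma intg_indic A : measurable A -> intg \1_A.
Proof. by move=> mA; exact: integrable_indic. Qed.

Lemma Ex_indic A : measurable A -> Ex \1_A = Pr A.
Proof.
by move=> mA; rewrite /Ex /Rintegral integral_indic// setIT.
Qed.

Lemma Pr_ge0 A : 0 <= Pr A. Proof. exact: fine_ge0. Qed.

Lemma le_Pr A B : measurable A -> measurable B -> A `<=` B -> Pr A <= Pr B.
Proof.
move=> mA mB AB; rewrite -lee_fin !EFin_Pr//.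
by apply: le_measure => //; rewrite inE.
Qed.

Lemma PrU A B : measurable A -> measurable B -> Pr (A `|` B) <= Pr A + Pr B.
Proof.
move=> mA mB; rewrite -lee_fin EFinD !EFin_Pr//; last exact: measurableU.
exact: measureU2.
Qed.

Lemma markov_Pr f A (e : R) : measurable A -> intg f -> 0 < e ->
  (forall w, 0 <= f w) -> (forall w, A w -> e <= f w) -> Pr A <= Ex f / e.
Proof.
move=> mA fi e0 f0 fe; rewrite ler_pdivlMr// mulrC -Ex_indic// -ExZ//; last exact: intg_indic.
apply: le_Ex => //; first by apply: intgZ; exact: intg_indic.
move=> w; rewrite indicE; have [wA|wA] := boolP (w \in A).
  by rewrite mulr1 fe//; exact: set_mem.
by rewrite mulr0.
Qed.

Lemma Ex_dominated (f_ : nat -> Omega -> R) f (M : R) :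
  (forall n, measurable_fun setT (f_ n)) -> measurable_fun setT f ->
  (forall n w, `|f_ n w| <= M) ->
  {ae P, forall w, f_ n w @[n --> \oo] --> f w} ->
  Ex (f_ n) @[n --> \oo] --> Ex f.
Proof.
move=> mf_ mf fM cf.
have := @dominated_convergence _ _ _ P setT measurableT
  (fun n w => (f_ n w)%:E) (EFin \o f) (cst M%:E).
case.
- by move=> n; exact/measurable_EFinP.
- exact/measurable_EFinP.
- apply: filterS cf => w cw _.
  by apply: cvg_comp cw _ => //; apply: cvg_EFin => //; near=> n.
- exact: intg_cst.
- by apply: aeW => w n _ /=; rewrite lee_fin.
move=> fi _ cE.
rewrite /Ex; apply: fine_cvg.
rewrite -/(Ex f) EFin_Ex//.
Unshelve. all: by end_near. Qed.

End expectation.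

(** * Sub-sigma-algebras and their augmentation by null sets *)

Section sub_sigma_algebras.
Context {d : measure_display} {Omega : measurableType d} {R : realType}
  (P : probability Omega R).
Implicit Types (f g : Omega -> R) (A B C : set Omega) (G : set (set Omega)).

Lemma measurable_wrtP G f : measurable_wrt <<s G>> f <->
  measurable_fun setT (f : g_sigma_algebraType G -> R).
Proof.
split=> [h _ B mB|h _ [B mB <-]].
  by apply: h; exists B.
exact: h.
Qed.

Lemma sigma_measurable G : G `<=` measurable -> <<s G>> `<=` measurable.
Proof. by move=> GM; apply: smallest_sub => //; exact: sigma_algebra_measurable. Qed.

Lemma measurable_wrt_meas (F : set (set Omega)) f : F `<=` measurable ->
  measurable_wrt F f -> measurable_fun setT f.
Proof. by move=> FM h _ B mB; apply: FM; apply: h; exists B. Qed.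

Lemma measurable_wrtS (F F' : set (set Omega)) f : F `<=` F' ->
  measurable_wrt F f -> measurable_wrt F' f.
Proof. by move=> FF' h; exact: subset_trans FF'. Qed.

Lemma measure_le_off_null A B N : measurable A -> measurable B -> measurable N ->
  P N = 0%E -> (forall w, ~ N w -> A w -> B w) -> (P A <= P B)%E.
Proof.
move=> mA mB mN N0 AB; apply: (@le_trans _ _ (P (B `|` N))).
  apply: le_measure; rewrite ?inE//; first exact: measurableU.
  by move=> w Aw; have [Nw|Nw] := pselect (N w); [right|left; exact: AB].
by apply: (le_trans (measureU2 _ _ _)) => //; rewrite [X in (_ + X)%E](_ : _ = 0%E) ?adde0.
Qed.

Lemma measure_eq_off_null A B N : measurable A -> measurable B -> measurable N ->
  P N = 0%E -> (forall w, ~ N w -> (A w <-> B w)) -> P A = P B.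
Proof.
move=> mA mB mN N0 AB; apply/eqP; rewrite eq_le; apply/andP; split.
  by apply: (measure_le_off_null _ _ mN) => // w /AB[].
by apply: (measure_le_off_null _ _ mN) => // w /AB[].
Qed.

(** The sets that agree with a member of [<<s G>>] outside some null set form a sigma-algebra, and
    it contains both [G] and the null sets. *)
Lemma sigma_null_approx G : G `<=` measurable -> forall A,
  <<s G `|` null_sets P>> A ->
  exists A' N, [/\ <<s G>> A', measurable N, P N = 0%E &
    forall w, ~ N w -> (A w <-> A' w)].
Proof.
move=> GM.
pose H := [set A : set Omega | exists A' N, [/\ <<s G>> A', measurable N, P N = 0%E &
    forall w, ~ N w -> (A w <-> A' w)]].
suff: <<s G `|` null_sets P>> `<=` H by [].
apply: smallest_sub; last first.
  move=> A [GA|[mA A0]].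
    exists A, set0; split => //.
    exact: sub_sigma_algebra.
  exists set0, A; split => //; first exact: sigma_algebra0.
split.
- by exists set0, set0; split => //; exact: sigma_algebra0.
- move=> A [A' [N [GA' mN N0 AA']]]; exists (~` A'), N; split => //.
    by rewrite -setTD; exact: sigma_algebraCD.
  by move=> w /AA'[h1 h2]; split=> [[_ h]|h] //; [move=> /h2|split => // /h1].
- move=> F HF.
  have /choice [A' hA'] := HF.
  have /choice [N hN] := hA'.
  exists (\bigcup_n A' n), (\bigcup_n N n); split.
  + by apply: sigma_algebra_bigcup => n; have [] := hN n.
  + by apply: bigcupT_measurable => n; have [] := hN n.
  + apply: measure_negligible.
      by apply: bigcupT_measurable => n; have [] := hN n.
    apply: negligible_bigcup => n; have [_ mN N0 _] := hN n.
    exact/negligibleP.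
  + move=> w Nw; split=> -[n _ Fnw]; exists n => //; have [_ _ _ h] := hN n.
      by apply/h => // ?; apply: Nw; exists n.
    by apply/h => // ?; apply: Nw; exists n.
Qed.

(** Replacing a set by its version in [<<s G>>] changes neither probability, so independence
    survives augmentation. *)
Lemma indep_augment G C : G `<=` measurable -> measurable C ->
  (forall A, <<s G>> A -> P (A `&` C) = (P A * P C)%E) ->
  forall A, <<s G `|` null_sets P>> A -> P (A `&` C) = (P A * P C)%E.
Proof.
move=> GM mC h A GA; have [A' [N [GA' mN N0 AA']]] := sigma_null_approx GM GA.
have mA : measurable A.
  by apply: sigma_measurable GA => B [/GM//|[]].
have mA' : measurable A' by exact: (sigma_measurable GM).
rewrite (measure_eq_off_null mA mA' mN)//.
rewrite (@measure_eq_off_null (A `&` C) (A' `&` C) N) ?h//; [exact: measurableI..|].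
by move=> w /AA'[h1 h2]; split=> -[? ?]; split; auto.
Qed.

End sub_sigma_algebras.

(** * Expectation of a product of independent functions *)

Section independence.
Context {d d1 d2} {Omega : measurableType d} {T1 : measurableType d1}
  {T2 : measurableType d2} {R : realType} (P : probability Omega R).
Variables (X : {mfun Omega >-> T1}) (Y : {mfun Omega >-> T2}).
Hypothesis XY : forall A B, measurable A -> measurable B ->
  P (X @^-1` A `&` Y @^-1` B) = (P (X @^-1` A) * P (Y @^-1` B))%E.

Let mXY : measurable_fun setT (fun w => (X w, Y w)).
Proof. exact: measurable_fun_pair. Qed.

Let Z : {mfun Omega >-> (T1 * T2)%type} :=
  HB.pack (fun w => (X w, Y w)) (isMeasurableFun.Build _ _ _ _ _ mXY).

Let jointE A : measurable A ->
  (distribution P X \x distribution P Y)%E A = distribution P Z A.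
Proof. by move=> mA; apply: product_measure_unique => // B C mB mC; exact: XY. Qed.

Variables (f : T1 -> R) (g : T2 -> R).
Hypotheses (mf : measurable_fun setT f) (mg : measurable_fun setT g).
Hypotheses (fi : intg P (f \o X)) (gi : intg P (g \o Y)).

Let mfg : measurable_fun setT (fun z : T1 * T2 => (f z.1 * g z.2)%:E).
Proof.
apply/measurable_EFinP; apply: measurable_funM.
  exact: measurableT_comp.
exact: measurableT_comp.
Qed.

Let fi1 : (distribution P X).-integrable setT (EFin \o f).
Proof. by apply: integrable_pushforward => //; exact/measurable_EFinP. Qed.

Let gi1 : (distribution P Y).-integrable setT (EFin \o g).
Proof. by apply: integrable_pushforward => //; exact/measurable_EFinP. Qed.

Let prod_integrable :
  (distribution P X \x distribution P Y)%E.-integrable setT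
    (fun z : T1 * T2 => (f z.1 * g z.2)%:E).
Proof.
apply/integrable12ltyP => //=.
under eq_integral => x _.
  under eq_integral do rewrite normrM EFinM.
  rewrite ge0_integralZl//; last first.
    by apply/measurable_EFinP; exact: measurableT_comp.
  over.
rewrite ge0_integralZr//; last 2 first.
  by apply/measurable_EFinP; exact: measurableT_comp.
  exact: integral_ge0.
have /integrableP[_ f1] := fi1; have /integrableP[_ g1] := gi1.
by apply: lte_mul_pinfty; [exact: integral_ge0|rewrite ge0_fin_numE//; exact: integral_ge0|].
Qed.

Lemma indep_intgM : intg P (fun w => f (X w) * g (Y w)).
Proof.
apply/integrableP; split.
  exact: (measurableT_comp mfg mXY).
have /integrableP[_] := prod_integrable.
rewrite (@eq_measure_integral _ _ _ _ (distribution P Z)); last first.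
  by move=> A mA _; exact: jointE.
by rewrite ge0_integral_distribution//; exact: measurableT_comp.
Qed.

(** Independence makes the joint law of [X] and [Y] the product of their laws, and Fubini splits the
    integral. The two target spaces are arbitrary so that [X] may be the identity onto a smaller
    sigma-algebra. *)
Lemma indep_ExM : Ex P (fun w => f (X w) * g (Y w)) = Ex P (f \o X) * Ex P (g \o Y).
Proof.
apply/EFin_inj; rewrite EFinM !EFin_Ex//; last exact: indep_intgM.
transitivity (\int[distribution P Z]_z (f z.1 * g z.2)%:E)%E.
  rewrite integral_distribution//; exact: indep_intgM.
rewrite -(@eq_measure_integral _ _ _ _ _ (distribution P X \x distribution P Y)%E); last first.
  by move=> A mA _; exact: jointE.
rewrite -integral12_prod_meas1//=.
under eq_integral => x _.
  rewrite /fubini_F /=; under eq_integral do rewrite EFinM.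
  rewrite integralZl//.
  over.
rewrite -[X in (_ * X)%E](@integral_distribution _ _ _ _ _ _ Y (EFin \o g))//; last exact/measurable_EFinP.
rewrite -[X in (X * _)%E](@integral_distribution _ _ _ _ _ _ X (EFin \o f))//; last exact/measurable_EFinP.
have /fineK gE := integrable_fin_num measurableT gi1.
by rewrite -gE -integralZr//; exact: eq_integral.
Qed.

End independence.

(** * Gaussian moments and Brownian increments *)

Section gaussian_moments.
Context {R : realType}.
Local Notation mu := (@lebesgue_measure R).
Implicit Types (s : R).

Let mpdf s D : measurable_fun D (fun x : R => (normal_pdf 0 s x)%:E).
Proof. by apply/measurable_EFinP; apply: measurable_funTS; exact: measurable_normal_pdf. Qed.

Let integral_normal_indic s (E : set R) : measurable E ->
  (\int[normal_prob 0 s]_x (\1_E x)%:E =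
   \int[mu]_x ((\1_E x)%:E * (normal_pdf 0 s x)%:E))%E.
Proof.
move=> mE; rewrite integral_indic//= setIT /normal_prob.
rewrite [LHS]integral_mkcond; apply: eq_integral => x _.
by rewrite patchE indicE; case: ifPn => _; rewrite ?mul1e ?mul0e.
Qed.

Import HBNNSimple.

Let integral_normal_nnsfun s (f : {nnsfun _ >-> R}) :
  (\int[normal_prob 0 s]_x (f x)%:E =
   \int[mu]_x ((f x)%:E * (normal_pdf 0 s x)%:E))%E.
Proof.
under [LHS]eq_integral do rewrite fimfunE -fsumEFin//.
rewrite [LHS]ge0_integral_fsum//; last 2 first.
  - by move=> r; exact/measurable_EFinP/measurableT_comp.
  - by move=> n x _; rewrite EFinM nnfun_muleindic_ge0.
under [RHS]eq_integral.
  move=> x xD; rewrite fimfunE -fsumEFin// muleC ge0_mule_fsumr; last first.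
    by move=> r; rewrite EFinM nnfun_muleindic_ge0.
  over.
rewrite [RHS]ge0_integral_fsum//; last 2 first.
  - move=> r; apply: emeasurable_funM; first exact: mpdf.
    exact/measurable_EFinP/measurableT_comp.
  - move=> n x _; rewrite mule_ge0 ?lee_fin ?normal_pdf_ge0//.
    by rewrite -lee_fin EFinM nnfun_muleindic_ge0.
apply: eq_fsbigr => r _.
under [RHS]eq_integral do rewrite muleC EFinM -muleA.
have [r0|r0] := leP 0 r; last first.
  rewrite !integral0_eq// => x _.
    by rewrite preimage_nnfun0// indicE in_set0 mul0e mule0.
  by rewrite preimage_nnfun0// indicE in_set0 mulr0.
rewrite ge0_integralZl//; last 2 first.
  - by apply: emeasurable_funM; [exact/measurable_EFinP/measurable_indic|exact: mpdf].
  - by move=> x _; rewrite -EFinM lee_fin mulr_ge0 ?normal_pdf_ge0.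
under eq_integral do rewrite EFinM.
rewrite ge0_integralZl//; last exact/measurable_EFinP.
congr (_ * _)%E; apply: integral_normal_indic.
have -> : f @^-1` [set r] = [set: measurableTypeR R] `&` f @^-1` [set r].
  by rewrite setTI.
by apply: (measurable_funP f); [exact: measurableT|exact: measurable_set1].
Qed.

(** Integration against a measure with a density, obtained in the usual three stages: indicators,
    simple functions, monotone limits. *)
Lemma ge0_integral_normal_prob s (f : _ -> \bar R) :
  measurable_fun setT f -> (forall x, 0 <= f x)%E ->
  (\int[normal_prob 0 s]_x f x = \int[mu]_x (f x * (normal_pdf 0 s x)%:E))%E.
Proof.
move=> mf f0; pose f_ := nnsfun_approx measurableT mf.
transitivity (lim (\int[normal_prob 0 s]_x (f_ n x)%:E @[n --> \oo])%E).
  rewrite -monotone_convergence//=.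
  - by apply: eq_integral => ? /[!inE] xD; apply/esym/cvg_lim => //=; exact: cvg_nnsfun_approx.
  - by move=> n; exact/measurable_EFinP/measurable_funTS.
  - by move=> n ? _; rewrite lee_fin.
  - by move=> ? _ ? ? mn; rewrite lee_fin; exact/lefP/nd_nnsfun_approx.
transitivity (lim (\int[mu]_x ((f_ n x)%:E * (normal_pdf 0 s x)%:E)%E @[n --> \oo])%E).
  by apply: congr_lim; apply/funext => n /=; exact: integral_normal_nnsfun.
rewrite -monotone_convergence//=.
- apply: eq_integral => x _; apply/cvg_lim => //.
  apply: cvgeZr => //; exact: cvg_nnsfun_approx.
- move=> n; apply: emeasurable_funM; last exact: mpdf.
  exact/measurable_EFinP/measurable_funTS.
- by move=> n ? _; rewrite -EFinM lee_fin mulr_ge0// normal_pdf_ge0.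
- move=> x _ ? ? mn; apply: lee_wpmul2r; rewrite lee_fin ?normal_pdf_ge0//.
  exact/lefP/nd_nnsfun_approx.
Qed.

Lemma normal_pdf_scale s x : 0 < s -> normal_pdf 0 s (s * x) * s = normal_pdf 0 1 x.
Proof.
move=> s0; rewrite !normal_pdfE ?oner_neq0 ?gt_eqF//.
rewrite mulrAC; congr (_ * _).
  rewrite /normal_peak -mulrnAr sqrtrM ?sqr_ge0// sqrtr_sqr gtr0_norm//.
  by rewrite expr1n mul1r invfM mulrAC mulVf ?mul1r// gt_eqF.
rewrite /normal_fun; congr expR; rewrite !subr0 exprMn expr1n.
by rewrite -[in LHS]mulr_natr; field; rewrite gt_eqF.
Qed.

Lemma integral_abs_moment_scale p s : 0 < s ->
  (\int[normal_prob 0 s]_x (`|x| ^+ p)%:E =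
   (s ^+ p)%:E * \int[normal_prob 0 1]_x (`|x| ^+ p)%:E)%E.
Proof.
move=> s0.
have cp : continuous (fun x : R => `|x| ^+ p).
  move=> x; apply: (@continuous_comp _ _ _ (fun x : R => `|x|) (fun y => y ^+ p)).
    exact: norm_continuous.
  exact: exprn_continuous.
have mp : measurable_fun setT (fun x : R => (`|x| ^+ p)%:E).
  by apply/measurable_EFinP; exact: continuous_measurable_fun.
rewrite !ge0_integral_normal_prob//; try by move=> x; rewrite lee_fin exprn_ge0.
have dF : ((fun x : R => s * x)^`())%classic = cst s.
  apply/funext => x; rewrite derive1E deriveM//= derive_cst derive_id.
  by rewrite /cst /= scaler0 addr0 [_ *: _]mulr1.
under eq_integral do rewrite -EFinM.
rewrite (@increasing_ge0_integration_by_substitutionT _ (fun x : R => s * x)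
  (fun x : R => `|x| ^+ p * normal_pdf 0 s x)); first last.
- by move=> x; rewrite mulr_ge0 ?exprn_ge0 ?normal_pdf_ge0.
- move=> x; apply: cvgM; first exact: cp.
  by apply: continuous_normal_pdf; rewrite gt_eqF.
- by apply: gt0_cvgMry => //; exact: cvg_id.
- by apply: gt0_cvgMrNy => //; exact: cvg_id.
- by move=> x; exact: derivableM.
- rewrite dF; exact: is_cvg_cst.
- rewrite dF; exact: is_cvg_cst.
- rewrite dF => x; exact: cvg_cst.
- by move=> x y xy; rewrite ltr_pM2l.
rewrite -ge0_integralZl//; last 3 first.
- apply: emeasurable_funM => //; exact: mpdf.
- by move=> x _; rewrite -EFinM lee_fin mulr_ge0 ?exprn_ge0 ?normal_pdf_ge0.
- by rewrite lee_fin exprn_ge0// ltW.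
apply: eq_integral => x _; rewrite -!EFinM dF; congr EFin.
rewrite !fctE /= -(normal_pdf_scale x s0) normrM exprMn gtr0_norm//.
by rewrite !mulrA.
Qed.

Lemma integral_opp_normal s (f : R -> R) : 0 < s -> measurable_fun setT f ->
  (forall x, 0 <= f x) ->
  (\int[normal_prob 0 s]_x (f (- x))%:E = \int[normal_prob 0 s]_x (f x)%:E)%E.
Proof.
move=> s0 mf f0.
have mfN : measurable_fun setT (fun x : R => f (- x)).
  by apply: (measurableT_comp mf); apply: continuous_measurable_fun; exact: opp_continuous.
rewrite !ge0_integral_normal_prob//; try by move=> x; rewrite lee_fin.
- transitivity (\int[pushforward mu (-%R : _ -> measurableTypeR R)]_x
    ((f x)%:E * (normal_pdf 0 s x)%:E))%E; last first.
    by apply: eq_measure_integral => A mA _; exact: lebesgue_measureN.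
  have mF : measurable_fun setT (fun x : R => ((f x)%:E * (normal_pdf 0 s x)%:E)%E).
    by apply: emeasurable_funM; [exact/measurable_EFinP|exact: mpdf].
  have mN : measurable_fun setT (-%R : measurableTypeR R -> measurableTypeR R).
    by apply: continuous_measurable_fun; exact: opp_continuous.
  have F0 : {in [set: R], forall x, (0 <= (f x)%:E * (normal_pdf 0 s x)%:E)%E}.
    by move=> x _; rewrite -EFinM lee_fin mulr_ge0 ?normal_pdf_ge0.
  rewrite (ge0_integral_pushforward mN mu measurableT mF F0).
  apply: eq_integral => x _; congr (_ * _%:E)%E.
  by rewrite !normal_pdfE ?gt_eqF// /normal_fun !subr0 sqrrN.
- exact/measurable_EFinP.
- exact/measurable_EFinP.
Qed.

(** Serves to dominate the third absolute moment of the standard Gaussian by the total mass of the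
    Gaussian with standard deviation 2. *)
Lemma abs_cube_gauss_le (x : R) :
  `|x| ^+ 3 * expR (- (x ^+ 2 / 2)) <= 32 * expR (- (x ^+ 2 / 8)).
Proof.
set y := `|x|; have y0 : 0 <= y by exact: normr_ge0.
have -> : x ^+ 2 = y ^+ 2 by rewrite real_normK// num_real.
have -> : - (y ^+ 2 / 2) = - (y ^+ 2 / 8) - 3 * y ^+ 2 / 8 by field.
rewrite expRD mulrCA -[leRHS]mulrC ler_pM2l ?expR_gt0// expRN.
rewrite ler_pdivrMr ?expR_gt0//.
(* Halving the exponent before using 1 + u <= exp u produces a polynomial of degree 4, which beats
   the cube. *)
have -> : 3 * y ^+ 2 / 8 = 3 * y ^+ 2 / 16 + 3 * y ^+ 2 / 16 by field.
rewrite expRD.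
have h : 1 + 3 * y ^+ 2 / 16 <= expR (3 * y ^+ 2 / 16) by exact: expR_ge1Dx.
have h1 : 0 <= 1 + 3 * y ^+ 2 / 16 by rewrite addr_ge0// divr_ge0// mulr_ge0// exprn_ge0.
apply: (@le_trans _ _ (32 * ((1 + 3 * y ^+ 2 / 16) * (1 + 3 * y ^+ 2 / 16)))); last first.
  by rewrite ler_pM2l// ler_pM.
nra.
Qed.

Let normal_fun01 (x : R) : normal_fun 0 1 x = expR (- (x ^+ 2 / 2)).
Proof.
by rewrite /normal_fun; congr expR; rewrite subr0 mulNr; congr (- (_ / _)); rewrite expr1n.
Qed.

Let normal_fun02 (x : R) : normal_fun 0 2 x = expR (- (x ^+ 2 / 8)).
Proof.
rewrite /normal_fun; congr expR; rewrite subr0 mulNr; congr (- (_ / _)).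
by rewrite -natrX -mulrnA.
Qed.

Let ratio_le (a b u v y : R) : 0 < a -> 0 < b -> y * v <= 32 * u ->
  y * (a * v) <= 32 * a / b * (b * u).
Proof.
move=> a0 b0 h; rewrite -!mulrA mulKf ?gt_eqF//.
by rewrite [leLHS]mulrCA [leRHS]mulrCA ler_pM2l.
Qed.

Lemma normal_abs_cube_finite : (\int[normal_prob 0 (1:R)]_x (`|x| ^+ 3)%:E < +oo)%E.
Proof.
have cp : continuous (fun x : R => `|x| ^+ 3).
  move=> x; apply: (@continuous_comp _ _ _ (fun x : R => `|x|) (fun y => y ^+ 3)).
    exact: norm_continuous.
  exact: exprn_continuous.
have mp : measurable_fun setT (fun x : R => (`|x| ^+ 3)%:E).
  by apply/measurable_EFinP; exact: continuous_measurable_fun.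
rewrite ge0_integral_normal_prob//.
pose C : R := 32 * normal_peak 1 / normal_peak 2.
apply: (@le_lt_trans _ _ (\int[mu]_x (C%:E * (normal_pdf 0 2 x)%:E)))%E.
  apply: ge0_le_integral => //.
  - by move=> x _; rewrite -EFinM lee_fin mulr_ge0 ?exprn_ge0 ?normal_pdf_ge0.
  - by apply: emeasurable_funM => //; exact: mpdf.
  - by apply: measurable_funeM; exact: mpdf.
  - move=> x _; rewrite -!EFinM lee_fin /C.
    have p1 := @normal_peak_gt0 R 1 (oner_neq0 _).
    have p20 : (2 : R) != 0 by rewrite pnatr_eq0.
    have p2 := @normal_peak_gt0 R 2 p20.
    rewrite (@normal_pdfE R 0 1) ?oner_neq0// (@normal_pdfE R 0 2)// normal_fun01 normal_fun02.
    have := abs_cube_gauss_le x.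
    move: (normal_peak 1) (normal_peak 2) p1 p2 (expR _) (expR _) => a b a0 b0 u v h.
    exact: ratio_le.
rewrite ge0_integralZl//; last 3 first.
- exact: mpdf.
- by move=> x _; rewrite lee_fin normal_pdf_ge0.
- by rewrite lee_fin /C !mulr_ge0 ?invr_ge0 ?normal_peak_ge0.
by rewrite integral_normal_pdf mule1 ltry.
Qed.

(** Orders 1, 2 and 3 occur: integrability of an increment, the bracket, and the Taylor remainder.
    They enter upper bounds only, so finiteness and sign are what matters and no value is
    computed. *)
Definition normal_abs_moment (p : nat) : R :=
  fine (\int[normal_prob 0 (1:R)]_x (`|x| ^+ p)%:E).

Lemma normal_abs_moment_ge0 p : 0 <= normal_abs_moment p.
Proof. by apply: fine_ge0; apply: integral_ge0 => x _; rewrite lee_fin exprn_ge0. Qed.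

Lemma integral_normal_abs_moment p s : (p <= 3)%N -> 0 < s ->
  (\int[normal_prob 0 s]_x (`|x| ^+ p)%:E = (s ^+ p * normal_abs_moment p)%:E)%E.
Proof.
move=> p3 s0; rewrite integral_abs_moment_scale// EFinM; congr (_ * _)%E.
have cp q : continuous (fun x : R => `|x| ^+ q).
  move=> x; apply: (@continuous_comp _ _ _ (fun x : R => `|x|) (fun y => y ^+ q)).
    exact: norm_continuous.
  exact: exprn_continuous.
have mp q : measurable_fun setT (fun x : R => (`|x| ^+ q)%:E).
  by apply/measurable_EFinP; exact: continuous_measurable_fun.
rewrite fineK// ge0_fin_numE; last by apply: integral_ge0 => x _; rewrite lee_fin exprn_ge0.
apply: (@le_lt_trans _ _ (\int[normal_prob 0 (1:R)]_x (1 + (`|x| ^+ 3)%:E)))%E.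
  apply: ge0_le_integral => //.
  - exact: mp.
  - by apply: emeasurable_funD => //; exact: mp.
  - move=> x _; rewrite -EFinD lee_fin.
    have [x1|x1] := leP `|x| 1.
      by rewrite (le_trans (exprn_ile1 _ _ _))// lerDl exprn_ge0.
    by apply: (le_trans (ler_weXn2l (ltW x1) p3)); rewrite lerDr.
rewrite ge0_integralD//; last exact: mp.
have -> : (\int[normal_prob 0 (1:R)]_x 1 = 1)%E.
  transitivity (1 * normal_prob 0 (1:R) [set: R])%E; last first.
    by rewrite /normal_prob integral_normal_pdf mule1.
  exact: (integral_cst (normal_prob 0 (1:R)) measurableT 1%E).
by rewrite lte_add_pinfty ?ltry//; exact: normal_abs_cube_finite.
Qed.

Lemma integrable_normal_id s : 0 < s ->
  (normal_prob 0 s).-integrable setT (fun x : R => x%:E).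
Proof.
move=> s0; apply/integrableP; split; first exact/measurable_EFinP.
have := @integral_normal_abs_moment 1 s isT s0.
under eq_integral do rewrite expr1.
by move=> ->; rewrite ltry.
Qed.

(** By symmetry the positive and negative parts have the same integral, which is finite. *)
Lemma integral_normal_id s : 0 < s -> (\int[normal_prob 0 s]_x x%:E = 0)%E.
Proof.
move=> s0; rewrite integralE.
have -> : (\int[normal_prob 0 s]_x (fun x : R => x%:E)^\- x =
           \int[normal_prob 0 s]_x (fun x : R => x%:E)^\+ x)%E.
  have mf : measurable_fun setT (fun x : R => Num.max x 0).
    by apply: measurable_maxr => //; exact: measurable_id.
  transitivity (\int[normal_prob 0 s]_x (Num.max (- x) 0)%:E)%E.
    by apply: eq_integral => x _; rewrite funenegE -EFinN -EFin_max.
  rewrite (integral_opp_normal s0 mf); last by move=> x; rewrite le_max lexx orbT.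
  by apply: eq_integral => x _; rewrite funeposE -EFin_max.
apply: subee; apply: integrable_pos_fin_num => //; exact: integrable_normal_id.
Qed.

(** On [2 s, 3 s] the density is smallest at 3 s, and the length s of the interval cancels the 1 / s
    of the peak: the bound does not depend on s. *)
Lemma normal_prob_tail_ge s : 0 < s ->
  ((normal_peak 1 * expR (- (9 / 2)) : R)%:E <= normal_prob 0 s `[(2 * s)%R, +oo[)%E.
Proof.
move=> s0; rewrite /normal_prob.
apply: (@le_trans _ _ (\int[mu]_(x in `[(2 * s)%R, (3 * s)%R])
   (normal_peak s * expR (- (9 / 2)))%:E))%E.
  rewrite integral_cst//= lebesgue_measure_itv/= lte_fin ltr_pM2r// ltr_nat/=.
  rewrite -EFinB -EFinM lee_fin -mulrBl.
  have <- : normal_peak s * s = normal_peak 1.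
    rewrite /normal_peak -mulrnAr sqrtrM ?sqr_ge0// sqrtr_sqr gtr0_norm//.
    by rewrite expr1n mul1r invfM mulrAC mulVf ?mul1r// gt_eqF.
  by rewrite le_eqVlt; apply/orP; left; apply/eqP; ring.
apply: (@le_trans _ _ (\int[mu]_(x in `[(2 * s)%R, (3 * s)%R]) (normal_pdf 0 s x)%:E))%E.
  apply: ge0_le_integral => //.
  - by move=> x _; rewrite lee_fin mulr_ge0 ?normal_peak_ge0 ?expR_ge0.
  - exact: mpdf.
  - move=> x; rewrite /= in_itv/= => /andP[x2 x3].
    rewrite lee_fin normal_pdfE ?gt_eqF// ler_wpM2l ?normal_peak_ge0//.
    rewrite /normal_fun subr0 ler_expR mulNr lerN2 -mulr_natr.
    rewrite ler_pdivrMr ?mulr_gt0 ?exprn_gt0//.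
    nra.
apply: ge0_subset_integral => //; first exact: mpdf.
- by move=> x _; rewrite lee_fin normal_pdf_ge0.
- by move=> x; rewrite /= !in_itv/= => /andP[->].
Qed.

End gaussian_moments.

Section measurable_wrt_theory.
Context {d : measure_display} {Omega : measurableType d} {R : realType}.
Variable G : set (set Omega).
Implicit Types (f g : Omega -> R) (A B : set Omega).
Local Notation mw := (measurable_wrt <<s G>>).

Lemma mw_cst (c : R) : mw (cst c).
Proof. by apply/measurable_wrtP; exact: measurable_cst. Qed.

Lemma mwD f g : mw f -> mw g -> mw (fun w => f w + g w).
Proof. by move=> /measurable_wrtP mf /measurable_wrtP mg; apply/measurable_wrtP; exact: measurable_funD. Qed.

Lemma mwB f g : mw f -> mw g -> mw (fun w => f w - g w).
Proof. by move=> /measurable_wrtP mf /measurable_wrtP mg; apply/measurable_wrtP; exact: measurable_funB. Qed.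

Lemma mwM f g : mw f -> mw g -> mw (fun w => f w * g w).
Proof. by move=> /measurable_wrtP mf /measurable_wrtP mg; apply/measurable_wrtP; exact: measurable_funM. Qed.

Lemma mw_comp (h : R -> R) f : measurable_fun setT h -> mw f -> mw (fun w => h (f w)).
Proof. by move=> mh /measurable_wrtP mf; apply/measurable_wrtP; exact: (measurableT_comp mh mf). Qed.

Lemma mw_sum n (f : nat -> Omega -> R) : (forall i, (i < n)%N -> mw (f i)) ->
  mw (fun w => \sum_(i < n) f i w).
Proof.
elim: n => [|n ih] fi.
  by under [X in mw X]eq_fun do rewrite big_ord0; exact: mw_cst.
under [X in mw X]eq_fun do rewrite big_ord_recr/=.
by apply: mwD; [apply: ih => i /ltnW; exact: fi|exact: fi].
Qed.

Lemma mw_indic A : <<s G>> A -> mw (\1_A : Omega -> R).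
Proof.
move=> GA; apply/measurable_wrtP.
exact: (@measurable_indic _ (g_sigma_algebraType G) _ _ A).
Qed.

Lemma mw_preimage f (B : set R) : mw f -> measurable B -> <<s G>> (f @^-1` B).
Proof. by move=> mf mB; apply: mf; exists B => //; rewrite setTI. Qed.

End measurable_wrt_theory.

(** * Brownian increments and the augmented filtration *)

Section filtration.
Context {d : measure_display} {Omega : measurableType d} {R : realType}
  (P : probability Omega R).
Variable W : R -> {RV P >-> R}.
Implicit Types (s t u : R) (f : Omega -> R).
Local Notation F := (augmented_filtration P W).

Lemma process_events_measurable (T : set R) (X : R -> {RV P >-> R}) :
  process_events T (fun t => X t) `<=` measurable.
Proof. by move=> _ [s _ [B mB <-]]; exact: measurable_funP. Qed.

Lemma filtration_gen_measurable t :
  process_events `[0, t] W `|` null_sets P `<=` measurable.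
Proof. by move=> A [/process_events_measurable//|[]]. Qed.

Lemma filtration_measurable t : F t `<=` measurable.
Proof. exact/sigma_measurable/filtration_gen_measurable. Qed.

Lemma filtration_mono s t : s <= t -> F s `<=` F t.
Proof.
move=> st; apply: sub_smallest2r => //; apply: setSU => A [u us XA]; exists u => //.
by move: us; rewrite /= !in_itv/= => /andP[-> us]; exact: le_trans st.
Qed.

Lemma filtration_process s t : 0 <= s -> s <= t -> measurable_wrt (F t) (W s).
Proof.
move=> s0 st A XA; apply: sub_sigma_algebra; left; exists s => //.
by rewrite /= in_itv/= s0.
Qed.

Lemma mw_measurable t f : measurable_wrt (F t) f -> measurable_fun setT f.
Proof. exact/measurable_wrt_meas/filtration_measurable. Qed.

Hypothesis BM : brownian_motion W.

Definition incr (s t : R) : Omega -> R := W t \- W s.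

Lemma measurable_incr s t : measurable_fun setT (incr s t).
Proof. exact: measurable_funB. Qed.

Lemma mw_incr s t u : 0 <= s -> 0 <= t -> s <= u -> t <= u ->
  measurable_wrt (F u) (incr s t).
Proof. by move=> s0 t0 su tu; apply: mwB; exact: filtration_process. Qed.

Lemma incr_indep s t A (B : set R) : 0 <= s -> s < t -> F s A -> measurable B ->
  P (A `&` incr s t @^-1` B) = (P A * P (incr s t @^-1` B))%E.
Proof.
move=> s0 st FA mB; case: BM => _ _ _ ind.
have mC : measurable (incr s t @^-1` B).
  by rewrite -[X in measurable X]setTI; exact: measurable_incr.
apply: (indep_augment (process_events_measurable (T := `[0, s]) (X := W)) mC) => // A' FA'.
by apply: (ind s t s0 st) => //; exists B => //; rewrite setTI.
Qed.

(** This replaces conditioning on the past: no conditional expectation is used in the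
    development. *)
Lemma Ex_incrM s t (f : Omega -> R) (h : R -> R) : 0 <= s -> s < t ->
  measurable_wrt (F s) f -> measurable_fun setT h ->
  intg P f -> intg P (h \o incr s t) ->
  intg P (fun w => f w * h (incr s t w)) /\
  Ex P (fun w => f w * h (incr s t w)) = Ex P f * Ex P (h \o incr s t).
Proof.
move=> s0 st mf mh fi hi.
set G := process_events `[0, s] W `|` null_sets P.
have mid : measurable_fun setT (id : Omega -> g_sigma_algebraType G).
  by move=> _ A FA; rewrite setTI preimage_id; exact: (filtration_measurable (t := s)).
(* With the identity viewed as a map onto the space carrying only [F s], every [F s]-measurable [f]
   is a function of [X]. *)
pose X : {mfun Omega >-> g_sigma_algebraType G} :=
  HB.pack (id : Omega -> g_sigma_algebraType G) (isMeasurableFun.Build _ _ _ _ _ mid).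
pose Y : {mfun Omega >-> R} :=
  HB.pack (incr s t) (isMeasurableFun.Build _ _ _ _ _ (measurable_incr s t)).
have XY A B : measurable A -> measurable B ->
  P (X @^-1` A `&` Y @^-1` B) = (P (X @^-1` A) * P (Y @^-1` B))%E.
  by move=> FA mB; exact: incr_indep.
have mf' : measurable_fun setT (f : g_sigma_algebraType G -> R) by exact/measurable_wrtP.
split.
  exact: (indep_intgM XY mf' mh fi hi).
exact: (indep_ExM XY mf' mh fi hi).
Qed.

Lemma ge0_integral_incr s t (h : R -> R) : 0 <= s -> s < t ->
  measurable_fun setT h -> (forall x, 0 <= h x) ->
  (\int[P]_w (h (incr s t w))%:E = \int[normal_prob 0 (Num.sqrt (t - s))]_x (h x)%:E)%E.
Proof.
move=> s0 st mh h0; case: BM => _ _ inc _.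
have mY : measurable_fun setT (incr s t : Omega -> measurableTypeR R).
  exact: measurable_incr.
pose Y : {mfun Omega >-> measurableTypeR R} :=
  HB.pack (incr s t : Omega -> measurableTypeR R) (isMeasurableFun.Build _ _ _ _ _ mY).
transitivity (\int[distribution P Y]_x (h x)%:E)%E.
  by rewrite ge0_integral_distribution//; exact/measurable_EFinP.
by apply: eq_measure_integral => A mA _; exact: inc.
Qed.

Lemma intg_incr_pow s t p : 0 <= s -> s < t -> (p <= 3)%N ->
  intg P (fun w => `|incr s t w| ^+ p) /\
  Ex P (fun w => `|incr s t w| ^+ p) = Num.sqrt (t - s) ^+ p * normal_abs_moment p.
Proof.
move=> s0 st p3.
have cp : continuous (fun x : R => `|x| ^+ p).
  move=> x; apply: (@continuous_comp _ _ _ (fun x : R => `|x|) (fun y => y ^+ p)).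
    exact: norm_continuous.
  exact: exprn_continuous.
have mp := continuous_measurable_fun cp.
have := ge0_integral_incr s0 st mp (fun x => exprn_ge0 p (normr_ge0 x)).
rewrite integral_normal_abs_moment ?sqrtr_gt0 ?subr_gt0// => E.
split; last by rewrite /Ex /Rintegral E.
apply/integrableP; split.
  by apply/measurable_EFinP; exact: (measurableT_comp mp (measurable_incr s t)).
under eq_integral do rewrite /= ger0_norm ?exprn_ge0//.
by rewrite E ltry.
Qed.

Lemma intg_incr s t : 0 <= s -> s < t -> intg P (incr s t).
Proof.
move=> s0 st; have [i1 _] := intg_incr_pow s0 st (isT : (1 <= 3)%N).
apply: (intg_le (measurable_incr s t) _ i1) => w.
by rewrite expr1 normr_id.
Qed.

Lemma Ex_incr s t : 0 <= s -> s < t -> Ex P (incr s t) = 0.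
Proof.
move=> s0 st; case: BM => _ _ inc _.
have mY : measurable_fun setT (incr s t : Omega -> measurableTypeR R).
  exact: measurable_incr.
pose Y : {mfun Omega >-> measurableTypeR R} :=
  HB.pack (incr s t : Omega -> measurableTypeR R) (isMeasurableFun.Build _ _ _ _ _ mY).
apply/EFin_inj; rewrite EFin_Ex; last exact: intg_incr.
transitivity (\int[distribution P Y]_x x%:E)%E.
  by rewrite integral_distribution//; exact: intg_incr.
have sq0 : 0 < Num.sqrt (t - s) by rewrite sqrtr_gt0 subr_gt0.
rewrite -[RHS]/(0%E) -(integral_normal_id sq0).
by apply: eq_measure_integral => A mA _; exact: inc.
Qed.

(** The martingale property of one increment. The case [s = t] is included because a grid obtained
    by merging lists of times may repeat a point. *)
Lemma incr_mean s t f : 0 <= s -> s <= t -> measurable_wrt (F s) f -> intg P f ->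
  intg P (fun w => f w * incr s t w) /\ Ex P (fun w => f w * incr s t w) = 0.
Proof.
move=> s0; rewrite le_eqVlt => /orP[/eqP <-|st] mf fi.
  have -> : (fun w => f w * incr s s w) = cst 0.
    by apply/funext => w; rewrite /incr /= subrr mulr0.
  by split; [exact: intg_cst|exact: Ex_cst].
have [i E] := Ex_incrM s0 st mf (@measurable_id _ _ setT) fi (intg_incr s0 st).
by split => //; rewrite E Ex_incr// mulr0.
Qed.

Lemma incr_pow s t f p : 0 <= s -> s <= t -> (0 < p)%N -> (p <= 3)%N ->
  measurable_wrt (F s) f -> intg P f ->
  intg P (fun w => f w * `|incr s t w| ^+ p) /\
  Ex P (fun w => f w * `|incr s t w| ^+ p) =
    Num.sqrt (t - s) ^+ p * normal_abs_moment p * Ex P f.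
Proof.
move=> s0; rewrite le_eqVlt => /orP[/eqP <-|st] p0 p3 mf fi.
  have -> : (fun w => f w * `|incr s s w| ^+ p) = cst 0.
    by apply/funext => w; rewrite /incr /= subrr normr0 expr0n gtn_eqF// mulr0.
  split; first exact: intg_cst.
  by rewrite Ex_cst subrr sqrtr0 expr0n gtn_eqF// !mul0r.
have cp : continuous (fun x : R => `|x| ^+ p).
  move=> x; apply: (@continuous_comp _ _ _ (fun x : R => `|x|) (fun y => y ^+ p)).
    exact: norm_continuous.
  exact: exprn_continuous.
have [ip Ep] := intg_incr_pow s0 st p3.
have [i E] := Ex_incrM s0 st mf (continuous_measurable_fun cp) fi ip.
by split => //; rewrite E [X in _ * X]Ep mulrC.
Qed.

Lemma incr_sqr s t f : 0 <= s -> s <= t -> measurable_wrt (F s) f -> intg P f ->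
  intg P (fun w => f w * incr s t w ^+ 2) /\
  Ex P (fun w => f w * incr s t w ^+ 2) = (t - s) * normal_abs_moment 2 * Ex P f.
Proof.
move=> s0 st mf fi; have [] := incr_pow s0 st (isT : (0 < 2)%N) isT mf fi.
rewrite sqr_sqrtr ?subr_ge0//.
by under [X in intg P X]eq_fun do rewrite real_normK ?num_real//; under [X in Ex P X]eq_fun do rewrite real_normK ?num_real//.
Qed.

End filtration.

(** * Sums against Brownian increments *)

Section measurable_level_sets.
Context {d : measure_display} {Omega : measurableType d} {R : realType}.
Implicit Types f g : Omega -> R.

Lemma measurable_level_ge f (e : R) : measurable_fun setT f ->
  measurable [set w | e <= f w].
Proof.
move=> mf; have := mf measurableT _ (measurable_itv `[e, +oo[).
rewrite setTI; congr measurable; apply/seteqP; split=> w /=; rewrite in_itv/= andbT//.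
Qed.

Lemma measurable_level_gt f (e : R) : measurable_fun setT f ->
  measurable [set w | e < f w].
Proof.
move=> mf; have := mf measurableT _ (measurable_itv `]e, +oo[).
rewrite setTI; congr measurable; apply/seteqP; split=> w /=; rewrite in_itv/= andbT//.
Qed.

Lemma measurable_sum_ord n (f : nat -> Omega -> R) :
  (forall i, (i < n)%N -> measurable_fun setT (f i)) ->
  measurable_fun setT (fun w => \sum_(i < n) f i w).
Proof.
elim: n => [|n ih] fi.
  by under eq_fun do rewrite big_ord0; exact: measurable_cst.
under eq_fun do rewrite big_ord_recr/=.
by apply: measurable_funD; [apply: ih => i /ltnW; exact: fi|exact: fi].
Qed.

Lemma mw_level_le (G : set (set Omega)) f (e : R) : measurable_wrt <<s G>> f ->
  <<s G>> [set w | f w <= e].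
Proof.
move=> mf; have := mw_preimage mf (measurable_itv `]-oo, e]).
congr (<<s G>> _); apply/seteqP; split=> w /=; rewrite in_itv/=//.
Qed.

End measurable_level_sets.

(** * Discrete stochastic integrals: isometry and Lenglart's inequality *)

Section grid_integral.
Context {d : measure_display} {Omega : measurableType d} {R : realType}
  (P : probability Omega R).
Variable W : R -> {RV P >-> R}.
Hypothesis BM : brownian_motion W.
Local Notation F := (augmented_filtration P W).
Local Notation v := (@normal_abs_moment R 2).

Variable u : nat -> R.
Hypotheses (u0 : forall i, 0 <= u i) (ule : forall i, u i <= u i.+1).

Definition grid_sum (g : nat -> Omega -> R) n w : R :=
  \sum_(i < n) g i w * incr W (u i) (u i.+1) w.

Lemma grid_le i j : (i <= j)%N -> u i <= u j.
Proof.
elim: j => [|j ih]; first by rewrite leqn0 => /eqP ->.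
rewrite leq_eqVlt => /orP[/eqP -> //|]; rewrite ltnS => /ih h.
exact: le_trans (ule j).
Qed.

Lemma mw_grid_sum g n : (forall i, (i < n)%N -> measurable_wrt (F (u i)) (g i)) ->
  measurable_wrt (F (u n)) (grid_sum g n).
Proof.
move=> mg; apply: (mw_sum (f := fun i w => g i w * incr W (u i) (u i.+1) w)) => i lin.
apply: mwM; first by apply: measurable_wrtS (mg i lin); apply: filtration_mono; apply: grid_le; exact: ltnW.
by apply: mw_incr => //; apply: grid_le => //; exact: ltnW.
Qed.

(** The discrete Ito isometry, by induction: in the square of the sum the cross term is an
    [F (u n)]-measurable factor times the next increment, hence has mean zero. *)
Lemma grid_sum_sqr g n :
  (forall i, (i < n)%N -> measurable_wrt (F (u i)) (g i)) ->
  (forall i, (i < n)%N -> exists M : R, forall w, `|g i w| <= M) ->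
  intg P (fun w => grid_sum g n w ^+ 2) /\
  Ex P (fun w => grid_sum g n w ^+ 2) =
    v * Ex P (fun w => \sum_(i < n) g i w ^+ 2 * (u i.+1 - u i)).
Proof.
elim: n => [|n ih] mg bg.
  have -> : (fun w => grid_sum g 0 w ^+ 2) = cst 0.
    by apply/funext => w; rewrite /grid_sum big_ord0 expr0n.
  split; first exact: intg_cst.
  have -> : (fun w : Omega => \sum_(i < 0) g i w ^+ 2 * (u i.+1 - u i)) = cst 0.
    by apply/funext => w; rewrite big_ord0.
  by rewrite Ex_cst mulr0.
have [i2 E2] := ih (fun i h => mg i (leqW h)) (fun i h => bg i (leqW h)).
have [M gM] := bg n (ltnSn n).
have mgn := mg n (ltnSn n).
have mgn' := mw_measurable mgn.
have mS := mw_grid_sum (fun i (h : (i < n)%N) => mg i (leqW h)).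
have mS' := mw_measurable mS.
have iS : intg P (grid_sum g n).
  apply: (intg_le mS' _ (intgD (intg_cst P 1) i2)) => w /=.
  rewrite [leRHS]ger0_norm ?addr_ge0 ?sqr_ge0//.
  have [h|h] := leP `|grid_sum g n w| 1; first by rewrite (le_trans h)// lerDl sqr_ge0.
  rewrite -(@real_normK _ (grid_sum g n w)) ?num_real// expr2.
  have := ler_peMl (normr_ge0 (grid_sum g n w)) (ltW h); lra.
pose f w := 2 * grid_sum g n w * g n w.
have mf : measurable_wrt (F (u n)) f.
  by apply: mwM => //; apply: mwM => //; exact: mw_cst.
have if_ : intg P f.
  apply: (intg_le (mw_measurable mf) _ (intgZ (2 * M) iS)) => w /=.
  rewrite /f !normrM mulrAC ler_wpM2r// ler_wpM2l//.
  by rewrite (le_trans (gM w))// ler_norm.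
have mg2 : measurable_wrt (F (u n)) (fun w => g n w ^+ 2).
  by under [X in measurable_wrt _ X]eq_fun do rewrite expr2; exact: mwM.
have ig2 : intg P (fun w => g n w ^+ 2).
  apply: (intg_bd P (M := M ^+ 2) (mw_measurable mg2)) => w.
  by rewrite normrX lerXn2r ?nnegrE ?normr_ge0// (le_trans _ (gM w)).
have [ia Ea] := incr_mean BM (u0 n) (ule n) mf if_.
have [ib Eb] := incr_sqr BM (u0 n) (ule n) mg2 ig2.
have -> : (fun w => grid_sum g n.+1 w ^+ 2) =
  (fun w => grid_sum g n w ^+ 2 + f w * incr W (u n) (u n.+1) w +
     g n w ^+ 2 * incr W (u n) (u n.+1) w ^+ 2).
  by apply/funext => w; rewrite /grid_sum big_ord_recr/= -/(grid_sum g n w) /f; ring.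
split; first by apply: intgD => //; exact: intgD.
rewrite (ExD (intgD i2 ia) ib) (ExD i2 ia) Ea addr0 E2 Eb.
under [in RHS]eq_Ex do rewrite big_ord_recr/= [X in _ + X]mulrC.
rewrite ExD//; last exact: intgZ.
  by rewrite ExZ// mulrDr; congr (_ + _); rewrite mulrA (mulrC _ v).
apply: (intg_sum (f := fun i w => g i w ^+ 2 * (u i.+1 - u i))) => i lin.
under [X in intg _ X]eq_fun do rewrite mulrC.
apply: intgZ; have [Mi gMi] := bg i (leqW lin).
have mgi := mw_measurable (mg i (leqW lin)).
apply: (intg_bd P (M := Mi ^+ 2)); first exact: measurable_funX.
by move=> w; rewrite normrX lerXn2r ?nnegrE ?normr_ge0// (le_trans _ (gMi w)).
Qed.

(* Lenglart's inequality: stop the sum before its bracket exceeds the level [a]. *)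
Lemma grid_sum_tail g n (e a : R) : 0 < e -> 0 <= a ->
  (forall i, (i < n)%N -> measurable_wrt (F (u i)) (g i)) ->
  (forall i, (i < n)%N -> exists M : R, forall w, `|g i w| <= M) ->
  Pr P [set w | e <= `|grid_sum g n w|] <=
    v * a / e ^+ 2 + Pr P [set w | a < \sum_(i < n) g i w ^+ 2 * (u i.+1 - u i)].
Proof.
move=> e0 a0 mg bg.
pose Q j w := \sum_(i < j) g i w ^+ 2 * (u i.+1 - u i).
have Qle j w : Q j w <= Q j.+1 w.
  by rewrite /Q [leRHS]big_ord_recr/= lerDl mulr_ge0 ?sqr_ge0// subr_ge0.
have Qmono i j w : (i <= j)%N -> Q i w <= Q j w.
  elim: j => [|j ih]; first by rewrite leqn0 => /eqP ->.
  rewrite leq_eqVlt => /orP[/eqP -> //|]; rewrite ltnS => /ih h.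
  exact: le_trans (Qle _ _).
have mQ j : (j < n)%N -> measurable_wrt (F (u j)) (Q j.+1).
  move=> jn; apply: (mw_sum (f := fun i w => g i w ^+ 2 * (u i.+1 - u i))) => i ij.
  apply: mwM; last exact: mw_cst.
  under [X in measurable_wrt _ X]eq_fun do rewrite expr2.
  have h : measurable_wrt (F (u j)) (g i).
    apply: measurable_wrtS (mg i (leq_trans ij jn)).
    by apply: filtration_mono; apply: grid_le; rewrite -ltnS.
  exact: mwM.
(* [Q i.+1] involves [g] up to index i only, so it is known at time [u i] and the stopped
   coefficients remain adapted. *)
pose g' i w := g i w * \1_[set w | Q i.+1 w <= a] w.
have mg' i : (i < n)%N -> measurable_wrt (F (u i)) (g' i).
  move=> lin; apply: mwM; first exact: mg.
  by apply: mw_indic; apply: mw_level_le; exact: mQ.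
have bg' i : (i < n)%N -> exists M : R, forall w, `|g' i w| <= M.
  move=> lin; have [M gM] := bg i lin; exists M => w.
  rewrite /g' normrM (le_trans _ (gM w))// ler_piMr// indicE.
  by case: (_ \in _); rewrite ?normr1 ?normr0.
have [i2 E2] := grid_sum_sqr mg' bg'.
have Q' j w : \sum_(i < j) g' i w ^+ 2 * (u i.+1 - u i) <= Q j w.
  apply: ler_sum => i _; rewrite ler_wpM2r ?subr_ge0// /g' indicE.
  by case: (_ \in _); rewrite ?mulr1 ?mulr0 ?expr0n ?sqr_ge0.
(* Either [Q j.+1] is still below [a], or the last coefficient has been set to 0 and the induction
   hypothesis applies. *)
have Q'a j w : \sum_(i < j) g' i w ^+ 2 * (u i.+1 - u i) <= a.
  elim: j => [|j ih]; first by rewrite big_ord0.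
  have [/set_mem h|h] := boolP (w \in [set w | Q j.+1 w <= a]).
    exact: le_trans (Q' j.+1 w) h.
  by rewrite big_ord_recr/= {2}/g' indicE (negbTE h) mulr0 expr0n mul0r addr0.
have mS := mw_measurable (mw_grid_sum mg).
have mS' := mw_measurable (mw_grid_sum mg').
have mQn : measurable_fun setT (Q n).
  apply: (measurable_sum_ord (f := fun i w => g i w ^+ 2 * (u i.+1 - u i))) => i lin.
  by apply: measurable_funM => //; apply: measurable_funX; exact: mw_measurable (mg i lin).
apply: (@le_trans _ _ (Pr P ([set w | e ^+ 2 <= grid_sum g' n w ^+ 2] `|`
                             [set w | a < Q n w]))).
  apply: le_Pr.
  - by apply: measurable_level_ge; exact: measurableT_comp.
  - apply: measurableU; first by apply: measurable_level_ge; exact: measurable_funX.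
    exact: measurable_level_gt.
  - move=> w /= eS; have [h|h] := leP (Q n w) a; [left|by right].
    (* [Q] is nondecreasing in its index, so a final value at most [a] means that no coefficient was
       stopped. *)
    have -> : grid_sum g' n w = grid_sum g n w.
      apply: eq_bigr => i _; rewrite /g' indicE mem_set ?mulr1//=.
      by apply: le_trans h; exact: Qmono.
    rewrite -(@real_normK _ (grid_sum g n w)) ?num_real//.
    by rewrite lerXn2r ?nnegrE// ltW.
apply: le_trans (PrU _ _ _) _; [by apply: measurable_level_ge; exact: measurable_funX|exact: measurable_level_gt|].
rewrite lerD2r.
apply: (le_trans (markov_Pr (f := fun w => grid_sum g' n w ^+ 2) (e := e ^+ 2) _ _ _ _ _)) => //.
- by apply: measurable_level_ge; exact: measurable_funX.
- by rewrite exprn_gt0.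
- by move=> w; exact: sqr_ge0.
rewrite ler_pM2r ?invr_gt0 ?exprn_gt0// E2 ler_wpM2l ?normal_abs_moment_ge0//.
rewrite -[leRHS](Ex_cst P); apply: le_Ex => //; last exact: intg_cst.
apply: (intg_bd P (M := a)); last first.
  move=> w; rewrite ger0_norm// sumr_ge0// => i _.
  by rewrite mulr_ge0 ?sqr_ge0// subr_ge0.
apply: (measurable_sum_ord (f := fun i w => g' i w ^+ 2 * (u i.+1 - u i))) => i lin.
by apply: measurable_funM => //; apply: measurable_funX; exact: mw_measurable (mg' i lin).
Qed.

End grid_integral.

Section step_functions.
Context {R : realType}.
Local Notation mu := (@lebesgue_measure R).
Variables (u : nat -> R) (phi : R -> R).
Hypothesis ule : forall i, u i <= u i.+1.

(** Cells are open on the left, as are the intervals of a simple process; the value on a cell is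
    therefore read at its right end. *)
Lemma integral_step_function n : measurable_fun setT phi ->
  (forall s, 0 <= phi s) ->
  (forall l s, (l < n)%N -> u l < s -> s <= u l.+1 -> phi s = phi (u l.+1)) ->
  (\int[mu]_(s in `]u 0%N, u n]) (phi s)%:E =
   (\sum_(l < n) phi (u l.+1) * (u l.+1 - u l))%:E)%E.
Proof.
move=> mphi phi0; elim: n => [|n ih] phiE.
  rewrite set_itv_ge ?bnd_simp ?ltxx//; first by rewrite integral_set0 big_ord0.
have un : u 0%N <= u n by elim: n {ih phiE} => // n h; exact: le_trans (ule n).
have -> : [set` `]u 0%N, u n.+1]] = `]u 0%N, u n] `|` `]u n, u n.+1].
  by rewrite -itv_bndbnd_setU// bnd_simp.
rewrite ge0_integral_setU//=; last 3 first.
- by apply/measurable_EFinP; exact: measurable_funTS.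
- by move=> s _; rewrite lee_fin.
- apply/disj_setPRL => s /=; rewrite !in_itv/= => /andP[s1 _] /andP[_ s2].
  by move: s1; rewrite ltNge s2.
rewrite ih; last by move=> l s ln; apply: phiE; exact: ltnW.
rewrite big_ord_recr/= EFinD; congr (_ + _)%E.
transitivity (\int[mu]_(s in `]u n, u n.+1]) (phi (u n.+1))%:E)%E.
  apply: eq_integral => s; rewrite inE/= in_itv/= => /andP[s1 s2].
  by rewrite (phiE n s).
rewrite integral_cst//= lebesgue_measure_itv/= lte_fin.
case: ltP => [h|h]; first by rewrite -EFinD.
by rewrite mule0 (_ : u n.+1 = u n) ?subrr ?mulr0//; apply/eqP; rewrite eq_le h ule.
Qed.

End step_functions.

(** * A common grid for finitely many times *)

Section sorted_grid.
Context {R : realType}.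
Variables (r : seq R) (t : R).
Hypotheses (t0 : 0 <= t) (r0t : {in r, forall x, 0 <= x <= t}).

Definition sgrid : seq R := sort <=%O [:: 0, t & r].
(** The default value [t] makes the sequence stationary past the end of the list: it stays
    nondecreasing and within [0, t] for every index. *)
Definition sgridn (i : nat) : R := nth t sgrid i.

Lemma mem_sgrid x : (x \in sgrid) = (x \in [:: 0, t & r]).
Proof. by rewrite mem_sort. Qed.

Lemma sgrid_bounds x : x \in sgrid -> 0 <= x <= t.
Proof.
rewrite mem_sgrid !inE => /orP[/eqP ->|/orP[/eqP ->|/r0t//]].
  by rewrite lexx.
by rewrite lexx andbT.
Qed.

Lemma sgridn_bounds i : 0 <= sgridn i <= t.
Proof.
have [h|h] := ltnP i (size sgrid); first by apply/sgrid_bounds/mem_nth.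
by rewrite /sgridn nth_default// t0 lexx.
Qed.

Lemma sgridn_le i j : (i <= j)%N -> sgridn i <= sgridn j.
Proof.
move=> ij; have [h|h] := ltnP j (size sgrid); last first.
  by rewrite [leRHS]/sgridn nth_default//; case/andP: (sgridn_bounds i).
apply: (sorted_leq_nth le_trans le_refl) => //; last by rewrite inE (leq_ltn_trans ij).
exact: (sort_sorted le_total).
Qed.

Lemma sgridn0 : sgridn 0 = 0.
Proof.
have : 0 \in sgrid by rewrite mem_sgrid inE eqxx.
move=> /(nthP t)[i _ iE].
apply/eqP; rewrite eq_le; case/andP: (sgridn_bounds 0) => -> _; rewrite andbT.
by rewrite -[leRHS]iE; exact: (sgridn_le (leq0n i)).
Qed.

Lemma sgridn_size : sgridn (size sgrid) = t.
Proof. by rewrite /sgridn nth_default. Qed.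

Lemma sgrid_gap a l : a \in sgrid -> a <= sgridn l \/ sgridn l.+1 <= a.
Proof.
move=> /(nthP t)[i _ <-]; have [il|il] := leqP i l.
  by left; exact: (sgridn_le il).
by right; exact: (sgridn_le il).
Qed.

Lemma sgrid_telescope (f : R -> R) b : b \in sgrid ->
  \sum_(l < size sgrid | sgridn l.+1 <= b) (f (sgridn l.+1) - f (sgridn l)) = f b - f 0.
Proof.
move=> bs; rewrite big_mkcond/=.
have -> : f b - f 0 = f (Num.min (sgridn (size sgrid)) b) - f (Num.min (sgridn 0) b).
  have /andP[b0 bt] := sgrid_bounds bs.
  by rewrite sgridn0 sgridn_size (min_idPr bt) (min_idPl b0).
rewrite -(telescope_sumr (fun l => f (Num.min (sgridn l) b)))// big_mkord.
apply: eq_bigr => l _; case: ifPn => [h|]; last rewrite -ltNge => h.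
  by rewrite !(min_idPl _)//; exact: le_trans (sgridn_le (leqnSn l)) h.
have [h'|h'] := sgrid_gap l bs; last by move: h; rewrite ltNge h'.
by rewrite !(min_idPr _) ?subrr// ltW.
Qed.

(** Splits an increment over ]a, b] along the grid. Since no grid point lies inside a cell, whether
    the cell is contained in ]a, b] is decided at its right end. *)
Lemma sgrid_telescope_itv (f : R -> R) a b : a \in sgrid -> b \in sgrid -> a <= b ->
  \sum_(l < size sgrid) \1_(`]a, b]) (sgridn l.+1) * (f (sgridn l.+1) - f (sgridn l))
  = f b - f a.
Proof.
move=> aS bS ab.
have -> : f b - f a = (f b - f 0) - (f a - f 0) by ring.
rewrite -(sgrid_telescope f bS) -(sgrid_telescope f aS) !(big_mkcond (fun l => sgridn _ <= _))/=.
rewrite -sumrB; apply: eq_bigr => l _; rewrite indicE mem_setE/= in_itv/=.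
have [h|h] := leP (sgridn l.+1) a; last by rewrite subr0; case: ifP => _; rewrite ?mul1r ?mul0r.
by rewrite (le_trans h ab) subrr mul0r.
Qed.

End sorted_grid.

(** * Comparing the integrals of two simple processes *)

Section simple_processes.
Context {d : measure_display} {Omega : measurableType d} {R : realType}
  (P : probability Omega R).
Variable W : R -> {RV P >-> R}.
Hypothesis BM : brownian_motion W.
Local Notation F := (augmented_filtration P W).
Local Notation v := (@normal_abs_moment R 2).
Local Notation simple := (@simple_process _ Omega R).
Implicit Types (H K : simple).

Definition clipped_times H (t : R) : seq R :=
  [seq Num.min (sp_time H i) t | i <- iota 0 (sp_size H).+1].

Lemma sp_time_ge0 H i : sp_adapted F H -> 0 <= sp_time H i.
Proof. by move=> [h0 hle _]; elim: i => // i ih; exact: le_trans (hle i). Qed.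

Lemma mem_clipped_times H t i : (i <= sp_size H)%N ->
  Num.min (sp_time H i) t \in clipped_times H t.
Proof. by move=> h; apply/mapP; exists i => //; rewrite mem_iota. Qed.

Lemma clipped_times_bounds H t : 0 <= t -> sp_adapted F H ->
  {in clipped_times H t, forall x, 0 <= x <= t}.
Proof.
move=> t0 aH x /mapP[i _ ->]; rewrite ge_min lexx orbT andbT le_min t0 andbT.
exact: sp_time_ge0.
Qed.

Section on_grid.
Variables (H : simple) (t : R) (r : seq R).
Hypotheses (t0 : 0 <= t) (aH : sp_adapted F H).
Hypotheses (r0t : {in r, forall x, 0 <= x <= t}) (Hr : {subset clipped_times H t <= r}).
Local Notation u := (sgridn r t).
Local Notation n := (size (sgrid r t)).

Let time_in i : (i <= sp_size H)%N -> Num.min (sp_time H i) t \in sgrid r t.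
Proof. by move=> h; rewrite mem_sgrid !inE Hr ?orbT//; exact: mem_clipped_times. Qed.

(** No jump time of [H] falls in the interior of a cell, so the comparison with a jump time is
    constant along the cell. *)
Let time_lt i l s : (i <= sp_size H)%N -> u l < s -> s <= u l.+1 ->
  (sp_time H i < s) = (sp_time H i < u l.+1).
Proof.
move=> iH ls sl; apply/idP/idP => [h|h]; first exact: lt_le_trans sl.
have /andP[_ ut] := sgridn_bounds t0 r0t l.+1.
have mi : Num.min (sp_time H i) t = sp_time H i by apply/min_idPl/ltW/(lt_le_trans h).
have [h'|h'] := sgrid_gap t0 r0t l (time_in iH); rewrite mi in h'.
  exact: le_lt_trans ls.
by move: h; rewrite ltNge h'.
Qed.

Lemma sp_val_grid l s w : u l < s -> s <= u l.+1 ->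
  sp_val H s w = sp_val H (u l.+1) w.
Proof.
move=> ls sl; apply: eq_bigr => i _; congr (_ * _); rewrite !indicE !mem_setE/= !in_itv/=.
by rewrite (time_lt _ ls sl) ?(ltnW (ltn_ord i))// !leNgt (time_lt _ ls sl) ?ltn_ord.
Qed.

Lemma sp_integral_grid w :
  sp_integral W H t w = grid_sum W u (fun l => sp_val H (u l.+1)) n w.
Proof.
rewrite /sp_integral /grid_sum /sp_val.
under [RHS]eq_bigr do rewrite big_distrl/=.
rewrite exchange_big/=; apply: eq_bigr => i _.
have [_ hle _] := aH.
have ab : Num.min (sp_time H i) t <= Num.min (sp_time H i.+1) t.
  by rewrite le_min !ge_min hle lexx orbT.
rewrite -(sgrid_telescope_itv t0 r0t (fun s => W s w) (time_in (ltnW (ltn_ord i)))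
  (time_in (ltn_ord i)) ab).
rewrite big_distrr/=; apply: eq_bigr => l _; rewrite mulrA; congr (_ * _ * _).
have /andP[_ ut] := sgridn_bounds t0 r0t l.+1.
by rewrite !indicE !mem_setE/= !in_itv/= gt_min le_min ut andbT [t < _]ltNge ut orbF.
Qed.

(** Predictability: a coefficient active at [u l.+1] was fixed strictly before that point, hence,
    there being no grid point in between, at a time not later than [u l]. *)
Lemma mw_sp_val_grid l : measurable_wrt (F (u l)) (sp_val H (u l.+1)).
Proof.
have [_ _ hc] := aH.
apply: (mw_sum (f := fun i w => sp_coef H i w * \1_(`]sp_time H i, sp_time H i.+1]) (u l.+1))) => i iH.
have [h|h] := ltP (sp_time H i) (u l.+1); last first.
  have -> : (fun w => sp_coef H i w * \1_(`]sp_time H i, sp_time H i.+1]) (u l.+1)) = cst 0.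
    by apply/funext => w; rewrite indicE mem_setE/= in_itv/= ltNge h mulr0.
  exact: mw_cst.
apply: mwM; last exact: mw_cst.
have [mc _] := hc i iH.
apply: measurable_wrtS mc; apply: filtration_mono.
have /andP[_ ut] := sgridn_bounds t0 r0t l.+1.
have mi : Num.min (sp_time H i) t = sp_time H i by apply/min_idPl/ltW/(lt_le_trans h).
have [h'|h'] := sgrid_gap t0 r0t l (time_in (ltnW iH)); rewrite mi in h' => //.
by move: h; rewrite ltNge h'.
Qed.

Lemma bounded_sp_val s : exists M : R, forall w, `|sp_val H s w| <= M.
Proof.
have [_ _ hc] := aH; rewrite /sp_val.
suff : forall m, (m <= sp_size H)%N -> exists M : R, forall w,
  `|\sum_(i < m) sp_coef H i w * \1_(`]sp_time H i, sp_time H i.+1]) s| <= M.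
  by apply.
elim=> [|m ih] mH; first by exists 0 => w; rewrite big_ord0 normr0.
have [M hM] := ih (ltnW mH); have [_ [M' hM']] := hc m mH.
exists (M + M') => w; rewrite big_ord_recr/=.
apply: le_trans (ler_normD _ _) _; apply: lerD => //.
rewrite normrM (le_trans _ (hM' w))// ler_piMr// indicE.
by case: (_ \in _); rewrite ?normr1 ?normr0.
Qed.

End on_grid.

Lemma measurable_sp_val H w : measurable_fun setT (fun s => sp_val H s w).
Proof.
apply: (measurable_sum_ord (f := fun i s => sp_coef H i w * \1_(`]sp_time H i, sp_time H i.+1]) s)) => i _.
apply: measurable_funM => //.
Qed.

(* The two integrals are compared on the grid merging both sets of times. *)
Lemma sp_integral_dist_tail H K (t e a : R) : 0 <= t -> 0 < e -> 0 <= a ->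
  sp_adapted F H -> sp_adapted F K ->
  Pr P [set w | e <= `|sp_integral W H t w - sp_integral W K t w|] <=
    v * a / e ^+ 2 +
    Pr P [set w | a < \int[lebesgue_measure]_(s in `[0, t])
                       (sp_val H s w - sp_val K s w) ^+ 2].
Proof.
move=> t0 e0 a0 aH aK.
pose r := clipped_times H t ++ clipped_times K t.
have r0t : {in r, forall x, 0 <= x <= t}.
  by move=> x; rewrite mem_cat => /orP[]; exact: clipped_times_bounds.
have Hr : {subset clipped_times H t <= r} by move=> x; rewrite mem_cat => ->.
have Kr : {subset clipped_times K t <= r} by move=> x; rewrite mem_cat => ->; rewrite orbT.
pose u := sgridn r t; pose n := size (sgrid r t).
pose g l w := sp_val H (u l.+1) w - sp_val K (u l.+1) w.
have u0 i : 0 <= u i by have /andP[] := sgridn_bounds t0 r0t i.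
have ule i : u i <= u i.+1 by exact: (sgridn_le t0 r0t).
have mg i : (i < n)%N -> measurable_wrt (F (u i)) (g i).
  by move=> _; apply: mwB; exact: mw_sp_val_grid.
have bg i : (i < n)%N -> exists M : R, forall w, `|g i w| <= M.
  move=> _; have [M1 h1] := bounded_sp_val aH (u i.+1).
  have [M2 h2] := bounded_sp_val aK (u i.+1).
  by exists (M1 + M2) => w; apply: le_trans (ler_normB _ _) _; exact: lerD.
have := grid_sum_tail BM u0 ule e0 a0 mg bg.
congr (Pr P _ <= _ + Pr P _).
  apply/funext => w /=; congr (is_true (_ <= `|_|)).
  rewrite (sp_integral_grid t0 aH r0t Hr) (sp_integral_grid t0 aK r0t Kr).
  by rewrite /grid_sum -sumrB; apply: eq_bigr => l _; rewrite /g mulrBl.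
apply/funext => w /=; congr (is_true (_ < _)).
have mphi : measurable_fun setT (fun s => (sp_val H s w - sp_val K s w) ^+ 2).
  by apply: measurable_funX; apply: measurable_funB; exact: measurable_sp_val.
have phiE l s : (l < n)%N -> u l < s -> s <= u l.+1 ->
    (sp_val H s w - sp_val K s w) ^+ 2 = (sp_val H (u l.+1) w - sp_val K (u l.+1) w) ^+ 2.
  move=> _ ls sl.
  by rewrite (sp_val_grid t0 r0t Hr w ls sl) (sp_val_grid t0 r0t Kr w ls sl).
have := integral_step_function ule mphi (fun s => sqr_ge0 _) phiE.
rewrite /u sgridn0// /n sgridn_size => E.
(* The cells cover ]0, t] while the bracket is an integral over [0, t]; the point 0 is
   negligible. *)
rewrite /Rintegral -integral_itv_obnd_cbnd ?E//.
by apply/measurable_EFinP; exact: measurable_funTS.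
Qed.

End simple_processes.

(** * Grid approximation of the Ito integral *)

Section paths.
Context {R : realType}.
Local Notation mu := (@lebesgue_measure R).
Implicit Types f g : R -> R.

(** Paths are controlled on the half-line only. Clamping time at 0 yields a function continuous on
    all of R without changing it where it matters. *)
Lemma continuous_clamp f : {within `[0, +oo[, continuous f} ->
  continuous (fun s : R => f (Num.max s 0)).
Proof.
move=> /subspace_continuousP cf s.
have s0 : `[0, +oo[%classic (Num.max s 0) by rewrite /= in_itv/= andbT le_max lexx orbT.
have h := cf _ s0.
apply: (cvg_trans _ h) => U /= hU.
have cm : Num.max (y : R) 0 @[y --> s] --> Num.max s 0.
  by apply: continuous_max; [exact: cvg_id|exact: cvg_cst].
have := cm _ hU; rewrite /= !nbhs_simpl/=; apply: filterS => y /=; apply.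
by rewrite in_itv/= andbT le_max lexx orbT.
Qed.

Lemma path_integrable f (T : R) : {within `[0, +oo[, continuous f} ->
  mu.-integrable `[0, T] (EFin \o f).
Proof.
move=> cf; apply: continuous_compact_integrable; first exact: segment_compact.
apply: continuous_subspaceW cf => x /=; rewrite !in_itv/= andbT.
by case/andP.
Qed.

Lemma path_bounded f (T : R) : {within `[0, +oo[, continuous f} ->
  exists C : R, 0 <= C /\ forall s : R, 0 <= s -> s <= T -> `|f s| <= C.
Proof.
move=> cf; have [T0|T0] := leP 0 T; last first.
  by exists 0; split => // s s0 sT; move: (le_lt_trans (le_trans s0 sT) T0); rewrite ltxx.
have cg : {within `[0, T], continuous (fun s : R => `|f (Num.max s 0)|)}.
  apply: continuous_subspaceT => s; apply: (@continuous_comp _ _ _ (fun s : R => f (Num.max s 0)) (fun y : R => `|y|)).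
    exact: continuous_clamp.
  exact: norm_continuous.
have [c _ h] := EVT_max T0 cg.
exists `|f (Num.max c 0)|; split => // s s0 sT.
by have := h s; rewrite in_itv/= s0 sT (max_l s0) => /(_ isT).
Qed.

Lemma bounded_itv_integrable g (T C : R) : measurable_fun `[0, T] g ->
  (forall s : R, 0 <= s -> s <= T -> `|g s| <= C) -> mu.-integrable `[0, T] (EFin \o g).
Proof.
move=> mg gC; apply: measurable_bounded_integrable => //.
  rewrite /= lebesgue_measure_itv/=; case: ifP => _; last exact: ltry.
  by rewrite -EFinD ltry.
exists C; split; first exact: num_real.
move=> x Cx s /=; rewrite in_itv/= => /andP[s0 sT].
exact: le_trans (gC _ s0 sT) (ltW Cx).
Qed.

End paths.

(** * Joint measurability in time and randomness *)

Section joint_measurability.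
Context {d : measure_display} {Omega : measurableType d} {R : realType}.
Local Notation mu := (@lebesgue_measure R).

(** The process is the pointwise limit of its discretisations at the left multiples of 1 / (m + 1);
    each of these is measurable piece by piece, the pieces being products of an interval and an
    event. *)
Lemma measurable_process (X : R -> Omega -> R) :
  (forall s : R, 0 <= s -> measurable_fun setT (X s)) ->
  (forall w, {within `[0, +oo[, continuous (X^~ w)}) ->
  measurable_fun setT (fun z : R * Omega => X (Num.max z.1 0) z.2).
Proof.
move=> mX cX.
pose k m (s : R) := Num.truncn (Num.max s 0 * m.+1%:R).
pose Xm m (z : R * Omega) := X ((k m z.1)%:R / m.+1%:R) z.2.
apply: (@measurable_fun_cvg _ _ _ _ Xm).
  move=> m _ B mB; rewrite setTI.
  have -> : Xm m @^-1` B = \bigcup_j ([set s | k m s = j] `*` (X (j%:R / m.+1%:R) @^-1` B)).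
    apply/seteqP; split=> [[s w] /= XB|[s w] [j _ [/= kj XB]]].
      by exists (k m s).
    by rewrite /Xm /preimage /= kj.
  apply: bigcupT_measurable => j; apply: measurableX; last first.
    rewrite -[X in measurable X]setTI; apply: mX => //.
  have mh : measurable_fun setT (fun s : R => Num.max s 0 * m.+1%:R).
    apply: continuous_measurable_fun => s; apply: cvgM; last exact: cvg_cst.
    by apply: continuous_max; [exact: cvg_id|exact: cvg_cst].
  rewrite (_ : [set s | _] = (fun s : R => Num.max s 0 * m.+1%:R) @^-1` `[j%:R, j.+1%:R[).
    by rewrite -[X in measurable X]setTI; apply: mh => //; exact: measurable_itv.
  apply/seteqP; split=> s /=; rewrite in_itv/=.
    by move=> <-; apply: truncn_itv; rewrite mulr_ge0// le_max lexx orbT.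
  by move/truncn_def.
move=> [s w] _ /=; rewrite /Xm /=.
set s' := Num.max s 0; have s'0 : 0 <= s' by rewrite le_max lexx orbT.
have -> : (fun m => X ((k m s)%:R / m.+1%:R) w) =
          (fun m => X (Num.max ((k m s)%:R / m.+1%:R) 0) w).
  by apply/funext => m; rewrite max_l// divr_ge0.
have -> : X s' w = X (Num.max s' 0) w by rewrite max_l.
apply: (@cvg_comp _ _ _ (fun m => (k m s)%:R / m.+1%:R) (fun y : R => X (Num.max y 0) w) _ (nbhs s')); last exact: (@continuous_clamp _ _ (cX w) s').
apply/cvgrPdist_le => e /= e0; near=> m.
have km : (k m s)%:R <= s' * m.+1%:R < (k m s).+1%:R by apply: truncn_itv; rewrite mulr_ge0.
have m0 : 0 < m.+1%:R :> R by rewrite ltr0n.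
have /ltW me : m.+1%:R^-1 < e.
  near: m; exact: (near_infty_natSinv_lt (PosNum e0)).
rewrite (_ : s' - _ = (s' * m.+1%:R - (k m s)%:R) / m.+1%:R); last first.
  by rewrite mulrBl mulfK ?gt_eqF.
case/andP: km => k1 k2; rewrite ger0_norm; last by rewrite divr_ge0// subr_ge0.
rewrite (le_trans _ me)// ler_piMl ?invr_ge0 ?(ltW m0)//.
by rewrite lerBlDl natr1 ltW.
Unshelve. all: by end_near. Qed.

Lemma measurable_path_integral (f : R * Omega -> R) (D : set R) :
  measurable D -> measurable_fun setT f -> (forall z, 0 <= f z) ->
  measurable_fun setT (fun w => \int[mu]_(s in D) f (s, w)).
Proof.
move=> mD mf f0; apply: (measurableT_comp (fine_measurable measurableT)).
have m1 : measurable_fun setT (fun z : measurableTypeR R * Omega => (f z * \1_D z.1)%:E).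
  apply/measurable_EFinP; apply: measurable_funM => //.
  apply: (measurableT_comp (f := \1_D : measurableTypeR R -> R)).
    exact: measurable_indic.
  exact: measurable_fst.
have := @measurable_fun_fubini_tonelli_G _ _ _ _ _ mu _ m1.
rewrite (_ : fubini_G _ _ = (fun w => \int[mu]_(s in D) (f (s, w))%:E)%E).
  by apply => z; rewrite lee_fin mulr_ge0.
apply/funext => w; rewrite /fubini_G/= [RHS]integral_mkcond.
apply: eq_integral => s _; rewrite patchE indicE.
by case: ifPn => _; rewrite ?mulr1 ?mulr0.
Qed.

End joint_measurability.

(** * Left-endpoint approximation of a continuous process *)

Section grid_approximation.
Context {d : measure_display} {Omega : measurableType d} {R : realType}.
Local Notation mu := (@lebesgue_measure R).
Variables (X : R -> Omega -> R) (T : R).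

(** The cap at [m] makes the coefficients bounded, as [sp_adapted] requires; it disappears in the
    limit because every path is bounded on [0, T]. *)
Definition gridP (m : nat) : @simple_process _ Omega R :=
  SimpleProcess m (fun i => i%:R * (T / m%:R))
    (fun i w => Num.min (X (i%:R * (T / m%:R)) w) m%:R).

Definition grid_err (m : nat) (w : Omega) : R :=
  \int[mu]_(s in `[0, T]) (X s w - sp_val (gridP m) s w) ^+ 2.

Hypothesis T0 : 0 < T.
Hypothesis X0 : forall (s : R) w, 0 <= s -> 0 <= X s w.
Hypothesis mX : forall s : R, 0 <= s -> measurable_fun setT (X s).
Hypothesis cX : forall w, {within `[0, +oo[, continuous (X^~ w)}.

Lemma grid_index (h s : R) m : 0 < h -> 0 < s -> s <= m%:R * h ->
  exists i, [/\ (i < m)%N, i%:R * h < s & s <= i.+1%:R * h].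
Proof.
move=> h0 s0 sm.
have exj : exists j, s <= j%:R * h by exists m.
case: (ex_minnP exj) => -[|i] hi mini.
  by move: hi; rewrite mul0r leNgt s0.
exists i; split => //; first exact: mini.
by rewrite ltNge; apply/negP => /mini; rewrite ltnn.
Qed.

Lemma gridP_val m i (s : R) w : (i < m)%N -> i%:R * (T / m%:R) < s ->
  s <= i.+1%:R * (T / m%:R) ->
  sp_val (gridP m) s w = Num.min (X (i%:R * (T / m%:R)) w) m%:R.
Proof.
move=> im si sS; rewrite /sp_val (bigD1 (Ordinal im))//= big1 ?addr0.
  by rewrite indicE mem_setE/= in_itv/= si sS mulr1.
move=> j /eqP ji; rewrite indicE mem_setE/= in_itv/=.
have h0 : 0 < T / m%:R by rewrite divr_gt0// ltr0n (leq_ltn_trans _ im).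
have [jlt|ilt|E] := ltngtP j i; last by exfalso; apply: ji; exact/val_inj.
- rewrite [s <= _](_ : _ = false) ?andbF ?mulr0//; apply/negbTE; rewrite -ltNge.
  by apply: le_lt_trans si; rewrite ler_pM2r// ler_nat.
- rewrite [_ < s](_ : _ = false) ?mulr0//; apply/negbTE; rewrite -leNgt.
  by apply: (le_trans sS); rewrite ler_pM2r// ler_nat.
Qed.

Lemma gridP_val_cvg (s : R) w : 0 < s -> s <= T -> sp_val (gridP m) s w @[m --> \oo] --> X s w.
Proof.
move=> s0 sT; apply/cvgrPdist_lt => e /= e0.
have /cvgrPdist_lt /(_ e e0) := @continuous_clamp _ _ (@cX w) s.
rewrite max_l ?(ltW s0)// => -[r /= r0 hr].
near=> m.
have m0 : (0 < m)%N by near: m; exact: nbhs_infty_gt.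
have mR : 0 < m%:R :> R by rewrite ltr0n.
have h0 : 0 < T / m%:R by rewrite divr_gt0.
have smh : s <= m%:R * (T / m%:R) by rewrite mulrC divfK ?gt_eqF.
have [i [im si sS]] := grid_index h0 s0 smh.
rewrite (gridP_val w im si sS).
have ti0 : 0 <= i%:R * (T / m%:R) by rewrite mulr_ge0// ltW.
have Td : T / m%:R < r.
  rewrite ltr_pdivrMr// mulrC -ltr_pdivrMr//; near: m.
  exact: nbhs_infty_gtr.
have hd : `|X s w - X (i%:R * (T / m%:R)) w| < e.
  have := hr (i%:R * (T / m%:R)); rewrite max_l//; apply.
  rewrite /= gtr0_norm ?subr_gt0// (le_lt_trans _ Td)//.
  by move: sS; rewrite -natr1 mulrDl mul1r lerBlDl.
rewrite min_l//; have Xm : X s w + e <= m%:R by near: m; exact: nbhs_infty_ger.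
apply: le_trans Xm; rewrite -lerBlDl; apply/ltW/(le_lt_trans (ler_norm _)).
by rewrite distrC.
Unshelve. all: by end_near. Qed.

Lemma grid_err_integrand_bound w : exists C : R, forall m (s : R), 0 < s -> s <= T ->
  `|(X s w - sp_val (gridP m) s w) ^+ 2| <= C.
Proof.
have [C [C0 hC]] := path_bounded T (@cX w).
exists (C ^+ 2) => m s s0 sT.
(* For [m = 0] the mesh [T / m%:R] is 0 by convention and the process is the empty sum, so the grid
   argument starts at [m.+1]. *)
case: m => [|m].
  rewrite /sp_val big_ord0 subr0 normrX lerXn2r ?nnegrE//.
  exact: hC (ltW s0) sT.
have mR : 0 < m.+1%:R :> R by rewrite ltr0n.
have h0 : 0 < T / m.+1%:R by rewrite divr_gt0.
have smh : s <= m.+1%:R * (T / m.+1%:R) by rewrite mulrC divfK ?gt_eqF.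
have [i [im si sS]] := grid_index h0 s0 smh.
rewrite (gridP_val w im si sS).
have ti0 : 0 <= i%:R * (T / m.+1%:R) by rewrite mulr_ge0// ltW.
have := hC _ (ltW s0) sT; have := hC _ ti0 (le_trans (ltW si) sT).
have := X0 w (ltW s0); have := X0 w ti0.
move: (X s w) (X _ w) => x y y0 x0; rewrite (ger0_norm y0) (ger0_norm x0) => yC xC.
rewrite normrX lerXn2r ?nnegrE//.
have : 0 <= Num.min y m.+1%:R by rewrite le_min y0 ltW.
have : Num.min y m.+1%:R <= y by rewrite ge_min lexx.
by move: (Num.min _ _) => z z1 z0; rewrite ler_norml; apply/andP; split; lra.
Qed.

Let X' (s : R) w := X (Num.max s 0) w.

Let mX' w : measurable_fun setT (X'^~ w).
Proof. by apply: continuous_measurable_fun; exact: (@continuous_clamp _ _ (@cX w)). Qed.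

Lemma measurable_grid_err_integrand m w :
  measurable_fun `[0, T] (fun s => (X s w - sp_val (gridP m) s w) ^+ 2).
Proof.
apply: (@eq_measurable_fun _ _ _ _ _ (fun s => (X' s w - sp_val (gridP m) s w) ^+ 2)).
  by move=> s; rewrite inE/= in_itv/= => /andP[s0 _]; rewrite /X' max_l.
apply: measurable_funTS; apply: measurable_funX; apply: measurable_funB.
  exact: mX'.
exact: measurable_sp_val.
Qed.

Lemma grid_err_cvg w : grid_err m w @[m --> \oo] --> 0.
Proof.
rewrite /grid_err /Rintegral; apply: fine_cvg.
have [C hC] := grid_err_integrand_bound w.
(* Simple processes vanish at time 0, so pointwise convergence holds on ]0, T] and the negligible
   point 0 is removed first. *)
have mi m : measurable_fun `]0, T] (fun s => ((X s w - sp_val (gridP m) s w) ^+ 2)%:E).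
  apply/measurable_EFinP; apply: measurable_funS (measurable_grid_err_integrand m w) => //.
  exact: subset_itv_oc_cc.
rewrite (_ : _ @ \oo = (\int[mu]_(s in `]0%R, T]) ((X s w - sp_val (gridP m) s w) ^+ 2)%:E)%E @[m --> \oo]); last first.
  by congr (_ @ \oo); apply/funext => m /=; rewrite integral_itv_obnd_cbnd.
rewrite (_ : 0%:E = \int[mu]_(s in `]0%R, T]) (cst 0%E s))%E; last by rewrite integral0.
apply: (@dominated_cvg _ _ _ mu _ _ _ _ (cst C%:E)) => //.
- move=> s /=; rewrite in_itv/= => /andP[s0 sT].
  apply: cvg_EFin; first by near=> m.
  rewrite [X in _ --> X](_ : _ = (X s w - X s w) ^+ 2); last by rewrite subrr expr0n.
  apply: (@cvg_comp _ _ _ (fun m => X s w - sp_val (gridP m) s w) (fun y : R => y ^+ 2) _ (nbhs (X s w - X s w))); last exact: exprn_continuous.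
  by apply: cvgB; [exact: cvg_cst|exact: gridP_val_cvg].
- apply/integrableP; split; first exact: measurable_cst.
  rewrite integral_cst//=; rewrite lebesgue_measure_itv/=; case: ifP => _; last by rewrite mule0 ltry.
  by rewrite -EFinD -EFinM ltry.
- by move=> m s /=; rewrite in_itv/= => /andP[s0 sT]; rewrite lee_fin; exact: hC.
Unshelve. all: by end_near. Qed.

Lemma measurable_grid_err m : measurable_fun setT (grid_err m).
Proof.
have h : measurable_fun setT
    (fun z : R * Omega => (X' z.1 z.2 - sp_val (gridP m) z.1 z.2) ^+ 2).
  apply: measurable_funX; apply: measurable_funB; first exact: measurable_process.
  apply: (measurable_sum_ord (f := fun i (z : R * Omega) => sp_coef (gridP m) i z.2 *
    \1_(`]sp_time (gridP m) i, sp_time (gridP m) i.+1]) z.1)) => i _.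
  apply: measurable_funM.
    apply: (measurableT_comp (f := sp_coef (gridP m) i)); last exact: measurable_snd.
    apply: measurable_minr; last exact: measurable_cst.
    by apply: mX; rewrite mulr_ge0// divr_ge0// ltW.
  apply: (measurableT_comp (f := \1_(`]sp_time (gridP m) i, sp_time (gridP m) i.+1]) : R -> R)).
    exact: measurable_indic.
  exact: measurable_fst.
have := measurable_path_integral (measurable_itv `[0, T]) h (fun z => sqr_ge0 _).
apply: eq_measurable_fun => w _; apply: eq_Rintegral => s.
by rewrite inE/= in_itv/= => /andP[s0 _]; rewrite /X' max_l.
Qed.

End grid_approximation.

Section convergence_in_probability.
Context {d : measure_display} {Omega : measurableType d} {R : realType}
  (P : probability Omega R).

Lemma Pr_level_cvg0 (f : nat -> Omega -> R) (e : R) : 0 < e ->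
  (forall n, measurable_fun setT (f n)) ->
  {ae P, forall w, f n w @[n --> \oo] --> 0} ->
  Pr P [set w | e <= f n w] @[n --> \oo] --> 0.
Proof.
move=> e0 mf cf.
have mA n : measurable [set w | e <= f n w] by exact: measurable_level_ge.
under eq_fun do rewrite -Ex_indic//.
rewrite -(Ex_cst P 0); apply: (Ex_dominated (M := 1)).
- by move=> n; exact: measurable_indic.
- exact: measurable_cst.
- by move=> n w; rewrite indicE; case: (_ \in _); rewrite ?normr1 ?normr0.
- apply: filterS cf => w /cvgrPdist_lt /(_ e e0) [N _ hN].
  apply: cvg_near_cst; exists N => // n Nn; rewrite indicE memNset//=.
  apply/negP; rewrite -ltNge; have := hN n Nn; rewrite sub0r normrN.
  exact: le_lt_trans (ler_norm _).
Qed.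

End convergence_in_probability.

Section almost_sure_tools.
Context {d : measure_display} {Omega : measurableType d} {R : realType}
  (P : probability Omega R).

Lemma le_Pr_ae (A B : set Omega) : measurable A -> measurable B ->
  {ae P, forall w, A w -> B w} -> Pr P A <= Pr P B.
Proof.
move=> mA mB [N [mN N0 hN]]; rewrite -lee_fin !EFin_Pr//.
apply: (measure_le_off_null mA mB mN N0) => w Nw Aw.
by apply: contrapT => Bw; apply: Nw; apply: hN => /(_ Aw).
Qed.

Lemma cvg_in_probability_Pr (X_ : nat -> Omega -> R) X (e : R) : 0 < e ->
  cvg_in_probability P X_ X ->
  Pr P [set w | e <= `|X_ n w - X w|] @[n --> \oo] --> 0.
Proof. by move=> e0 /(_ e e0) h; exact: fine_cvg. Qed.

End almost_sure_tools.

Section simple_process_paths.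
Context {d : measure_display} {Omega : measurableType d} {R : realType}.
Local Notation mu := (@lebesgue_measure R).
Implicit Types H : @simple_process _ Omega R.

Lemma sp_val_bounded H w : exists C : R, forall s, `|sp_val H s w| <= C.
Proof.
exists (\sum_(i < sp_size H) `|sp_coef H i w|) => s.
apply: (le_trans (ler_norm_sum _ _ _)); apply: ler_sum => i _.
rewrite normrM ler_piMr// indicE; by case: (_ \in _); rewrite ?normr1 ?normr0.
Qed.

Lemma measurable_sp_val_joint H :
  (forall i, (i < sp_size H)%N -> measurable_fun setT (sp_coef H i)) ->
  measurable_fun setT (fun z : R * Omega => sp_val H z.1 z.2).
Proof.
move=> mc.
apply: (measurable_sum_ord (f := fun i (z : R * Omega) => sp_coef H i z.2 *
  \1_(`]sp_time H i, sp_time H i.+1]) z.1)) => i iH.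
apply: measurable_funM.
  by apply: (measurableT_comp (f := sp_coef H i)); [exact: mc|exact: measurable_snd].
apply: (measurableT_comp (f := \1_(`]sp_time H i, sp_time H i.+1]) : R -> R)).
  exact: measurable_indic.
exact: measurable_fst.
Qed.

Lemma measurable_sp_integral (P : probability Omega R) (W : R -> {RV P >-> R}) H t :
  (forall i, (i < sp_size H)%N -> measurable_fun setT (sp_coef H i)) ->
  measurable_fun setT (sp_integral W H t).
Proof.
move=> mc.
apply: (measurable_sum_ord (f := fun i w => sp_coef H i w *
    (W (Num.min (sp_time H i.+1) t) w - W (Num.min (sp_time H i) t) w))) => i iH.
by apply: measurable_funM; [exact: mc|exact: measurable_funB].
Qed.

Lemma itv_integrableZ (g : R -> R) (T c : R) : mu.-integrable `[0, T] (EFin \o g) ->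
  mu.-integrable `[0, T] (EFin \o (fun s => c * g s)).
Proof.
have mT : measurable (`[0, T]%classic : set (measurableTypeR R)) by exact: measurable_itv.
by move=> gi; exact: (integrableZl mT c gi).
Qed.

Lemma itv_integrableD (f g : R -> R) (T : R) : mu.-integrable `[0, T] (EFin \o f) ->
  mu.-integrable `[0, T] (EFin \o g) ->
  mu.-integrable `[0, T] (EFin \o (fun s => f s + g s)).
Proof.
have mT : measurable (`[0, T]%classic : set (measurableTypeR R)) by exact: measurable_itv.
by move=> fi gi; exact: (integrableD mT fi gi).
Qed.

Lemma Rintegral_itv_le (f : R -> R) (t T : R) : t <= T ->
  (forall s, 0 <= f s) -> mu.-integrable `[0, T] (EFin \o f) ->
  \int[mu]_(s in `[0, t]) f s <= \int[mu]_(s in `[0, T]) f s.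
Proof.
move=> tT f0 fi.
have sub : `[0, t] `<=` `[0, T] by apply: subset_itvl; rewrite bnd_simp.
have fi' : mu.-integrable `[0, t] (EFin \o f) by exact: integrableS fi.
rewrite -lee_fin /Rintegral !fineK; [|exact: (integrable_fin_num _ fi)|exact: (integrable_fin_num _ fi')].
apply: ge0_subset_integral => //.
  exact: measurable_int fi.
by move=> s _; rewrite lee_fin.
Qed.

(* |g| <= c + g^2/c trades the L1 distance for the L2 one. *)
Lemma Rintegral_norm_le_sqr (g : R -> R) (T c : R) : 0 <= T -> 0 < c ->
  mu.-integrable `[0, T] (EFin \o g) ->
  mu.-integrable `[0, T] (EFin \o (fun s => g s ^+ 2)) ->
  \int[mu]_(s in `[0, T]) `|g s| <= c * T + (\int[mu]_(s in `[0, T]) g s ^+ 2) / c.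
Proof.
move=> T0 c0 ig ig2.
have ic : mu.-integrable `[0, T] (EFin \o (cst c : R -> R)).
  by apply: (bounded_itv_integrable (C := `|c|)) => //; exact: measurable_cst.
have ic2 : mu.-integrable `[0, T] (EFin \o (fun s => c^-1 * g s ^+ 2)).
  exact: itv_integrableZ.
apply: (@le_trans _ _ (\int[mu]_(s in `[0, T]) (c + c^-1 * g s ^+ 2))).
  apply: le_Rintegral => //; first exact: integrable_norm.
    exact: (itv_integrableD ic ic2).
  move=> s _.
  rewrite -(@ler_pM2l _ c)// mulrDr mulrA mulfV ?gt_eqF// mul1r -(real_normK (num_real (g s))).
  have := normr_ge0 (g s); move: `|g s| => y y0; nra.
rewrite RintegralD// RintegralZl// Rintegral_cst//= lebesgue_measure_itv/= lte_fin.
rewrite mulrC [_^-1 * _]mulrC lerD2r; case: ltP => h /=.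
  by rewrite oppr0 addr0 mulrC.
by rewrite mul0r mulr_ge0// ltW.
Qed.

End simple_process_paths.

(** * Identification of the Ito integral with its grid sums *)

Section ito_grid.
Context {d : measure_display} {Omega : measurableType d} {R : realType}
  (P : probability Omega R).
Variable W : R -> {RV P >-> R}.
Hypothesis BM : brownian_motion W.
Local Notation F := (augmented_filtration P W).
Local Notation v := (@normal_abs_moment R 2).
Local Notation mu := (@lebesgue_measure R).

Variable S : R -> Omega -> R.
Hypothesis S0 : forall (s : R) w, 0 <= s -> 0 <= S s w.
Hypothesis adS : forall s : R, 0 <= s -> measurable_wrt (F s) (S s).
Hypothesis cS : forall w, {within `[0, +oo[, continuous (S^~ w)}.

Let mS (s : R) : 0 <= s -> measurable_fun setT (S s).
Proof. by move=> s0; exact: mw_measurable (adS s0). Qed.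

Lemma gridP_adapted (T : R) m : 0 <= T -> sp_adapted F (gridP S T m).
Proof.
move=> T0; have h0 : 0 <= T / m%:R by rewrite divr_ge0.
split => /=.
- by rewrite mul0r.
- by move=> i; rewrite ler_wpM2r// ler_nat.
- move=> i im; have ti : 0 <= i%:R * (T / m%:R) by rewrite mulr_ge0.
  split.
    apply: (mw_comp (h := fun y => Num.min y m%:R)); last exact: adS.
    by apply: measurable_minr => //; exact: measurable_cst.
  exists m%:R => w; rewrite ger0_norm ?ge_min ?lexx ?orbT//.
  by rewrite le_min S0 ?ler0n.
Qed.

(** The sequence witnessing [is_ito_integral] is an intermediary: it is compared with [I] by
    definition and with [gridP] by Lenglart's inequality, and then sent to its limit. The remaining
    bound mentions only the error of the grid on [0, T], so it is the same for every [t]. *)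
Lemma ito_grid_tail (T t e a : R) m (I : Omega -> R) : 0 < T -> 0 <= t -> t <= T ->
  0 < e -> 0 < a -> measurable_fun setT I -> is_ito_integral F W S t I ->
  Pr P [set w | e <= `|I w - sp_integral W (gridP S T m) t w|] <=
    v * a / (e / 2) ^+ 2 + Pr P [set w | a / 4 <= grid_err S T m w].
Proof.
move=> T0 t0 tT e0 a0 mI [H_ [aH cH cI]].
set K := gridP S T m.
have aK : sp_adapted F K by apply: gridP_adapted; exact: ltW.
have mcoef H : sp_adapted F H ->
    forall i, (i < sp_size H)%N -> measurable_fun setT (sp_coef H i).
  by move=> [_ _ hc] i iH; have [h _] := hc i iH; exact: mw_measurable h.
have mKI := measurable_sp_integral W t (mcoef _ aK).
have mHI n := measurable_sp_integral W t (mcoef _ (aH n)).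
pose D n w := \int[mu]_(s in `[0, t]) (S s w - sp_val (H_ n) s w) ^+ 2.
have mD n : measurable_fun setT (D n).
  have h : measurable_fun setT
      (fun z : R * Omega => (S (Num.max z.1 0) z.2 - sp_val (H_ n) z.1 z.2) ^+ 2).
    apply: measurable_funX; apply: measurable_funB; first exact: measurable_process.
    by apply: measurable_sp_val_joint; exact: mcoef.
  have := measurable_path_integral (measurable_itv `[0, t]) h (fun z => sqr_ge0 _).
  apply: eq_measurable_fun => w _; apply: eq_Rintegral => s.
  by rewrite inE/= in_itv/= => /andP[s0 _]; rewrite max_l.
have mgrid : measurable_fun setT (grid_err S T m) by exact: measurable_grid_err.
have iSH H w (t' : R) : mu.-integrable `[0, t'] (EFin \o (fun s => (S s w - sp_val H s w) ^+ 2)).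
  have [C1 [C10 h1]] := path_bounded t' (@cS w); have [C2 h2] := sp_val_bounded H w.
  apply: (bounded_itv_integrable (C := (C1 + C2) ^+ 2)).
    apply: measurable_funX; apply: measurable_funB.
      apply: (@eq_measurable_fun _ _ _ _ _ (fun s : R => S (Num.max s 0) w)).
        by move=> s; rewrite inE/= in_itv/= => /andP[s0 _]; rewrite max_l.
      apply: measurable_funTS; apply: continuous_measurable_fun.
      exact: (@continuous_clamp _ _ (@cS w)).
    by apply: measurable_funTS; exact: measurable_sp_val.
  move=> s s0 st; rewrite normrX lerXn2r ?nnegrE//.
    by rewrite addr_ge0// (le_trans _ (h2 0)).
  by apply: (le_trans (ler_normB _ _)); apply: lerD => //; exact: h1.
have key n : Pr P [set w | e <= `|I w - sp_integral W K t w|] <=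
    Pr P [set w | e / 2 <= `|sp_integral W (H_ n) t w - I w|] +
    Pr P [set w | a / 4 <= `|D n w - cst 0 w|] +
    (v * a / (e / 2) ^+ 2 + Pr P [set w | a / 4 <= grid_err S T m w]).
  have e20 : 0 < e / 2 by rewrite divr_gt0.
  have := sp_integral_dist_tail BM t0 e20 (ltW a0) (aH n) aK.
  set J := (fun w => \int[mu]_(s in `[0, t]) (sp_val (H_ n) s w - sp_val K s w) ^+ 2).
  rewrite -/(J _) => hJ.
  have mJ : measurable_fun setT J.
    have h : measurable_fun setT
      (fun z : R * Omega => (sp_val (H_ n) z.1 z.2 - sp_val K z.1 z.2) ^+ 2).
      apply: measurable_funX; apply: measurable_funB.
        by apply: measurable_sp_val_joint; exact: mcoef.
      by apply: measurable_sp_val_joint; exact: mcoef.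
    exact: (measurable_path_integral (measurable_itv `[0, t]) h (fun z => sqr_ge0 _)).
  have m1 : measurable [set w | e / 2 <= `|sp_integral W (H_ n) t w - I w|].
    by apply: measurable_level_ge; apply: measurableT_comp => //; exact: measurable_funB.
  have m2 : measurable [set w | e / 2 <= `|sp_integral W (H_ n) t w - sp_integral W K t w|].
    by apply: measurable_level_ge; apply: measurableT_comp => //; exact: measurable_funB.
  have m3 : measurable [set w | a / 4 <= `|D n w - cst 0 w|].
    by apply: measurable_level_ge; apply: measurableT_comp => //; apply: measurable_funB => //; exact: measurable_cst.
  have m4 : measurable [set w | a / 4 <= grid_err S T m w] by exact: measurable_level_ge.
  have m5 : measurable [set w | a < J w] by exact: measurable_level_gt.
  have h1 : Pr P [set w | e <= `|I w - sp_integral W K t w|] <=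
      Pr P [set w | e / 2 <= `|sp_integral W (H_ n) t w - I w|] +
      Pr P [set w | e / 2 <= `|sp_integral W (H_ n) t w - sp_integral W K t w|].
    apply: le_trans (PrU P m1 m2); apply: le_Pr.
    - by apply: measurable_level_ge; apply: measurableT_comp => //; exact: measurable_funB.
    - exact: measurableU.
    - move=> w /= ew; apply/orP; rewrite -[_ || _]negbK negb_or -!ltNge; apply/negP => /andP[q1 q2].
      move: ew; apply/negP; rewrite -ltNge.
      have -> : I w - sp_integral W K t w =
        - (sp_integral W (H_ n) t w - I w) + (sp_integral W (H_ n) t w - sp_integral W K t w) by ring.
      apply: (le_lt_trans (ler_normD _ _)); rewrite normrN.
      by rewrite (splitr e); exact: ltrD.
  have h2 : Pr P [set w | a < J w] <= Pr P [set w | a / 4 <= `|D n w - cst 0 w|] +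
      Pr P [set w | a / 4 <= grid_err S T m w].
    apply: le_trans (PrU P m3 m4); apply: le_Pr => //; first exact: measurableU.
    move=> w /= ew; apply/orP; rewrite -[_ || _]negbK negb_or -!ltNge; apply/negP => /andP[q1 q2].
    move: ew; apply/negP; rewrite -leNgt.
    have D0 : 0 <= D n w by apply: Rintegral_ge0 => s _; exact: sqr_ge0.
    rewrite subr0 ger0_norm// in q1.
    (* From (y - z)^2 <= 2 (x - y)^2 + 2 (x - z)^2; two errors below [a / 4] then keep the bracket
       below [a]. *)
    have : J w <= 2 * D n w + 2 * grid_err S T m w; last by lra.
    apply: (@le_trans _ _ (2 * D n w + 2 * \int[mu]_(s in `[0, t]) (S s w - sp_val K s w) ^+ 2)); last first.
      rewrite lerD2l ler_pM2l//; apply: Rintegral_itv_le => //.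
      by move=> s; exact: sqr_ge0.
    rewrite -RintegralZl//.
    rewrite -RintegralZl//.
    have i1 := itv_integrableZ 2 (iSH (H_ n) w t).
    have i2 := itv_integrableZ 2 (iSH K w t).
    rewrite -RintegralD//.
    apply: le_Rintegral => //.
    - have [C1 h1'] := sp_val_bounded (H_ n) w; have [C2 h2'] := sp_val_bounded K w.
      apply: (bounded_itv_integrable (C := (C1 + C2) ^+ 2)).
        apply: measurable_funTS; apply: measurable_funX; apply: measurable_funB; exact: measurable_sp_val.
      move=> s _ _; rewrite normrX lerXn2r ?nnegrE//.
        by rewrite addr_ge0// ?(le_trans _ (h1' 0))// (le_trans _ (h2' 0)).
      by apply: (le_trans (ler_normB _ _)); exact: lerD.
    - exact: (itv_integrableD i1 i2).
    - move=> s _; move: (S s w) (sp_val _ s w) (sp_val K s w) => x y z.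
      have := sqr_ge0 (x - y + (x - z)); nra.
  by apply: (le_trans h1); rewrite -addrA lerD2l (le_trans hJ)// addrCA lerD2l.
apply/ler_addgt0Pr => c c0.
have c20 : 0 < c / 2 by rewrite divr_gt0.
have e20 : 0 < e / 2 by rewrite divr_gt0.
have a40 : 0 < a / 4 by rewrite divr_gt0.
have /cvgrPdist_lt /(_ _ c20) [n1 _ hn1] := cvg_in_probability_Pr e20 cI.
have /cvgrPdist_lt /(_ _ c20) [n2 _ hn2] := cvg_in_probability_Pr a40 cH.
have := hn1 (maxn n1 n2) (leq_maxl _ _); have := hn2 (maxn n1 n2) (leq_maxr _ _).
rewrite /= !sub0r !normrN !(ger0_norm (Pr_ge0 _ _)) => q1 q2.
apply: (le_trans (key (maxn n1 n2))); rewrite addrC lerD2l (splitr c).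
by apply: lerD; apply/ltW.
Qed.

End ito_grid.

Lemma Rintegral_itv_cst {R : realType} (c t : R) : 0 <= t ->
  \int[@lebesgue_measure R]_(s in `[0, t]) c = c * t.
Proof.
move=> t0; rewrite Rintegral_cst//= lebesgue_measure_itv/= lte_fin.
case: ltP => h /=; first by rewrite oppr0 addr0.
by rewrite (_ : t = 0) ?mulr0//; apply/eqP; rewrite eq_le h.
Qed.

(** * Euler scheme of the CIR equation *)

Section euler_scheme.
Context {d : measure_display} {Omega : measurableType d} {R : realType}
  (P : probability Omega R).
Variable W : R -> {RV P >-> R}.
Hypothesis BM : brownian_motion W.
Local Notation F := (augmented_filtration P W).
Local Notation v := (@normal_abs_moment R 2).
Local Notation mu := (@lebesgue_measure R).

Variables (k theta gamma x : R) (X : R -> {RV P >-> R}).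
Hypotheses (k0 : 0 < k) (gamma0 : 0 < gamma).
Hypothesis cirX : cir_strong_solution k theta gamma W x X.

Let S (s : R) w : R := gamma * Num.sqrt (X s w).

Lemma cir_ge0 (s : R) w : 0 <= s -> 0 <= X s w.
Proof. by case: cirX => _ X0 _ _ _; exact: X0. Qed.

Lemma cir_continuous w : {within `[0, +oo[, continuous ((fun s => X s)^~ w)}.
Proof. by case: cirX => cX _ _ _ _; exact: cX. Qed.

Lemma cir_adapted (s : R) : 0 <= s -> measurable_wrt (F s) (X s).
Proof. by case: cirX => _ _ adX _ _; exact: adX. Qed.

Lemma cir_vol_ge0 (s : R) w : 0 <= s -> 0 <= S s w.
Proof. by move=> s0; rewrite mulr_ge0// ?sqrtr_ge0// ltW. Qed.

Lemma cir_vol_continuous w : {within `[0, +oo[, continuous (S^~ w)}.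
Proof.
move=> s; apply: cvgM; first exact: cvg_cst.
exact: (cvg_comp _ _ (@cir_continuous w s) (@sqrt_continuous _ _)).
Qed.

Lemma cir_vol_adapted (s : R) : 0 <= s -> measurable_wrt (F s) (S s).
Proof.
move=> s0; apply: mwM; first exact: mw_cst.
apply: (mw_comp (h := fun y : R => Num.sqrt y)); last exact: cir_adapted.
by apply: continuous_measurable_fun; exact: sqrt_continuous.
Qed.

Variable T : R.
Hypothesis T0 : 0 < T.

Definition tgrid (m i : nat) : R := i%:R * (T / m%:R).

Lemma tgridS m i : tgrid m i.+1 - tgrid m i = T / m%:R.
Proof. by rewrite /tgrid -natr1 mulrDl mul1r addrC addKr. Qed.

Lemma tgrid_ge0 m i : 0 <= tgrid m i.
Proof. by rewrite mulr_ge0// divr_ge0// ltW. Qed.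

Lemma tgrid_leS m i : tgrid m i <= tgrid m i.+1.
Proof. by rewrite -subr_ge0 tgridS divr_ge0// ltW. Qed.

Lemma tgrid_le_mono m i j : (i <= j)%N -> tgrid m i <= tgrid m j.
Proof. by move=> ij; rewrite ler_wpM2r ?ler_nat// divr_ge0// ltW. Qed.

Lemma tgrid_leT m i : (0 < m)%N -> (i <= m)%N -> tgrid m i <= T.
Proof.
move=> m0 im; apply: (le_trans (tgrid_le_mono m im)).
by rewrite /tgrid mulrC divfK// pnatr_eq0 -lt0n.
Qed.

Lemma sp_integral_gridP (Y : R -> Omega -> R) m j w : (j <= m)%N ->
  sp_integral W (gridP Y T m) (tgrid m j) w =
  \sum_(i < j) Num.min (Y (tgrid m i) w) m%:R * incr W (tgrid m i) (tgrid m i.+1) w.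
Proof.
move=> jm.
rewrite (big_ord_widen m (fun i : nat => Num.min (Y (tgrid m i) w) m%:R * incr W (tgrid m i) (tgrid m i.+1) w) jm).
rewrite [RHS]big_mkcond/=; apply: eq_bigr => i _; rewrite /= -/(tgrid m i) -/(tgrid m i.+1).
case: ifP => ij.
  by rewrite (min_l (tgrid_le_mono m ij)) (min_l (tgrid_le_mono m (ltnW ij))).
have ji : (j <= i)%N by rewrite leqNgt ij.
by rewrite (min_r (tgrid_le_mono m ji)) (min_r (tgrid_le_mono m (leqW ji))) subrr mulr0.
Qed.

Lemma integral_gridP (Y : R -> Omega -> R) m j w : (forall (s : R) w, 0 <= s -> 0 <= Y s w) ->
  (j <= m)%N ->
  \int[mu]_(s in `[0, tgrid m j]) sp_val (gridP Y T m) s w =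
  \sum_(i < j) Num.min (Y (tgrid m i) w) m%:R * (T / m%:R).
Proof.
move=> Y0 jm.
have c0 i : 0 <= Num.min (Y (tgrid m i) w) m%:R.
  by rewrite le_min Y0 ?ler0n// tgrid_ge0.
have mphi := measurable_sp_val (gridP Y T m) w.
have phi0 (s : R) : 0 <= sp_val (gridP Y T m) s w.
  by apply: sumr_ge0 => i _; apply: mulr_ge0 => //; exact: c0.
have vE l (s : R) : (l < j)%N -> tgrid m l < s -> s <= tgrid m l.+1 ->
    sp_val (gridP Y T m) s w = Num.min (Y (tgrid m l) w) m%:R.
  by move=> lj ls sl; apply: gridP_val => //; exact: leq_trans jm.
have phiE l (s : R) : (l < j)%N -> tgrid m l < s -> s <= tgrid m l.+1 ->
    sp_val (gridP Y T m) s w = sp_val (gridP Y T m) (tgrid m l.+1) w.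
  move=> lj ls sl; rewrite (vE l)// (vE l)//.
  exact: lt_le_trans ls sl.
have := integral_step_function (tgrid_leS m) mphi phi0 phiE.
rewrite [tgrid m 0]mul0r /Rintegral -integral_itv_obnd_cbnd; last first.
  by apply/measurable_EFinP; exact: measurable_funTS.
move=> -> /=; apply: eq_bigr => l _; rewrite tgridS.
have h0 : 0 < T / m%:R.
  by rewrite divr_gt0// ltr0n (leq_trans _ (leq_trans (ltn_ord l) jm)).
rewrite (vE l)//; last by rewrite -subr_gt0 tgridS.
Qed.

(** The coefficients are read along the solution [X] itself, not along the scheme, and are capped at
    [m] exactly as in [gridP]: the sums are thus integrals of [gridP] and converge to [X] without
    any stability argument. *)
Definition euler (m j : nat) (w : Omega) : R :=
  x + \sum_(i < j) (k * (theta - Num.min (X (tgrid m i) w) m%:R) * (T / m%:R) +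
    Num.min (S (tgrid m i) w) m%:R * incr W (tgrid m i) (tgrid m i.+1) w).

Let mX (s : R) : 0 <= s -> measurable_fun setT (X s).
Proof. by move=> _; exact: measurable_funP. Qed.

Let X_int t w : mu.-integrable `[0, t] (EFin \o (fun s => X s w)).
Proof. exact: path_integrable (@cir_continuous w). Qed.

Let step_int m t w : mu.-integrable `[0, t] (EFin \o (fun s => sp_val (gridP X T m) s w)).
Proof.
have [C hC] := sp_val_bounded (gridP X T m) w.
apply: (bounded_itv_integrable (C := C)) => //.
by apply: measurable_funTS; exact: measurable_sp_val.
Qed.

(** The drift requires an L1 error whereas [grid_err] is the squared L2 one; the free parameter [c]
    converts one into the other. *)
Lemma drift_grid_err m j w (c : R) : (0 < m)%N -> (j <= m)%N -> 0 < c ->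
  `|\int[mu]_(s in `[0, tgrid m j]) (k * (theta - X s w)) -
    \sum_(i < j) k * (theta - Num.min (X (tgrid m i) w) m%:R) * (T / m%:R)|
  <= k * (c * T + grid_err X T m w / c).
Proof.
move=> m0 jm c0; set t := tgrid m j.
have tT : t <= T by exact: tgrid_leT.
have t0 : 0 <= t by exact: tgrid_ge0.
pose g (s : R) := sp_val (gridP X T m) s w.
have gi (t' : R) : mu.-integrable `[0, t'] (EFin \o (fun s => X s w - g s)).
  have := itv_integrableD (X_int t' w) (itv_integrableZ (-1) (step_int m t' w)).
  by apply: eq_integrable => // s _ /=; rewrite mulN1r.
have gi2 (t' : R) : mu.-integrable `[0, t'] (EFin \o (fun s => (X s w - g s) ^+ 2)).
  have [C1 [C10 h1]] := path_bounded t' (@cir_continuous w).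
  have [C2 h2] := sp_val_bounded (gridP X T m) w.
  apply: (bounded_itv_integrable (C := (C1 + C2) ^+ 2)).
    apply: measurable_funX; apply/measurable_EFinP.
    exact: (measurable_int _ (gi t')).
  move=> s s0 st; rewrite normrX lerXn2r ?nnegrE//.
    by rewrite addr_ge0// (le_trans _ (h2 0)).
  by apply: (le_trans (ler_normB _ _)); apply: lerD; [exact: h1|exact: h2].
have sumE : \sum_(i < j) k * (theta - Num.min (X (tgrid m i) w) m%:R) * (T / m%:R) =
    \int[mu]_(s in `[0, t]) (k * (theta - g s)).
  have ith : mu.-integrable `[0, t] (EFin \o (cst theta : R -> R)).
    by apply: (bounded_itv_integrable (C := `|theta|)) => //; exact: measurable_cst.
  have i1 : mu.-integrable `[0, t] (EFin \o (fun s => theta - g s)).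
    have := itv_integrableD ith (itv_integrableZ (-1) (step_int m t w)).
    by apply: eq_integrable => // s _ /=; rewrite mulN1r.
  rewrite RintegralZl// RintegralB//; last exact: step_int.
  rewrite Rintegral_itv_cst//.
  rewrite /t integral_gridP//; last by move=> *; exact: cir_ge0.
  under eq_bigr do rewrite -mulrA.
  rewrite -big_distrr/=; congr (_ * _).
  under eq_bigr do rewrite mulrBl.
  rewrite sumrB; congr (_ - _).
  by rewrite sumr_const card_ord /tgrid -mulr_natr; ring.
rewrite sumE -RintegralB//; last 2 first.
- have ith : mu.-integrable `[0, t] (EFin \o (cst theta : R -> R)).
    by apply: (bounded_itv_integrable (C := `|theta|)) => //; exact: measurable_cst.
  apply: itv_integrableZ.
  have := itv_integrableD ith (itv_integrableZ (-1) (X_int t w)).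
  by apply: eq_integrable => // s _ /=; rewrite mulN1r.
- have ith : mu.-integrable `[0, t] (EFin \o (cst theta : R -> R)).
    by apply: (bounded_itv_integrable (C := `|theta|)) => //; exact: measurable_cst.
  apply: itv_integrableZ.
  have := itv_integrableD ith (itv_integrableZ (-1) (step_int m t w)).
  by apply: eq_integrable => // s _ /=; rewrite mulN1r.
have -> : \int[mu]_(s in `[0, t]) (k * (theta - X s w) - k * (theta - g s)) =
   \int[mu]_(s in `[0, t]) (- k * (X s w - g s)).
  by apply: eq_Rintegral => s _; ring.
rewrite RintegralZl// normrM normrN (gtr0_norm k0) ler_pM2l//.
apply: (le_trans (le_normr_Rintegral _ _)) => //.
apply: (@le_trans _ _ (\int[mu]_(s in `[0, T]) `|X s w - g s|)).
  apply: Rintegral_itv_le => //; exact: integrable_norm (gi T).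
by apply: Rintegral_norm_le_sqr => //; exact: ltW.
Qed.

Lemma measurable_euler m j : measurable_fun setT (euler m j).
Proof.
apply: measurable_funD; first exact: measurable_cst.
apply: (measurable_sum_ord (f := fun i w => k * (theta - Num.min (X (tgrid m i) w) m%:R) * (T / m%:R) +
    Num.min (S (tgrid m i) w) m%:R * incr W (tgrid m i) (tgrid m i.+1) w)) => i ij.
apply: measurable_funD.
  apply: measurable_funM; last exact: measurable_cst.
  apply: measurable_funM; first exact: measurable_cst.
  apply: measurable_funB; first exact: measurable_cst.
  by apply: measurable_minr; [exact: measurable_funP|exact: measurable_cst].
apply: measurable_funM; last exact: measurable_incr.
apply: measurable_minr; last exact: measurable_cst.
exact: mw_measurable (cir_vol_adapted (tgrid_ge0 _ _)).
Qed.

(** The tolerance [e] is divided into [e / 2] for the stochastic integral and two shares [e / 4] for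
    the two terms of the drift error. *)
Lemma euler_dist_tail m j (e a c : R) : (0 < m)%N -> (j <= m)%N ->
  0 < e -> 0 < a -> 0 < c -> k * c * T < e / 4 ->
  Pr P [set w | e <= `|X (tgrid m j) w - euler m j w|] <=
    v * a / (e / 4) ^+ 2 + Pr P [set w | a / 4 <= grid_err S T m w] +
    Pr P [set w | e * c / (4 * k) <= grid_err X T m w].
Proof.
move=> m0 jm e0 a0 c0 kcT.
have t0 := tgrid_ge0 m j; have tT := tgrid_leT m0 jm.
case: cirX => _ _ _ _ /(_ _ t0)[I IS XE].
have e20 : 0 < e / 2 by rewrite divr_gt0.
have mI : measurable_fun setT I by exact: measurable_funP.
have := ito_grid_tail (S := S) BM cir_vol_ge0 cir_vol_adapted cir_vol_continuous
  m T0 t0 tT e20 a0 mI IS.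
have -> : e / 2 / 2 = e / 4 by field.
move=> h.
have mg1 : measurable_fun setT (grid_err X T m).
  apply: measurable_grid_err => //; exact: cir_continuous.
have mKI : measurable_fun setT (sp_integral W (gridP S T m) (tgrid m j)).
  apply: measurable_sp_integral => i im.
  have [_ _ hc] := gridP_adapted cir_vol_ge0 cir_vol_adapted m (ltW T0).
  by have [mc _] := hc i im; exact: mw_measurable mc.
have m1 : measurable [set w | e / 2 <= `|I w - sp_integral W (gridP S T m) (tgrid m j) w|].
  by apply: measurable_level_ge; apply: measurableT_comp => //; exact: measurable_funB.
have m2 : measurable [set w | e * c / (4 * k) <= grid_err X T m w].
  exact: measurable_level_ge.
apply: (@le_trans _ _ (Pr P ([set w | e / 2 <= `|I w - sp_integral W (gridP S T m) (tgrid m j) w|]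
   `|` [set w | e * c / (4 * k) <= grid_err X T m w]))); last first.
  apply: (le_trans (PrU P m1 m2)); rewrite lerD2r; exact: h.
apply: le_Pr_ae.
- apply: measurable_level_ge; apply: measurableT_comp => //; apply: measurable_funB => //.
  exact: measurable_euler.
- exact: measurableU.
apply: filterS XE => w XE /= ew; apply/orP; rewrite -[_ || _]negbK negb_or -!ltNge.
apply/negP => /andP[q1 q2]; move: ew; apply/negP; rewrite -ltNge.
rewrite (sp_integral_gridP _ w jm) in q1.
have := drift_grid_err w m0 jm c0.
rewrite XE /euler big_split/=; move: q1.
set C := \sum_(i < j) _ => q1; set A := \int[mu]_(s in _) _; set B := \sum_(i < j) _ => q3.
have -> : x + A + I w - (x + (B + C)) = (A - B) + (I w - C) by ring.
apply: (le_lt_trans (ler_normD _ _)).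
have : k * (c * T + grid_err X T m w / c) < e / 2.
  have : k * (grid_err X T m w / c) < e / 4.
    rewrite mulrA ltr_pdivrMr// mulrC -ltr_pdivlMr//.
    by apply: (lt_le_trans q2); rewrite le_eqVlt; apply/orP; left; apply/eqP; field; rewrite gt_eqF.
  move: kcT; rewrite mulrDr mulrA (splitr (e / 2)).
  have -> : e / 2 / 2 = e / 4 by field.
  by rewrite (mulrA k c T) => h1 h2; exact: ltrD.
by move=> q4; rewrite (splitr e); apply: ltrD => //; exact: le_lt_trans q3 q4.
Qed.

(** Uniformity in [j] is the point: the tail bound depends on errors over the whole of [0, T]
    only. *)
Lemma euler_cvg (e eta : R) : 0 < e -> 0 < eta -> exists m0, forall m, (m0 <= m)%N ->
  (0 < m)%N -> forall j, (j <= m)%N ->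
  Pr P [set w | e <= `|X (tgrid m j) w - euler m j w|] <= eta.
Proof.
move=> e0 eta0.
(* [a] makes the Lenglart term at most [eta / 3], with [v + 1] as a safe denominator; [c] makes the
   drift term [k * c * T] equal to [e / 8]. *)
pose a := eta / 3 * (e / 4) ^+ 2 / (v + 1).
pose c := e / (8 * k * T).
have v0 : 0 < v + 1 by rewrite ltr_wpDl// normal_abs_moment_ge0.
have a0 : 0 < a by rewrite divr_gt0// mulr_gt0 ?divr_gt0// exprn_gt0// divr_gt0.
have c0 : 0 < c by rewrite divr_gt0// !mulr_gt0.
have a40 : 0 < a / 4 by rewrite divr_gt0.
have d0 : 0 < e * c / (4 * k) by apply: divr_gt0; apply: mulr_gt0.
have eta30 : 0 < eta / 3 by rewrite divr_gt0.
have c1 : forall w, grid_err S T m w @[m --> \oo] --> 0.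
  by move=> w; apply: grid_err_cvg => //; [exact: cir_vol_ge0|exact: cir_vol_continuous].
have c2 : forall w, grid_err X T m w @[m --> \oo] --> 0.
  by move=> w; apply: grid_err_cvg => //; [move=> *; exact: cir_ge0|exact: cir_continuous].
have mg1 m : measurable_fun setT (grid_err S T m).
  apply: measurable_grid_err => //; last exact: cir_vol_continuous.
  by move=> s s0; exact: mw_measurable (cir_vol_adapted s0).
have mg2 m : measurable_fun setT (grid_err X T m).
  apply: measurable_grid_err => //; exact: cir_continuous.
have /cvgrPdist_lt /(_ _ eta30) [n1 _ hn1] := Pr_level_cvg0 a40 mg1 (aeW P c1).
have /cvgrPdist_lt /(_ _ eta30) [n2 _ hn2] := Pr_level_cvg0 d0 mg2 (aeW P c2).
exists (maxn n1 n2) => m; rewrite geq_max => /andP[mn1 mn2] m0 j jm.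
have kcT : k * c * T < e / 4.
  have -> : k * c * T = e / 8 by rewrite /c; field; rewrite !gt_eqF.
  by rewrite ltr_pM2l// ltf_pV2 ?posrE// ltr_nat.
apply: (le_trans (euler_dist_tail m0 jm e0 a0 c0 kcT)).
have := hn1 m mn1; rewrite /= sub0r normrN => /(le_lt_trans (ler_norm _))/ltW q1.
have := hn2 m mn2; rewrite /= sub0r normrN => /(le_lt_trans (ler_norm _))/ltW q2.
rewrite (_ : eta = eta / 3 + eta / 3 + eta / 3); last by field.
apply: lerD q2; apply: lerD q1.
rewrite ler_pdivrMr ?exprn_gt0 ?divr_gt0// /a mulrA ler_pdivrMr//.
rewrite mulrC ler_wpM2l//; last by rewrite lerDl.
by rewrite mulr_ge0 ?sqr_ge0// ltW.
Qed.

End euler_scheme.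

(** * Comparison of CIR solutions *)

Section real_derivatives.
Context {R : realType}.
Implicit Types (f g : R -> R) (x a b : R).

Lemma is_derive1_add f g x a b : is_derive x 1 f a -> is_derive x 1 g b ->
  is_derive x 1 (fun z => f z + g z) (a + b).
Proof. by move=> df dg; exact: is_deriveD. Qed.

Lemma is_derive1_sub f g x a b : is_derive x 1 f a -> is_derive x 1 g b ->
  is_derive x 1 (fun z => f z - g z) (a - b).
Proof. by move=> df dg; exact: is_deriveB. Qed.

Lemma is_derive1_mul f g x a b : is_derive x 1 f a -> is_derive x 1 g b ->
  is_derive x 1 (fun z => f z * g z) (f x * b + g x * a).
Proof. by move=> df dg; exact: is_deriveM. Qed.

Lemma is_derive1_scale f x a b : is_derive x 1 f a ->
  is_derive x 1 (fun z => b * f z) (b * a).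
Proof. by move=> df; exact: is_deriveZ. Qed.

Lemma is_derive1_fcomp f g x a b : is_derive (g x) 1 f a -> is_derive x 1 g b ->
  is_derive x 1 (fun z => f (g z)) (a * b).
Proof. by move=> df dg; exact: is_derive1_comp. Qed.

Lemma is_derive1_shift f x y a : is_derive (x + y) 1 f a ->
  is_derive y 1 (fun z => f (x + z)) a.
Proof.
move=> df; rewrite -[a]mulr1; apply: (is_derive1_fcomp (g := fun z => x + z)) => //.
by rewrite -[X in is_derive _ _ _ X]add0r; apply: is_derive1_add; exact: is_derive_cst.
Qed.

End real_derivatives.

Section mean_value_bound.
Context {R : realType}.

Lemma mean_value_bound (f f' : R -> R) (K y : R) :
  (forall x : R, is_derive x 1 f (f' x)) ->
  (forall c, `|c| <= `|y| -> `|f' c| <= K) -> `|f y - f 0| <= K * `|y|.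
Proof.
move=> df fK.
have cf : continuous f.
  by move=> z; apply/differentiable_continuous/derivable1_diffP; have [] := df z.
have [y0|y0|->] := ltgtP y 0; last by rewrite subrr !normr0 mulr0.
- have [c + E] := @MVT R f f' y 0 y0 (fun z _ => df z) (continuous_subspaceT cf).
  rewrite in_itv/= => /andP[c1 c2].
  rewrite distrC E normrM sub0r normrN ler_wpM2r//; apply: fK.
  by rewrite !ltr0_norm// lerN2 ltW.
- have [c + E] := @MVT R f f' 0 y y0 (fun z _ => df z) (continuous_subspaceT cf).
  rewrite in_itv/= => /andP[c1 c2].
  rewrite E normrM subr0 ler_wpM2r//; apply: fK.
  by rewrite !gtr0_norm// ltW.
Qed.

End mean_value_bound.

Section log_bounds.
Context {R : realType}.
Implicit Types u : R.

Lemma ln_ge_1B u : 0 < u -> 1 - u^-1 <= ln u.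
Proof.
move=> u0; have h : -1 < u^-1 - 1 by rewrite -subr_gt0 opprK subrK invr_gt0.
by have := le_ln1Dx h; rewrite addrC subrK lnV ?posrE// lerNl opprB.
Qed.

Lemma mul_ln_ge u : 0 < u -> u - 1 <= u * ln u.
Proof.
move=> u0; have := ln_ge_1B u0; rewrite -(ler_pM2l u0).
by rewrite mulrBr mulr1 mulfV ?gt_eqF.
Qed.

End log_bounds.

(* The even convex function with second derivative [1 / (n sqrt (x^2 + a^2))],
   where [a = 2 exp (-n)] is chosen so that it tends to [|x|] as n grows, while
   [|x|] times the second derivative stays below [1 / n]. *)
Section yamada_function.
Context {R : realType}.
Variable n : R.
Hypothesis n0 : 0 < n.

Definition yam_a : R := 2 * expR (- n).
Local Notation a := yam_a.
Definition yam_rt (x : R) : R := Num.sqrt (x ^+ 2 + a ^+ 2).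
Local Notation rt := yam_rt.
Definition yam_q (x : R) : R := (n * rt x)^-1.
(** This is arsinh (x / a) / n, the odd primitive of [yam_q]; [yam] is in turn its primitive
    vanishing at 0. *)
Definition yam_p (x : R) : R := ln ((x + rt x) / a) / n.
Definition yam (x : R) : R := x * yam_p x - (rt x - a) / n.

Lemma yam_a_gt0 : 0 < a.
Proof. by rewrite mulr_gt0// expR_gt0. Qed.

Let arg_gt0 (x : R) : 0 < x ^+ 2 + a ^+ 2.
Proof. by rewrite ltr_wpDl ?sqr_ge0// exprn_gt0// yam_a_gt0. Qed.

Lemma yam_rt_gt0 (x : R) : 0 < rt x.
Proof. by rewrite sqrtr_gt0. Qed.

Lemma yam_rt_sqr (x : R) : rt x ^+ 2 = x ^+ 2 + a ^+ 2.
Proof. by rewrite sqr_sqrtr// ltW. Qed.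

Lemma yam_rt_gt_norm (x : R) : `|x| < rt x.
Proof.
rewrite -(@ltr_pXn2r _ 2)// ?nnegrE ?normr_ge0 ?(ltW (yam_rt_gt0 _))//.
by rewrite yam_rt_sqr real_normK ?num_real// ltrDl exprn_gt0// yam_a_gt0.
Qed.

Lemma yam_rt_le (x : R) : rt x <= `|x| + a.
Proof.
have a0 := yam_a_gt0.
rewrite -(@ler_pXn2r _ 2)// ?nnegrE ?addr_ge0 ?normr_ge0 ?(ltW a0) ?(ltW (yam_rt_gt0 _))//.
rewrite yam_rt_sqr -(real_normK (num_real x)) sqrrD -addrA lerD2l lerDr.
by rewrite mulrn_wge0// mulr_ge0// ltW.
Qed.

Lemma yam_rt_ge_a (x : R) : a <= rt x.
Proof.
have a0 := yam_a_gt0.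
rewrite -(@ler_pXn2r _ 2)// ?nnegrE ?(ltW a0) ?(ltW (yam_rt_gt0 _))//.
by rewrite yam_rt_sqr lerDr sqr_ge0.
Qed.

Lemma yam_rt_lip (x y : R) : `|rt x - rt y| <= `|x - y|.
Proof.
have rx := yam_rt_gt0 x; have ry := yam_rt_gt0 y.
have s0 : 0 < rt x + rt y by exact: addr_gt0.
rewrite -(ler_pM2r s0) -{1}(gtr0_norm s0) -normrM.
rewrite -subr_sqr !yam_rt_sqr.
have -> : x ^+ 2 + a ^+ 2 - (y ^+ 2 + a ^+ 2) = (x - y) * (x + y) by ring.
rewrite normrM ler_wpM2l//; apply: (le_trans (ler_normD _ _)).
by apply: lerD; apply/ltW/yam_rt_gt_norm.
Qed.

Lemma yam_rtN (x : R) : rt (- x) = rt x.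
Proof. by rewrite /rt sqrrN. Qed.

Let sum_gt0 (x : R) : 0 < x + rt x.
Proof.
rewrite -ltrBlDl sub0r; apply: le_lt_trans (yam_rt_gt_norm x).
by rewrite -normrN ler_norm.
Qed.

Lemma yam_pN (x : R) : yam_p (- x) = - yam_p x.
Proof.
have a0 := yam_a_gt0.
rewrite /yam_p yam_rtN -mulNr; congr (_ / _).
have E : ((- x + rt x) / a) * ((x + rt x) / a) = 1.
  have -> : ((- x + rt x) / a) * ((x + rt x) / a) = (rt x ^+ 2 - x ^+ 2) / a ^+ 2.
    by field; rewrite gt_eqF.
  by rewrite yam_rt_sqr addrAC subrr add0r divff// gt_eqF// exprn_gt0.
have h0 : 0 < (x + rt x) / a by rewrite divr_gt0.
rewrite -lnV ?posrE//; congr ln.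
by rewrite -[RHS]mul1r -E mulfK// gt_eqF.
Qed.

Lemma yamN (x : R) : yam (- x) = yam x.
Proof. by rewrite /yam yam_pN yam_rtN mulrNN. Qed.

Lemma yam_p0 : yam_p 0 = 0.
Proof. by have := yam_pN 0; rewrite oppr0 => /eqP; rewrite -addr_eq0 -mulr2n mulrn_eq0/= => /eqP. Qed.

Lemma yam_q_ge0 (x : R) : 0 <= yam_q x.
Proof. by rewrite invr_ge0 mulr_ge0// ltW// yam_rt_gt0. Qed.

Lemma yam_q_le (x : R) : yam_q x <= (n * a)^-1.
Proof.
have a0 := yam_a_gt0; have r0 := yam_rt_gt0 x.
by rewrite /yam_q lef_pV2 ?posrE ?(mulr_gt0 n0 a0) ?(mulr_gt0 n0 r0)// ler_pM2l// yam_rt_ge_a.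
Qed.

(** This is what defeats the square-root volatility: the squared difference of volatilities is at
    most a multiple of |x|, so the second-order term is of order 1 / n. *)
Lemma yam_q_norm (x : R) : yam_q x * `|x| <= n^-1.
Proof.
have r0 := yam_rt_gt0 x.
rewrite /yam_q invfM -mulrA ler_piMr ?invr_ge0 ?(ltW n0)//.
by rewrite mulrC ler_pdivrMr// mul1r ltW// yam_rt_gt_norm.
Qed.

Lemma yam_q_lip (x y : R) : `|yam_q x - yam_q y| <= (n * a ^+ 2)^-1 * `|x - y|.
Proof.
have a0 := yam_a_gt0; have rx := yam_rt_gt0 x; have ry := yam_rt_gt0 y.
have -> : yam_q x - yam_q y = (rt y - rt x) / (n * (rt x * rt y)).
  by rewrite /yam_q; field; rewrite !gt_eqF.
rewrite normrM mulrC; apply: ler_pM => //; last by rewrite distrC; exact: yam_rt_lip.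
have rr : 0 < n * (rt x * rt y) by rewrite !mulr_gt0.
have aa : 0 < n * a ^+ 2 by apply: mulr_gt0 => //; exact: exprn_gt0.
rewrite gtr0_norm ?invr_gt0// lef_pV2 ?posrE//.
by rewrite ler_pM2l// expr2; apply: ler_pM; rewrite ?(ltW a0)// yam_rt_ge_a.
Qed.

Lemma is_derive_yam_rt (x : R) : is_derive x 1 rt (x / rt x).
Proof.
have h : is_derive x 1 (fun z : R => z ^+ 2 + a ^+ 2) (x * 1 + x * 1 + 0).
  exact: (is_derive1_add (is_derive1_mul (is_derive_id x 1) (is_derive_id x 1))
    (is_derive_cst (a ^+ 2) x 1)).
apply: (is_derive_eq (is_derive1_fcomp (g := fun z : R => z ^+ 2 + a ^+ 2) (is_derive1_sqrt (arg_gt0 x)) h)).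
rewrite -/(rt x); move: (rt x) (yam_rt_gt0 x) => r r0.
by field; rewrite gt_eqF.
Qed.

Lemma is_derive_yam_p (x : R) : is_derive x 1 yam_p (yam_q x).
Proof.
have a0 := yam_a_gt0; have r0 := yam_rt_gt0 x; have xr := sum_gt0 x.
have h0 : 0 < (x + rt x) / a by rewrite divr_gt0.
have h1 := is_derive1_mul (is_derive1_add (is_derive_id x 1) (is_derive_yam_rt x)) (is_derive_cst a^-1 x 1).
have h2 := is_derive1_mul (is_derive1_fcomp (g := fun z : R => (z + rt z) / a) (is_derive1_ln h0) h1) (is_derive_cst n^-1 x 1).
apply: (is_derive_eq h2) => /=; rewrite /yam_q.
rewrite mulr0 add0r; move: (rt x) (yam_a) a0 r0 xr {h0 h1 h2} => r b b0 r0 xr; field.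
by rewrite !gt_eqF.
Qed.

Lemma is_derive_yam (x : R) : is_derive x 1 yam (yam_p x).
Proof.
have r0 := yam_rt_gt0 x.
have h1 := is_derive1_mul (is_derive_id x 1) (is_derive_yam_p x).
have h2 := is_derive1_mul (is_derive1_sub (is_derive_yam_rt x) (is_derive_cst a x 1)) (is_derive_cst n^-1 x 1).
apply: (is_derive_eq (is_derive1_sub h1 h2)) => /=; rewrite /yam_q.
move: (yam_p x) (rt x) r0 {h1 h2} => p r r0; field.
by rewrite !gt_eqF.
Qed.

Lemma yam_p_lip (x y : R) : `|yam_p x - yam_p y| <= (n * a)^-1 * `|x - y|.
Proof.
have := @mean_value_bound R (fun z => yam_p (y + z)) (fun z => yam_q (y + z)) (n * a)^-1 (x - y).
rewrite addr0 [y + _]addrC subrK; apply.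
  by move=> z; apply: is_derive1_shift; exact: is_derive_yam_p.
by move=> c _; rewrite ger0_norm ?yam_q_ge0 ?yam_q_le.
Qed.

Lemma yam_p_norm (x : R) : `|yam_p x| <= (n * a)^-1 * `|x|.
Proof. by have := yam_p_lip x 0; rewrite yam_p0 !subr0. Qed.

(** The remainder bound comes from the Lipschitz constant of [yam_q] by applying the mean value
    bound twice. *)
Lemma yam_taylor (x y : R) :
  `|yam (x + y) - yam x - yam_p x * y - yam_q x / 2 * y ^+ 2| <=
  (n * a ^+ 2)^-1 * `|y| ^+ 3.
Proof.
set L := (n * a ^+ 2)^-1.
have L0 : 0 <= L by rewrite invr_ge0 mulr_ge0 ?sqr_ge0// ltW.
pose g (z : R) := yam_p (x + z) - yam_p x - yam_q x * z.
have gE z : `|g z| <= L * `|z| * `|z|.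
  have := @mean_value_bound R g (fun z => yam_q (x + z) - yam_q x) (L * `|z|) z.
  rewrite /g addr0 subrr mulr0 !subr0; apply; last first.
    move=> c cz; apply: (le_trans (yam_q_lip _ _)); rewrite -/L ler_wpM2l//.
    by rewrite addrAC subrr add0r.
  move=> {}z.
  have h1 := is_derive1_sub (is_derive1_shift (is_derive_yam_p (x + z))) (is_derive_cst (yam_p x) z 1).
  have h2 := is_derive1_scale (yam_q x) (is_derive_id z 1).
  by apply: (is_derive_eq (is_derive1_sub h1 h2)); ring.
pose f (z : R) := yam (x + z) - yam x - yam_p x * z - yam_q x / 2 * z ^+ 2.
have := @mean_value_bound R f g (L * `|y| ^+ 2) y.
have -> : f 0 = 0 by rewrite /f addr0 subrr mulr0 expr0n mulr0 !subr0.
rewrite subr0; have -> : L * `|y| ^+ 3 = L * `|y| ^+ 2 * `|y| by rewrite [in LHS]exprSr mulrA.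
apply; last first.
  move=> c cy; apply: (le_trans (gE c)); rewrite -mulrA ler_wpM2l// -expr2.
  by rewrite lerXn2r ?nnegrE.
move=> z.
have h1 := is_derive1_sub (is_derive1_shift (is_derive_yam (x + z))) (is_derive_cst (yam x) z 1).
have h2 := is_derive1_scale (yam_p x) (is_derive_id z 1).
have h3 := is_derive1_scale (yam_q x / 2) (is_derive1_mul (is_derive_id z 1) (is_derive_id z 1)).
by apply: (is_derive_eq (is_derive1_sub (is_derive1_sub h1 h2) h3)); rewrite /g; field.
Qed.

(** The choice of [yam_a] shows here: u + sqrt (u^2 + a^2) >= 2 u, and dividing by a = 2 exp (-n)
    gives at least u exp n. *)
Lemma yam_p_ge (u : R) : 0 < u -> 1 + ln u / n <= yam_p u.
Proof.
move=> u0; have a0 := yam_a_gt0.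
rewrite /yam_p -(@ler_pM2r _ n)// divfK ?gt_eqF// mulrDl mul1r divfK ?gt_eqF//.
rewrite -{1}(expRK n) -lnM ?posrE ?expR_gt0// ler_ln ?posrE ?mulr_gt0 ?expR_gt0 ?invr_gt0//.
rewrite ler_pdivlMr// /yam_a mulrAC mulrCA.
have -> : 2 * (expR n * expR (- n)) * u = u + u.
  by rewrite expRN mulfV ?gt_eqF ?expR_gt0// mulr1 mulr_natl mulr2n.
by rewrite lerD2l ltW// (le_lt_trans _ (yam_rt_gt_norm _))// ler_norm.
Qed.

Lemma yam_p_le (u : R) : 0 <= u -> yam_p u <= 1 + u / n.
Proof.
move=> u0; have a0 := yam_a_gt0.
rewrite /yam_p -(@ler_pM2r _ n)// divfK ?gt_eqF// [leRHS]mulrDl mul1r divfK ?gt_eqF//.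
have u1 : 0 < 1 + u by rewrite ltr_wpDr.
apply: (@le_trans _ _ (n + ln (1 + u))); last first.
  by rewrite lerD2l le_ln1Dx// (lt_le_trans _ u0)// oppr_lt0.
rewrite -{1}(expRK n) -lnM ?posrE ?expR_gt0// ler_ln ?posrE ?mulr_gt0 ?expR_gt0 ?invr_gt0//.
rewrite ler_pdivrMr// /yam_a.
have -> : expR n * (1 + u) * (2 * expR (- n)) = 2 * (1 + u).
  by rewrite expRN; field; rewrite gt_eqF// expR_gt0.
have := yam_rt_le u; rewrite ger0_norm// => h.
have : a <= 2 by rewrite /yam_a ler_piMr// -expR0 ler_expR oppr_le0 ltW.
by lra.
Qed.

(** The logarithmic defect is controlled by u ln u >= u - 1, and the correction (rt u - a) / n is at
    most u / n; together they cost 1 / n. *)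
Lemma yam_ge (x : R) : `|x| - n^-1 <= yam x.
Proof.
have -> : yam x = yam `|x| by case: (ger0P x) => // _; rewrite yamN.
have := normr_ge0 x; move: `|x| => u; rewrite le_eqVlt => /orP[/eqP <-|u0].
  rewrite /yam mul0r !sub0r lerN2 ler_pdivrMr// mulVf ?gt_eqF//.
  have := yam_rt_le 0; rewrite normr0 add0r -subr_le0 => h.
  by apply: (le_trans h).
have h1 := yam_p_ge u0; have h2 := mul_ln_ge u0.
have h3 := yam_rt_le u; rewrite gtr0_norm// in h3.
rewrite /yam; apply: (@le_trans _ _ (u * (1 + ln u / n) - u / n)).
  rewrite mulrDr mulr1 -addrA lerD2l mulrA -mulrBl -[in leLHS]mulN1r.
  by rewrite ler_pM2r ?invr_gt0//; lra.
apply: lerB; first by rewrite ler_pM2l.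
by rewrite ler_pM2r ?invr_gt0//; lra.
Qed.

Lemma yam_le (x : R) : yam x <= `|x| + x ^+ 2 / n.
Proof.
have -> : yam x = yam `|x| by case: (ger0P x) => // _; rewrite yamN.
rewrite -(real_normK (num_real x)); have := normr_ge0 x; move: `|x| => u u0.
have h : 0 <= (rt u - a) / n by rewrite divr_ge0 ?subr_ge0 ?yam_rt_ge_a// ltW.
rewrite /yam; apply: (@le_trans _ _ (u * yam_p u)); first by rewrite gerBl.
apply: (@le_trans _ _ (u * (1 + u / n))); first by rewrite ler_wpM2l// yam_p_le.
by rewrite mulrDr mulr1 mulrA expr2.
Qed.

(** [yam_p + 1] is the derivative of yam (x) + x, which approximates twice the positive part. For
    positive x the drift - k x pushes down; for negative x the derivative is nearly 0, up to a term
    |ln u| / n compensated by u. *)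
Lemma yam_drift (x : R) : - ((yam_p x + 1) * x) <= n^-1.
Proof.
have n10 : 0 <= n^-1 by rewrite invr_ge0 ltW.
have [x0|x0|->] := ltgtP x 0; last by rewrite mulr0 oppr0.
- have u0 : 0 < - x by rewrite oppr_gt0.
  have h1 := yam_p_ge u0; have h2 := mul_ln_ge u0.
  rewrite -mulrN -[in yam_p x](opprK x) yam_pN.
  move: (- x) u0 h1 h2 => u u0 h1 h2.
  apply: (@le_trans _ _ (- (ln u / n) * u)).
    by rewrite ler_pM2r//; lra.
  rewrite mulNr mulrAC -mulNr -[leRHS]mul1r ler_pM2r ?invr_gt0// [ln u * u]mulrC; lra.
- apply: le_trans n10; rewrite oppr_le0 mulr_ge0 ?(ltW x0)// addr_ge0//.
  rewrite /yam_p divr_ge0 ?(ltW n0)// ln_ge0// ler_pdivlMr ?yam_a_gt0// mul1r.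
  by rewrite ler_wpDl ?(ltW x0)// yam_rt_ge_a.
Qed.

End yamada_function.

Section yamada_measurable.
Context {R : realType}.

Lemma lipschitz_measurable (f : R -> R) (K : R) :
  (forall x y, `|f x - f y| <= K * `|x - y|) -> measurable_fun setT f.
Proof.
move=> lf; apply: continuous_measurable_fun => x.
have K0 : 0 <= K.
  by have := lf (x + 1) x; rewrite addrAC subrr add0r normr1 mulr1; exact: le_trans.
apply/cvgrPdist_le => e /= e0.
have K1 : 0 < K + 1 by rewrite ltr_wpDl.
have d0 : 0 < e / (K + 1) by rewrite divr_gt0.
exists (e / (K + 1)) => //= y /=; rewrite ltr_pdivlMr// => /ltW h.
apply: (le_trans (lf x y)); apply: le_trans h.
by rewrite mulrC ler_wpM2l// lerDl.
Qed.

Variable n : R.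
Hypothesis n0 : 0 < n.

Lemma measurable_yam_p : measurable_fun setT (yam_p n).
Proof. exact: (lipschitz_measurable (yam_p_lip n0)). Qed.

Lemma measurable_yam_q : measurable_fun setT (yam_q n).
Proof. exact: (lipschitz_measurable (yam_q_lip n0)). Qed.

Lemma measurable_yam : measurable_fun setT (yam n).
Proof.
apply: continuous_measurable_fun => z.
by apply/differentiable_continuous/derivable1_diffP; have [] := is_derive_yam n0 z.
Qed.

Lemma yam_norm_le (x : R) : `|yam n x| <= n^-1 + (n * yam_a n)^-1 * x ^+ 2.
Proof.
have a0 := yam_a_gt0 n; have n10 : 0 < n^-1 by rewrite invr_gt0.
have c0 : 0 <= (n * yam_a n)^-1 * x ^+ 2.
  by apply: mulr_ge0; [rewrite invr_ge0 ltW// mulr_gt0|exact: sqr_ge0].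
rewrite ler_norml; apply/andP; split.
  apply: le_trans (yam_ge n0 x); rewrite opprD.
  by have := normr_ge0 x; lra.
apply: (@le_trans _ _ (x * yam_p n x)).
  by rewrite /yam gerBl divr_ge0 ?(ltW n0)// subr_ge0 yam_rt_ge_a.
apply: (le_trans (ler_norm _)); rewrite normrM -(real_normK (num_real x)) expr2.
apply: (@le_trans _ _ (`|x| * ((n * yam_a n)^-1 * `|x|))).
  by rewrite ler_wpM2l// yam_p_norm.
by rewrite mulrCA lerDr ltW.
Qed.

End yamada_measurable.

Lemma cube_normD {R : realType} (x y : R) :
  `|x + y| ^+ 3 <= 4 * (`|x| ^+ 3 + `|y| ^+ 3).
Proof.
apply: (@le_trans _ _ ((`|x| + `|y|) ^+ 3)).
  by rewrite lerXn2r ?nnegrE// ?addr_ge0// ler_normD.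
have := normr_ge0 x; have := normr_ge0 y.
move: `|x| `|y| => u w w0 u0.
have -> : 4 * (u ^+ 3 + w ^+ 3) = (u + w) ^+ 3 + 3 * ((u + w) * (u - w) ^+ 2) by ring.
by rewrite lerDl mulr_ge0// mulr_ge0 ?sqr_ge0// addr_ge0.
Qed.

(** * Ito's formula over one time step *)

Section one_step.
Context {d : measure_display} {Omega : measurableType d} {R : realType}
  (P : probability Omega R).
Variable W : R -> {RV P >-> R}.
Hypothesis BM : brownian_motion W.
Local Notation F := (augmented_filtration P W).
Local Notation v := (@normal_abs_moment R 2).
Local Notation c3 := (@normal_abs_moment R 3).

Lemma intg_of_sqr (f : Omega -> R) : measurable_fun setT f ->
  intg P (fun w => f w ^+ 2) -> intg P f.
Proof.
move=> mf f2; apply: (intg_le mf _ (intgD (intg_cst P 1) f2)) => w /=.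
rewrite [leRHS]ger0_norm ?addr_ge0 ?sqr_ge0//.
rewrite -(real_normK (num_real (f w))).
by have := normr_ge0 (f w); move: `|f w| => y y0; nra.
Qed.

Lemma intg_yam (n : R) (Z : Omega -> R) : 0 < n -> measurable_fun setT Z ->
  intg P (fun w => Z w ^+ 2) -> intg P (fun w => yam n (Z w)).
Proof.
move=> n0 mZ Z2.
apply: (intg_le (f := fun w => yam n (Z w)) _ _ (intgD (intg_cst P n^-1) (intgZ (n * yam_a n)^-1 Z2))).
  exact: (measurableT_comp (measurable_yam n0) mZ).
by move=> w /=; apply: (le_trans (yam_norm_le n0 (Z w))); exact: ler_norm.
Qed.

Variables (n s h Ma Mb : R) (Z al be : Omega -> R).
Hypotheses (n0 : 0 < n) (s0 : 0 <= s) (h0 : 0 <= h).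
Hypotheses (mZ : measurable_wrt (F s) Z) (mal : measurable_wrt (F s) al)
  (mbe : measurable_wrt (F s) be).
Hypotheses (Z2 : intg P (fun w => Z w ^+ 2)).
Hypotheses (alM : forall w, `|al w| <= Ma) (beM : forall w, `|be w| <= Mb).

Let K : R := (n * yam_a n)^-1.
Let L : R := (n * yam_a n ^+ 2)^-1.
Local Notation dW := (incr W s (s + h)).

(** Every term has order at least h^(3/2) in the step [h], so the errors of all steps of a fine mesh
    add up to something small. *)
Definition step_err : R :=
  K / 2 * (Ma * h) ^+ 2 + 4 * L * ((Ma * h) ^+ 3 + Mb ^+ 3 * (Num.sqrt h ^+ 3 * c3)).

Let K0 : 0 <= K. Proof. by rewrite invr_ge0 mulr_ge0 ?ltW// yam_a_gt0. Qed.
Let L0 : 0 <= L. Proof. by rewrite invr_ge0 mulr_ge0 ?sqr_ge0// ltW. Qed.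
Let mw1 : measurable_wrt (F s) (cst (1 : R) : Omega -> R). Proof. exact: mw_cst. Qed.
Let sh : s <= s + h. Proof. by rewrite lerDl. Qed.

(** Taylor expansion with the squared increment multiplied out: the part in dW^2 survives, the cross
    term is kept since its mean is zero, and (al h)^2 is bounded. Each term is arranged as an
    [F s]-measurable factor times a function of dW, the factor 1 in front of the cube included. *)
Let pointwise w :
  yam n (Z w + al w * h + be w * dW w) <=
  yam n (Z w) + h * (yam_p n (Z w) * al w) + yam_p n (Z w) * be w * dW w +
  2^-1 * (yam_q n (Z w) * be w ^+ 2 * dW w ^+ 2) +
  h * (yam_q n (Z w) * al w * be w * dW w) +
  (K / 2 * (Ma * h) ^+ 2 + 4 * L * (Ma * h) ^+ 3) +
  4 * L * Mb ^+ 3 * (1 * `|dW w| ^+ 3).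
Proof.
rewrite -addrA; have := yam_taylor n0 (Z w) (al w * h + be w * dW w).
move=> /(le_trans (ler_norm _)); rewrite -/L.
have := ler_wpM2l L0 (cube_normD (al w * h) (be w * dW w)).
have a1 : `|al w * h| <= Ma * h by rewrite normrM (ger0_norm h0) ler_wpM2r.
have a3 : `|al w * h| ^+ 3 <= (Ma * h) ^+ 3.
  by rewrite lerXn2r ?nnegrE// (le_trans _ a1).
have b3 : `|be w * dW w| ^+ 3 <= Mb ^+ 3 * `|dW w| ^+ 3.
  rewrite normrM exprMn ler_wpM2r ?exprn_ge0//.
  by rewrite lerXn2r ?nnegrE ?beM// (le_trans _ (beM w)).
have a2 : yam_q n (Z w) * (al w * h) ^+ 2 <= K * (Ma * h) ^+ 2.
  apply: ler_pM; rewrite ?yam_q_ge0 ?sqr_ge0 ?yam_q_le//.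
  by rewrite -(real_normK (num_real (al w * h))) lerXn2r ?nnegrE// (le_trans _ a1).
have := ler_wpM2l L0 a3; have := ler_wpM2l L0 b3.
move: a2.
set Y' := yam n (Z w + (al w * h + be w * dW w)).
set c0 := `|al w * h + be w * dW w| ^+ 3; set c1 := `|al w * h| ^+ 3.
set c2 := `|be w * dW w| ^+ 3; set c4 := `|dW w| ^+ 3.
move: Y' (yam n (Z w)) (yam_p n (Z w)) (yam_q n (Z w)) (al w) (be w) (dW w)
  c0 c1 c2 c4 K L => Y' Y p q A B D c0 c1 c2 c4 K' L' {}a2 e1 e2 e3 e4.
by lra.
Qed.

Let dWM f := incr_mean BM s0 sh (f := f).

Lemma intg_step_sqr : intg P (fun w => (Z w + al w * h + be w * dW w) ^+ 2).
Proof.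
have [d2 _] := incr_sqr BM s0 sh mw1 (intg_cst P 1).
apply: (intg_le _ _ (intgD (intgD (intgZ 3 Z2) (intg_cst P (3 * (Ma * h) ^+ 2))) (intgZ (3 * Mb ^+ 2) d2))).
  apply: measurable_funX; apply: measurable_funD; last first.
    apply: measurable_funM; last exact: measurable_incr.
    exact: mw_measurable mbe.
  apply: measurable_funD; first exact: mw_measurable mZ.
  by apply: measurable_funM => //; exact: mw_measurable mal.
move=> w /=; rewrite ger0_norm ?sqr_ge0//; apply: le_trans (ler_norm _).
have a1 : (al w * h) ^+ 2 <= (Ma * h) ^+ 2.
  rewrite -(real_normK (num_real (al w * h))) lerXn2r ?nnegrE//.
    by apply: mulr_ge0 => //; apply: le_trans (alM w).
  by rewrite normrM (ger0_norm h0) ler_wpM2r.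
have b1 : (be w * dW w) ^+ 2 <= Mb ^+ 2 * dW w ^+ 2.
  rewrite exprMn ler_wpM2r ?sqr_ge0// -(real_normK (num_real (be w))) lerXn2r ?nnegrE//.
  by apply: le_trans (beM w).
rewrite /= mul1r -(mulrA 3 (Mb ^+ 2)); move: a1 b1.
move: (Z w) (al w * h) (be w * dW w) (Ma * h) (Mb ^+ 2 * _) => z x y m1 m2 a1 b1.
have := sqr_ge0 (z - x); have := sqr_ge0 (z - y); have := sqr_ge0 (x - y); nra.
Qed.

(** Taking expectations in [pointwise]: terms linear in dW vanish and dW^2 contributes [h * v]. *)
Lemma yam_one_step :
  Ex P (fun w => yam n (Z w + al w * h + be w * dW w)) <=
  Ex P (fun w => yam n (Z w)) + h * Ex P (fun w => yam_p n (Z w) * al w) +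
  h * v / 2 * Ex P (fun w => yam_q n (Z w) * be w ^+ 2) + step_err.
Proof.
have mZ' := mw_measurable mZ; have Zi := intg_of_sqr mZ' Z2.
have mp : measurable_wrt (F s) (fun w => yam_p n (Z w)).
  by apply: mw_comp => //; exact: measurable_yam_p.
have mq : measurable_wrt (F s) (fun w => yam_q n (Z w)).
  by apply: mw_comp => //; exact: measurable_yam_q.
have q0 w : 0 <= yam_q n (Z w) by exact: yam_q_ge0.
have qK w : yam_q n (Z w) <= K by exact: yam_q_le.
have Ma0 w : 0 <= Ma := le_trans (normr_ge0 _) (alM w).
have Mb0 w : 0 <= Mb := le_trans (normr_ge0 _) (beM w).
have i1 : intg P (fun w => yam n (Z w)) by exact: intg_yam.
have mpal := mwM mp mal; have mpbe := mwM mp mbe.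
have i2 : intg P (fun w => yam_p n (Z w) * al w).
  apply: (intg_le (mw_measurable mpal) _ (intgZ (K * Ma) Zi)) => w.
  rewrite normrM; apply: le_trans (ler_pM _ _ (yam_p_norm n0 (Z w)) (alM w)) _ => //.
  by rewrite -/K mulrAC normrM ler_wpM2r// ler_norm.
have i3' : intg P (fun w => yam_p n (Z w) * be w).
  apply: (intg_le (mw_measurable mpbe) _ (intgZ (K * Mb) Zi)) => w.
  rewrite normrM; apply: le_trans (ler_pM _ _ (yam_p_norm n0 (Z w)) (beM w)) _ => //.
  by rewrite -/K mulrAC normrM ler_wpM2r// ler_norm.
have [i3 E3] := dWM mpbe i3'.
have mqb : measurable_wrt (F s) (fun w => yam_q n (Z w) * be w ^+ 2).
  apply: mwM => //; under [X in measurable_wrt _ X]eq_fun do rewrite expr2.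
  exact: mwM.
have i4' : intg P (fun w => yam_q n (Z w) * be w ^+ 2).
  apply: (intg_bd P (M := K * Mb ^+ 2) (mw_measurable mqb)) => w.
  rewrite ger0_norm; last by rewrite mulr_ge0 ?sqr_ge0.
  apply: ler_pM => //; first exact: sqr_ge0.
  by rewrite -(real_normK (num_real (be w))) lerXn2r ?nnegrE// (Mb0 w).
have [i4 E4] := incr_sqr BM s0 sh mqb i4'.
have mqab := mwM (mwM mq mal) mbe.
have i5' : intg P (fun w => yam_q n (Z w) * al w * be w).
  apply: (intg_bd P (M := K * Ma * Mb) (mw_measurable mqab)) => w.
  by rewrite !normrM (ger0_norm (q0 w)); apply: ler_pM; [by rewrite mulr_ge0|by []|by apply: ler_pM|exact: beM].
have [i5 E5] := dWM mqab i5'.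
have [i7 E7] := incr_pow BM s0 sh (isT : (0 < 3)%N) (isT : (3 <= 3)%N) mw1 (intg_cst P 1).
have iL : intg P (fun w => yam n (Z w + al w * h + be w * dW w)).
  apply: (intg_yam (Z := fun w => Z w + al w * h + be w * dW w)) => //; last exact: intg_step_sqr.
  apply: measurable_funD; last first.
    apply: measurable_funM; last exact: measurable_incr.
    exact: mw_measurable mbe.
  by apply: measurable_funD => //; apply: measurable_funM => //; exact: mw_measurable mal.
have j2 := intgD i1 (intgZ h i2).
have j3 := intgD j2 i3.
have j4 := intgD j3 (intgZ 2^-1 i4).
have j5 := intgD j4 (intgZ h i5).
have j6 := intgD j5 (intg_cst P (K / 2 * (Ma * h) ^+ 2 + 4 * L * (Ma * h) ^+ 3)).
have j7 := intgD j6 (intgZ (4 * L * Mb ^+ 3) i7).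
apply: (le_trans (le_Ex iL j7 pointwise)).
rewrite (ExD j6 (intgZ _ i7)) (ExD j5 (intg_cst P _)) (ExD j4 (intgZ h i5)).
rewrite (ExD j3 (intgZ _ i4)) (ExD j2 i3) (ExD i1 (intgZ h i2)).
rewrite (ExZ h i2) (ExZ _ i4) (ExZ h i5) (ExZ _ i7) E3 E4 E5 E7 !Ex_cst.
have -> : s + h - s = h by rewrite addrAC subrr add0r.
rewrite /step_err -/K -/L.
set e1 := Ex P (fun w => yam n (Z w)).
set e2 := Ex P (fun w => yam_p n (Z w) * al w).
set e3 := Ex P (fun w => yam_q n (Z w) * be w ^+ 2).
rewrite le_eqVlt; apply/orP; left; apply/eqP.
by move: e1 e2 e3 (Num.sqrt h) c3 v K L => e1 e2 e3 sq c v0 K' L'; field.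
Qed.

End one_step.

(** * The Yamada-Watanabe estimate below a truncation level *)

Section truncated_comparison.
Context {d : measure_display} {Omega : measurableType d} {R : realType}
  (P : probability Omega R).
Variable W : R -> {RV P >-> R}.
Hypothesis BM : brownian_motion W.
Local Notation F := (augmented_filtration P W).
Local Notation v := (@normal_abs_moment R 2).
Local Notation c3 := (@normal_abs_moment R 3).

Variables (k theta gamma x y : R) (X Y : R -> {RV P >-> R}).
Hypotheses (k0 : 0 < k) (gamma0 : 0 < gamma).
Hypothesis cirX : cir_strong_solution k theta gamma W x X.
Hypothesis cirY : cir_strong_solution k theta gamma W y Y.
Variables (T N : R).
Hypotheses (T0 : 0 < T) (N0 : 0 < N).

Section fixed_mesh.
Variable m : nat.
Local Notation u := (tgrid T m).
Local Notation h := (T / m%:R).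

(* cut_diff is the Euler scheme of X - Y, frozen once X or Y exceeds N: all its
   coefficients are bounded, and it is the difference of the two Euler schemes as
   long as no freezing occurs (cut_diff_euler). *)
Definition cir_below (j : nat) : set Omega :=
  [set w | forall i, (i <= j)%N -> X (u i) w <= N /\ Y (u i) w <= N].
Definition cir_diff (j : nat) (w : Omega) : R := X (u j) w - Y (u j) w.
Definition cut_drift (j : nat) (w : Omega) : R :=
  \1_(cir_below j) w * (- k * cir_diff j w).
Definition cut_vol (j : nat) (w : Omega) : R :=
  \1_(cir_below j) w * (gamma * (Num.sqrt (X (u j) w) - Num.sqrt (Y (u j) w))).
Definition cut_diff (j : nat) (w : Omega) : R :=
  x - y + \sum_(i < j) cut_drift i w * h + grid_sum W u cut_vol j w.
(** The distance counts only on paths not yet frozen, since after freezing [cut_diff] stops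
    following [cir_diff]. *)
Definition cut_gap (j : nat) (w : Omega) : R :=
  \1_(cir_below j) w * `|cut_diff j w - cir_diff j w|.

Local Notation A := cir_below.
Local Notation D := cir_diff.
Local Notation al := cut_drift.
Local Notation be := cut_vol.
Local Notation Z := cut_diff.

Lemma cir_belowS j w : A j.+1 w -> A j w.
Proof. by move=> Aw i ij; exact: Aw (leqW ij). Qed.

Lemma cir_below_sub i j : (i <= j)%N -> A j `<=` A i.
Proof. by move=> ij w Aw l li; apply: Aw; exact: leq_trans ij. Qed.

Lemma mw_cir_below j : F (u j) (A j).
Proof.
pose G t := process_events `[0, t] (fun s => W s) `|` null_sets P.
have b i : F (u i) ([set w | X (u i) w <= N] `&` [set w | Y (u i) w <= N]).
  apply: (@measurableI _ (g_sigma_algebraType (G (u i)))).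
    by apply: mw_level_le; exact: (cir_adapted cirX (tgrid_ge0 T0 m i)).
  by apply: mw_level_le; exact: (cir_adapted cirY (tgrid_ge0 T0 m i)).
elim: j => [|j ih].
  have -> : A 0 = [set w | X (u 0) w <= N] `&` [set w | Y (u 0) w <= N].
    apply/seteqP; split => [w Aw|w Aw i]; first exact: Aw.
    by rewrite leqn0 => /eqP ->.
  exact: b.
have -> : A j.+1 = A j `&` ([set w | X (u j.+1) w <= N] `&` [set w | Y (u j.+1) w <= N]).
  apply/seteqP; split => [w Aw|w [Aw Bw] i].
    by split; [exact: cir_belowS|exact: Aw].
  by rewrite leq_eqVlt => /orP[/eqP -> //|]; rewrite ltnS => /Aw.
apply: (@measurableI _ (g_sigma_algebraType (G (u j.+1)))) (b j.+1).
exact: (filtration_mono (tgrid_leS T0 m j)).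
Qed.

Lemma measurable_cir_below j : measurable (A j).
Proof. exact: filtration_measurable (@mw_cir_below j). Qed.

Lemma mw_cir_diff j : measurable_wrt (F (u j)) (D j).
Proof.
by apply: mwB; [exact: cir_adapted cirX _ (tgrid_ge0 T0 m j)|exact: cir_adapted cirY _ (tgrid_ge0 T0 m j)].
Qed.

Lemma mw_cut_drift j : measurable_wrt (F (u j)) (al j).
Proof.
apply: mwM; first exact: mw_indic (@mw_cir_below j).
by apply: mwM; [exact: mw_cst|exact: mw_cir_diff].
Qed.

Lemma mw_cut_vol j : measurable_wrt (F (u j)) (be j).
Proof.
apply: mwM; first exact: mw_indic (@mw_cir_below j).
apply: mwM; first exact: mw_cst.
have ms : measurable_fun setT (fun y : R => Num.sqrt y).
  by apply: continuous_measurable_fun; exact: sqrt_continuous.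
by apply: mwB; apply: (mw_comp ms); [exact: cir_adapted cirX _ (tgrid_ge0 T0 m j)|exact: cir_adapted cirY _ (tgrid_ge0 T0 m j)].
Qed.

Lemma mw_cut_diff j : measurable_wrt (F (u j)) (Z j).
Proof.
apply: mwD; last first.
  apply: (mw_grid_sum (tgrid_ge0 T0 m) (tgrid_leS T0 m)) => i _; exact: mw_cut_vol.
apply: mwD; first exact: mw_cst.
apply: (mw_sum (f := fun i w => al i w * h)) => i ij.
apply: mwM; last exact: mw_cst.
by apply: (measurable_wrtS _ (@mw_cut_drift i)); apply: filtration_mono; apply: tgrid_le_mono => //; exact: ltnW.
Qed.

Lemma cir_diff_le j w : A j w -> `|D j w| <= N.
Proof.
move=> Aw; have [Xw Yw] := Aw j (leqnn j).
have := cir_ge0 cirX w (tgrid_ge0 T0 m j); have := cir_ge0 cirY w (tgrid_ge0 T0 m j).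
by move=> Y0 X0; rewrite /cir_diff ler_norml; apply/andP; split; lra.
Qed.

Lemma cut_drift_le j w : `|al j w| <= k * N.
Proof.
rewrite /cut_drift indicE; case: (boolP (w \in A j)) => [/set_mem Aw|_].
  by rewrite mul1r normrM normrN (gtr0_norm k0) ler_pM2l// cir_diff_le.
by rewrite mul0r normr0 mulr_ge0 ?ltW.
Qed.

Lemma sqrt_diff_sqr (a b : R) : 0 <= a -> 0 <= b ->
  (Num.sqrt a - Num.sqrt b) ^+ 2 <= `|a - b|.
Proof.
move=> a0 b0; rewrite -{2}(sqr_sqrtr a0) -{2}(sqr_sqrtr b0).
have := sqrtr_ge0 a; have := sqrtr_ge0 b.
move: (Num.sqrt a) (Num.sqrt b) => p q q0 p0.
rewrite subr_sqr normrM (ger0_norm (addr_ge0 p0 q0)) -real_normK ?num_real// expr2.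
by rewrite ler_wpM2l// ler_norml; apply/andP; split; lra.
Qed.

Lemma cut_vol_sqr j w : be j w ^+ 2 <= gamma ^+ 2 * (\1_(A j) w * `|D j w|).
Proof.
rewrite /cut_vol exprMn [leRHS]mulrCA indicE; case: (w \in A j); last by rewrite expr0n !mul0r.
rewrite expr1n !mul1r exprMn ler_wpM2l ?sqr_ge0//; apply: sqrt_diff_sqr.
  exact: cir_ge0 cirX _ _ (tgrid_ge0 T0 m j).
exact: cir_ge0 cirY _ _ (tgrid_ge0 T0 m j).
Qed.

Lemma indic_diff_le j w : \1_(A j) w * `|D j w| <= N.
Proof.
rewrite indicE; case: (boolP (w \in A j)) => [/set_mem Aw|_].
  by rewrite mul1r cir_diff_le.
by rewrite mul0r ltW.
Qed.

Lemma cut_vol_sqr_le j w : be j w ^+ 2 <= gamma ^+ 2 * N.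
Proof. by apply: (le_trans (cut_vol_sqr j w)); rewrite ler_wpM2l ?sqr_ge0// indic_diff_le. Qed.

Lemma cut_vol_le j w : `|be j w| <= gamma * Num.sqrt N.
Proof.
rewrite -(@ler_pXn2r _ 2)// ?nnegrE ?mulr_ge0 ?sqrtr_ge0 ?(ltW gamma0)//.
by rewrite real_normK ?num_real// [leRHS]exprMn (sqr_sqrtr (ltW N0)) cut_vol_sqr_le.
Qed.

Lemma cut_diffS j w :
  Z j.+1 w = Z j w + al j w * h + be j w * incr W (u j) (u j + h) w.
Proof.
have -> : u j + h = u j.+1 by rewrite -(tgridS T m j) addrC subrK.
by rewrite /cut_diff /grid_sum !big_ord_recr/=; ring.
Qed.

Let h0 : 0 <= h. Proof. by rewrite divr_ge0// ltW. Qed.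

Lemma intg_cut_diff_sqr j : intg P (fun w => Z j w ^+ 2).
Proof.
elim: j => [|j ih].
  under [X in intg P X]eq_fun do rewrite /cut_diff /grid_sum !big_ord0.
  exact: (intg_cst P ((x - y + 0 + 0) ^+ 2)).
under [X in intg P X]eq_fun do rewrite cut_diffS.
exact: (intg_step_sqr BM (tgrid_ge0 T0 m j) h0 (@mw_cut_diff j) (@mw_cut_drift j)
  (@mw_cut_vol j) ih (cut_drift_le j) (cut_vol_le j)).
Qed.

Lemma measurable_cut_diff j : measurable_fun setT (Z j).
Proof. exact: mw_measurable (@mw_cut_diff j). Qed.

Lemma intg_cut_diff j : intg P (Z j).
Proof. exact: intg_of_sqr (measurable_cut_diff j) (intg_cut_diff_sqr j). Qed.

(** A bound independent of the mesh: it provides the uniform integrability that turns convergence in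
    probability of the gap into convergence in mean. *)
Lemma Ex_cut_diff_sqr j : (0 < m)%N -> (j <= m)%N ->
  Ex P (fun w => Z j w ^+ 2) <=
  3 * ((x - y) ^+ 2 + (k * N * T) ^+ 2 + v * (gamma ^+ 2 * N * T)).
Proof.
move=> m0 jm.
have mh : j%:R * h <= T.
  have -> : j%:R * h = u j by [].
  exact: tgrid_leT.
have [i2 E2] := grid_sum_sqr BM (tgrid_ge0 T0 m) (tgrid_leS T0 m) (g := be) (n := j)
  (fun i _ => @mw_cut_vol i) (fun i _ => ex_intro _ _ (cut_vol_le i)).
have le3 : Ex P (fun w => Z j w ^+ 2) <=
    Ex P (fun w => 3 * ((x - y) ^+ 2 + (k * N * T) ^+ 2) + 3 * grid_sum W u be j w ^+ 2).
  apply: le_Ex; first exact: intg_cut_diff_sqr.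
    by apply: intgD; [exact: intg_cst|exact: intgZ].
  move=> w; rewrite /cut_diff.
  have a1 : (\sum_(i < j) al i w * h) ^+ 2 <= (k * N * T) ^+ 2.
    rewrite -(real_normK (num_real (\sum_(i < j) _))) lerXn2r ?nnegrE//.
      by rewrite !mulr_ge0 ?ltW.
    apply: (le_trans (ler_norm_sum _ _ _)).
    apply: (@le_trans _ _ (\sum_(i < j) k * N * h)).
      apply: ler_sum => i _; rewrite normrM (ger0_norm h0) ler_wpM2r//; exact: cut_drift_le.
    have -> : \sum_(i < j) k * N * h = k * N * (j%:R * h).
      by rewrite sumr_const card_ord -[_ *+ j]mulr_natl; ring.
    by rewrite ler_wpM2l// mulr_ge0// ltW.
  move: a1; set s := \sum_(i < j) _; move: s (grid_sum _ _ _ _ _) (x - y) (k * N * T) => s g xy M a1.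
  have := sqr_ge0 (s - g); have := sqr_ge0 (s - xy); have := sqr_ge0 (g - xy); nra.
apply: (le_trans le3); rewrite ExD; [|exact: intg_cst|exact: intgZ].
rewrite Ex_cst ExZ// E2 -mulrDr ler_pM2l// lerD2l.
apply: (ler_wpM2l (normal_abs_moment_ge0 2)).
have isq i : intg P (fun w => be i w ^+ 2 * (u i.+1 - u i)).
  apply: (intg_bd P (M := gamma ^+ 2 * N * h)).
    apply: measurable_funM; last exact: measurable_cst.
    by apply: measurable_funX; exact: mw_measurable (@mw_cut_vol i).
  move=> w; rewrite tgridS (ger0_norm (mulr_ge0 (sqr_ge0 _) h0)).
  by rewrite ler_wpM2r// cut_vol_sqr_le.
rewrite -[leRHS](Ex_cst P); apply: le_Ex; first exact: (intg_sum (f := fun i w => be i w ^+ 2 * (u i.+1 - u i)) (fun i _ => isq i)).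
  exact: intg_cst.
move=> w /=.
apply: (@le_trans _ _ (\sum_(i < j) gamma ^+ 2 * N * h)).
  by apply: ler_sum => i _; rewrite tgridS ler_wpM2r// cut_vol_sqr_le.
have -> : \sum_(i < j) gamma ^+ 2 * N * h = gamma ^+ 2 * N * (j%:R * h).
  by rewrite sumr_const card_ord -[_ *+ j]mulr_natl; ring.
by rewrite ler_wpM2l// mulr_ge0 ?sqr_ge0// ltW.
Qed.

Lemma cut_diff_euler j w : N <= m%:R -> gamma * Num.sqrt N <= m%:R -> A j w ->
  Z j w = euler W k theta gamma x X T m j w - euler W k theta gamma y Y T m j w.
Proof.
move=> Nm gm Aw; rewrite /cut_diff /euler /grid_sum -addrA -big_split/=.
rewrite opprD addrACA -sumrB; congr (_ + _).
apply: eq_bigr => i _.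
have ij : (i <= j)%N by exact: ltnW.
have [Xi Yi] := Aw i ij.
have Ai : A i w := cir_below_sub ij Aw.
rewrite /cut_drift /cut_vol indicE mem_set// !mul1r /cir_diff.
have sX : gamma * Num.sqrt (X (u i) w) <= m%:R.
  by apply: le_trans gm; rewrite ler_pM2l//; exact: ler_wsqrtr.
have sY : gamma * Num.sqrt (Y (u i) w) <= m%:R.
  by apply: le_trans gm; rewrite ler_pM2l//; exact: ler_wsqrtr.
(* Below level [N] the caps of the Euler sums are inactive once [m] dominates both [N] and
   [gamma * Num.sqrt N]. *)
rewrite (min_l (le_trans Xi Nm)) (min_l (le_trans Yi Nm)) (min_l sX) (min_l sY).
by ring.
Qed.

Lemma measurable_cut_gap j : measurable_fun setT (cut_gap j).
Proof.
apply: measurable_funM; first exact: measurable_indic (measurable_cir_below j).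
apply: measurableT_comp => //; apply: measurable_funB; first exact: measurable_cut_diff.
exact: mw_measurable (@mw_cir_diff j).
Qed.

Lemma cut_gap_sqr j w : cut_gap j w ^+ 2 <= 2 * Z j w ^+ 2 + 2 * N ^+ 2.
Proof.
have e0 : 0 <= 2 * Z j w ^+ 2 + 2 * N ^+ 2 by rewrite addr_ge0// mulr_ge0// sqr_ge0.
rewrite /cut_gap indicE; case: (boolP (w \in A j)) => [/set_mem Aw|_]; last by rewrite mul0r expr0n.
rewrite mul1r real_normK ?num_real//.
have : D j w ^+ 2 <= N ^+ 2.
  by rewrite -(real_normK (num_real (D j w))) lerXn2r ?nnegrE ?cir_diff_le// ltW.
by move: (Z j w) (D j w) => z g hg; have := sqr_ge0 (z + g); nra.
Qed.

Lemma intg_cut_gap j : intg P (cut_gap j).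
Proof.
apply: (intg_of_sqr (measurable_cut_gap j)).
apply: (intg_le (measurable_funX _ (measurable_cut_gap j)) _
  (intgD (intgZ 2 (intg_cut_diff_sqr j)) (intg_cst P (2 * N ^+ 2)))) => w /=.
by rewrite ger0_norm ?sqr_ge0// (le_trans (cut_gap_sqr j w)) ?ler_norm.
Qed.


(** [drift_rate] collects what remains when the derivatives of [yam] are evaluated at the true
    difference and vanishes as n grows; [gap_rate] is the price of evaluating them at [cut_diff]
    instead, and multiplies an error that vanishes with the mesh. *)
Let drift_rate (n : R) : R := (k + v * gamma ^+ 2 / 2) / n.
Let gap_rate (n : R) : R :=
  k * ((n * yam_a n)^-1 * N) + v * gamma ^+ 2 / 2 * ((n * yam_a n ^+ 2)^-1 * N).

(** The identity is added to [yam] so that the sum behaves like twice the positive part and sees the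
    favourable sign of the drift. *)
Lemma cut_yam_step (n : R) j : 0 < n ->
  Ex P (fun w => yam n (Z j.+1 w)) + Ex P (Z j.+1) <=
  Ex P (fun w => yam n (Z j w)) + Ex P (Z j) +
  h * (drift_rate n + gap_rate n * Ex P (cut_gap j)) +
  step_err n h (k * N) (gamma * Num.sqrt N).
Proof.
move=> n0.
have uS : u j <= u j + h by rewrite lerDl.
have mZ := @mw_cut_diff j; have mal := @mw_cut_drift j; have mbe := @mw_cut_vol j.
have mZ' := measurable_cut_diff j.
have iZ := intg_cut_diff j; have iZ2 := intg_cut_diff_sqr j.
have ial : intg P (al j) := intg_bd P (mw_measurable mal) (cut_drift_le j).
have ibe : intg P (be j) := intg_bd P (mw_measurable mbe) (cut_vol_le j).
have ig := intg_cut_gap j.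
have [idW EdW] := incr_mean BM (tgrid_ge0 T0 m j) uS mbe ibe.
have E1 : Ex P (Z j.+1) = Ex P (Z j) + h * Ex P (al j).
  under eq_Ex do rewrite cut_diffS (mulrC (al j _)).
  rewrite (ExD (intgD iZ (intgZ h ial)) idW) (ExD iZ (intgZ h ial)) (ExZ h ial).
  by rewrite EdW addr0.
have := yam_one_step BM n0 (tgrid_ge0 T0 m j) h0 mZ mal mbe iZ2 (cut_drift_le j) (cut_vol_le j).
under eq_Ex do rewrite -cut_diffS.
rewrite E1 => step.
have K0 : 0 <= (n * yam_a n)^-1 by rewrite invr_ge0 mulr_ge0 ?ltW// yam_a_gt0.
have L0 : 0 <= (n * yam_a n ^+ 2)^-1 by rewrite invr_ge0 mulr_ge0 ?sqr_ge0// ltW.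
have v0 : 0 <= v := normal_abs_moment_ge0 2.
have mp : measurable_fun setT (fun w => yam_p n (Z j w)).
  exact: (measurableT_comp (measurable_yam_p n0) mZ').
have mq : measurable_fun setT (fun w => yam_q n (Z j w)).
  exact: (measurableT_comp (measurable_yam_q n0) mZ').
have ip : intg P (fun w => yam_p n (Z j w) * al j w).
  apply: (intg_le _ _ (intgZ ((n * yam_a n)^-1 * (k * N)) iZ)).
    by apply: measurable_funM => //; exact: mw_measurable mal.
  move=> w; rewrite normrM; apply: le_trans (ler_pM _ _ (yam_p_norm n0 (Z j w)) (cut_drift_le j w)) _ => //.
  by rewrite mulrAC normrM ler_wpM2r// ler_norm.
have iq : intg P (fun w => yam_q n (Z j w) * be j w ^+ 2).
  apply: (intg_bd P (M := (n * yam_a n)^-1 * (gamma ^+ 2 * N))).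
    by apply: measurable_funM => //; apply: measurable_funX; exact: mw_measurable mbe.
  move=> w; rewrite ger0_norm; last by apply: mulr_ge0; [exact: yam_q_ge0|exact: sqr_ge0].
  apply: ler_pM; [exact: yam_q_ge0|exact: sqr_ge0|exact: yam_q_le|exact: cut_vol_sqr_le].
have drift : Ex P (fun w => yam_p n (Z j w) * al j w) + Ex P (al j) <=
    k / n + k * ((n * yam_a n)^-1 * N) * Ex P (cut_gap j).
  rewrite -(ExD ip ial) -(ExZ _ ig) -[k / n](Ex_cst P) -(ExD (intg_cst P _) (intgZ _ ig)).
  apply: le_Ex; [exact: intgD|by apply: intgD; [exact: intg_cst|exact: intgZ]|move=> w /=].
  rewrite /cut_drift /cut_gap indicE; case: (boolP (w \in A j)) => [/set_mem Aw|_]; last first.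
    by rewrite !mul0r !mulr0 !addr0 divr_ge0// ltW.
  rewrite !mul1r.
  have d1 := yam_drift n0 (D j w).
  (* The Lipschitz bound moves [yam_p] from [Z] to [D], where [yam_drift] applies; the bound [N] on
     [D] holds because the path is not frozen. *)
  have d2 : (yam_p n (D j w) - yam_p n (Z j w)) * D j w <= (n * yam_a n)^-1 * `|Z j w - D j w| * N.
    apply: (le_trans (ler_norm _)); rewrite normrM; apply: ler_pM => //.
      by rewrite (distrC (Z j w)); exact: yam_p_lip.
    exact: cir_diff_le.
  move: d1 d2; set e1 := (_ * _)^-1; set e2 := `|_ - _|.
  move: (yam_p n (Z j w)) (yam_p n (D j w)) (D j w) e1 e2 => p p' D' e1 e2 d1 d2.
  have := ler_wpM2l (ltW k0) (lerD d1 d2).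
  by set t := n^-1; lra.
have vol : Ex P (fun w => yam_q n (Z j w) * be j w ^+ 2) <=
    gamma ^+ 2 / n + gamma ^+ 2 * ((n * yam_a n ^+ 2)^-1 * N) * Ex P (cut_gap j).
  rewrite -(ExZ _ ig) -[gamma ^+ 2 / n](Ex_cst P) -(ExD (intg_cst P _) (intgZ _ ig)).
  apply: le_Ex => //; [by apply: intgD; [exact: intg_cst|exact: intgZ]|move=> w /=].
  apply: le_trans (ler_wpM2l (yam_q_ge0 n0 _) (cut_vol_sqr j w)) _.
  rewrite /cut_gap indicE; case: (boolP (w \in A j)) => [/set_mem Aw|_]; last first.
    by rewrite !mul0r !mulr0 !addr0 divr_ge0 ?sqr_ge0// ltW.
  rewrite !mul1r.
  have d1 := yam_q_norm n0 (D j w).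
  have d2 : (yam_q n (Z j w) - yam_q n (D j w)) * `|D j w| <= (n * yam_a n ^+ 2)^-1 * `|Z j w - D j w| * N.
    apply: (le_trans (ler_norm _)); rewrite normrM normr_id; apply: ler_pM => //.
      exact: yam_q_lip.
    exact: cir_diff_le.
  move: d1 d2; set e1 := (n * yam_a n ^+ 2)^-1; set e2 := `|Z j w - _|; set e3 := `|D j w|.
  move: (yam_q n (Z j w)) (yam_q n (D j w)) e3 e1 e2 => p p' D' e1 e2 d1 d2.
  have := ler_wpM2l (sqr_ge0 gamma) (lerD d1 d2).
  by set t := n^-1; lra.
apply: (le_trans (lerD step (lexx _))).
have e1 := ler_wpM2l h0 drift.
have e2 : h * v / 2 * Ex P (fun w => yam_q n (Z j w) * be j w ^+ 2) <=
  h * v / 2 * (gamma ^+ 2 / n + gamma ^+ 2 * ((n * yam_a n ^+ 2)^-1 * N) * Ex P (cut_gap j)).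
  by apply: ler_wpM2l => //; rewrite divr_ge0// mulr_ge0.
have := lerD e1 e2; rewrite /drift_rate /gap_rate.
set x1 := Ex P (fun w => yam_p n _ * _); set x2 := Ex P (al j).
set x3 := Ex P (fun w => yam_q n _ * _); set x4 := Ex P (fun w => yam n _).
move: (h) (Ex P (Z j)) (Ex P (cut_gap j)) (n * yam_a n)^-1 (n * yam_a n ^+ 2)^-1 (step_err _ _ _ _) x1 x2 x3 x4 v n^-1.
move=> H z g K L er x1 x2 x3 x4 V n1; lra.
Qed.

Lemma cut_yam_sum (n delta : R) j : 0 < n ->
  (forall i, (i < j)%N -> Ex P (cut_gap i) <= delta) ->
  Ex P (fun w => yam n (Z j w)) + Ex P (Z j) <=
  yam n (x - y) + (x - y) +
  j%:R * (h * (drift_rate n + gap_rate n * delta) +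
  step_err n h (k * N) (gamma * Num.sqrt N)).
Proof.
move=> n0; elim: j => [_|j ih gd].
  have Z0 w : Z 0 w = x - y by rewrite /cut_diff /grid_sum !big_ord0 !addr0.
  under eq_Ex do rewrite Z0; under [X in _ + X]eq_Ex do rewrite Z0.
  by rewrite (Ex_cst P (yam n (x - y))) (Ex_cst P (x - y)) mul0r addr0.
apply: (le_trans (cut_yam_step j n0)).
have G0 : 0 <= gap_rate n.
  have v0 : 0 <= v := normal_abs_moment_ge0 2.
  apply: addr_ge0; apply: mulr_ge0; rewrite ?(ltW k0)//.
  - by rewrite mulr_ge0 ?(ltW N0)// invr_ge0 mulr_ge0 ?ltW// yam_a_gt0.
  - by rewrite divr_ge0// mulr_ge0// sqr_ge0.
  - by rewrite mulr_ge0 ?(ltW N0)// invr_ge0 mulr_ge0 ?sqr_ge0// ltW.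
have e1 := ler_wpM2l h0 (ler_wpM2l G0 (gd j (ltnSn j))).
have := ih (fun i ij => gd i (leqW ij)).
move: e1; rewrite -natr1.
set x4 := Ex P (fun w => yam n (Z j w)).
by move: (h) (gap_rate n) (drift_rate n) (Ex P (cut_gap j)) (Ex P (Z j)) (step_err _ _ _ _) x4 (yam n (x - y)) j%:R
  => H g r c z e y4 y0 J e1 e2; lra.
Qed.

End fixed_mesh.

(** Convergence in probability with bounded second moments gives convergence in mean, through g <= e
    + eta g^2 + 1_E / (4 eta) with E the event g >= e. *)
Lemma cut_gap_cvg (delta : R) : 0 < delta -> exists m0, forall m, (m0 <= m)%N ->
  (0 < m)%N -> forall j, (j <= m)%N -> Ex P (cut_gap m j) <= delta.
Proof.
move=> d0.
pose C2 := 3 * ((x - y) ^+ 2 + (k * N * T) ^+ 2 + v * (gamma ^+ 2 * N * T)).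
pose M := 2 * C2 + 2 * N ^+ 2 + 1.
have C20 : 0 <= C2.
  rewrite mulr_ge0// addr_ge0//; first by rewrite addr_ge0 ?sqr_ge0.
  by rewrite mulr_ge0 ?normal_abs_moment_ge0// mulr_ge0 ?(ltW T0)// mulr_ge0 ?(ltW N0)// sqr_ge0.
have M0 : 0 < M by rewrite ltr_wpDl// addr_ge0// mulr_ge0 ?sqr_ge0.
(* Each of the three terms becomes [delta / 3]: [M] bounds the second moment of the gap, and [pr] is
   the probability allowed to each of the two Euler errors. *)
pose e := delta / 3; pose eta := delta / (3 * M); pose pr := 2 * eta * delta / 3.
have e0 : 0 < e by rewrite divr_gt0.
have eta0 : 0 < eta by rewrite divr_gt0 ?mulr_gt0.
have pr0 : 0 < pr by apply: divr_gt0 => //; apply: mulr_gt0 => //; apply: mulr_gt0.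
have e20 : 0 < e / 2 by rewrite divr_gt0.
have [m1 h1] := euler_cvg BM k0 gamma0 cirX T0 e20 pr0.
have [m2 h2] := euler_cvg BM k0 gamma0 cirY T0 e20 pr0.
(* From this mesh on the caps are inactive, as [cut_diff_euler] requires. *)
pose m3 := (Num.trunc (Num.max N (gamma * Num.sqrt N))).+1.
exists (maxn m1 (maxn m2 m3)) => m; rewrite !geq_max => /and3P[m1m m2m m3m] m0 j jm.
have : Num.max N (gamma * Num.sqrt N) <= m%:R.
  apply: ltW; apply: (@lt_le_trans _ _ m3%:R); last by rewrite ler_nat.
  exact: truncnS_gt.
rewrite ge_max => /andP[Nm gm].
pose E : set Omega := [set w | e <= cut_gap m j w].
have mE : measurable E by apply: measurable_level_ge; exact: measurable_cut_gap.
pose EX := [set w | e / 2 <= `|X (tgrid T m j) w - euler W k theta gamma x X T m j w|].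
pose EY := [set w | e / 2 <= `|Y (tgrid T m j) w - euler W k theta gamma y Y T m j w|].
have mEX : measurable EX.
  apply: measurable_level_ge; apply: measurableT_comp => //.
  by apply: measurable_funB => //; exact: (measurable_euler cirX T0).
have mEY : measurable EY.
  apply: measurable_level_ge; apply: measurableT_comp => //.
  by apply: measurable_funB => //; exact: (measurable_euler cirY T0).
have EE : E `<=` EX `|` EY.
  move=> w; rewrite /E/= /cut_gap indicE; case: (boolP (w \in _)) => [/set_mem Aw|_]; last first.
    by rewrite mul0r => /(lt_le_trans e0); rewrite ltxx.
  rewrite mul1r (cut_diff_euler Nm gm Aw) /cir_diff => ew.
  have [XE|XE] := leP (e / 2) `|X (tgrid T m j) w - euler W k theta gamma x X T m j w|; first by left.
  right; rewrite /EY/=.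
  move: ew XE; move: (euler _ _ _ _ _ _ _ _ _ _) (euler _ _ _ _ _ _ _ _ _ _) (X _ w) (Y _ w) => b a c f ew XE.
  have := ler_normD (c - a) (b - f).
  have -> : c - a + (b - f) = - (a - b - (c - f)) by ring.
  by rewrite normrN (distrC f b); lra.
have PE : Pr P E <= 2 * pr.
  apply: (le_trans (le_Pr P mE (measurableU _ _ mEX mEY) EE)).
  apply: (le_trans (PrU P mEX mEY)).
  by have := h1 m m1m m0 j jm; have := h2 m m2m m0 j jm; rewrite -/EX -/EY; lra.
have iZ2 := intg_cut_diff_sqr m j.
have i1 := intgD (intgZ 2 iZ2) (intg_cst P (2 * N ^+ 2)).
have i2 := intgD (intg_cst P e) (intgZ eta i1).
have i3 := intgZ (4 * eta)^-1 (intg_indic P mE).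
apply: (@le_trans _ _ (Ex P (fun w => e + eta * (2 * cut_diff m j w ^+ 2 + 2 * N ^+ 2) +
    (4 * eta)^-1 * \1_E w))).
  apply: le_Ex; [exact: intg_cut_gap|exact: (intgD i2 i3)|move=> w].
  have g0 : 0 <= cut_gap m j w by rewrite mulr_ge0.
  have := cut_gap_sqr m j w; rewrite [\1_E w]indicE.
  case: (boolP (w \in E)) => [_|/negP nE].
    rewrite [true%:R]mulr1n; move: (cut_gap m j w) (2 * cut_diff m j w ^+ 2 + _) g0 => g z g0 gz.
    have := ler_wpM2l (ltW eta0) gz.
    have am : g <= eta * g ^+ 2 + (4 * eta)^-1 * 1.
      have -> : eta * g ^+ 2 + (4 * eta)^-1 * 1 = g + (eta * g - 2^-1) ^+ 2 / eta by field; rewrite gt_eqF.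
      by rewrite lerDl divr_ge0 ?sqr_ge0// ltW.
    by lra.
  have ge : cut_gap m j w < e.
    by rewrite ltNge; apply/negP => h; apply: nE; rewrite inE.
  move=> gz; rewrite mulr0 addr0; apply: (le_trans (ltW ge)).
  by rewrite lerDl mulr_ge0 ?(ltW eta0)// (le_trans _ gz)// sqr_ge0.
rewrite (ExD i2 i3) (ExD (intg_cst P e) (intgZ eta i1)) (ExZ eta i1).
rewrite (ExD (intgZ 2 iZ2) (intg_cst P _)) (ExZ 2 iZ2) (ExZ _ (intg_indic P mE)).
rewrite !Ex_cst Ex_indic//.
have b2 := Ex_cut_diff_sqr m0 jm; rewrite -/C2 in b2.
have b3 : eta * (2 * Ex P (fun w => cut_diff m j w ^+ 2) + 2 * N ^+ 2) <= eta * M.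
  by apply: ler_wpM2l; [exact: ltW|rewrite /M; lra].
have b4 : (4 * eta)^-1 * Pr P E <= (4 * eta)^-1 * (2 * pr).
  by apply: ler_wpM2l => //; rewrite invr_ge0 mulr_ge0// ltW.
have b5 : eta * M = delta / 3 by rewrite /eta; field; rewrite gt_eqF.
have b6 : (4 * eta)^-1 * (2 * pr) = delta / 3 by rewrite /pr; field; rewrite gt_eqF.
by rewrite /e; lra.
Qed.


(** Errors of order h^(3/2) over m steps of length T / m add up to order m^(-1/2). *)
Lemma step_err_sum (n Ma Mb : R) m : 0 < n -> 0 <= Ma -> 0 <= Mb -> (0 < m)%N ->
  m%:R * step_err n (T / m%:R) Ma Mb <=
  step_err n T Ma Mb / Num.sqrt m%:R.
Proof.
move=> n0 Ma0 Mb0 m0.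
have m0' : 0 < m%:R :> R by rewrite ltr0n.
have K0 : 0 <= (n * yam_a n)^-1 by rewrite invr_ge0 mulr_ge0 ?ltW// yam_a_gt0.
have L0 : 0 <= (n * yam_a n ^+ 2)^-1 by rewrite invr_ge0 mulr_ge0 ?sqr_ge0// ltW.
have c30 : 0 <= c3 := normal_abs_moment_ge0 3.
set r := Num.sqrt m%:R.
have r0 : 0 < r by rewrite sqrtr_gt0.
have r1 : 1 <= r by rewrite -sqrtr1 ler_wsqrtr// ler1n.
have mE : m%:R = r ^+ 2 :> R by rewrite sqr_sqrtr.
have sT : Num.sqrt (T / m%:R) = Num.sqrt T / r.
  by rewrite sqrtrM ?(ltW T0)// sqrtrV// ltW.
rewrite /step_err sT mE.
have st0 := sqrtr_ge0 T.
have q2 : 0 <= (Ma * T) ^+ 2 by exact: sqr_ge0.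
have q3 : 0 <= (Ma * T) ^+ 3 by rewrite exprn_ge0// mulr_ge0// ltW.
have q4 : 0 <= Mb ^+ 3 * (Num.sqrt T ^+ 3 * c3).
  by rewrite mulr_ge0 ?exprn_ge0// mulr_ge0// exprn_ge0.
have ri1 : r^-1 <= 1 by rewrite invf_le1.
have ri0 : 0 <= r^-1 by rewrite invr_ge0 ltW.
move: K0 L0; set K := (n * _)^-1; set L := (n * _)^-1 => K0 L0.
set a2 := (Ma * T) ^+ 2 in q2 *; set a3 := (Ma * T) ^+ 3 in q3 *.
set a4 := Mb ^+ 3 * _ in q4 *.
have -> : r ^+ 2 * (K / 2 * (Ma * (T / r ^+ 2)) ^+ 2 +
    4 * L * ((Ma * (T / r ^+ 2)) ^+ 3 + Mb ^+ 3 * ((Num.sqrt T / r) ^+ 3 * c3))) =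
  (K / 2 * (a2 * r^-1) + 4 * L * (a3 * r^-1 ^+ 3 + a4)) * r^-1.
  by rewrite /a2 /a3 /a4; field; rewrite gt_eqF.
rewrite ler_wpM2r// lerD//.
  by apply: ler_wpM2l; [rewrite divr_ge0|rewrite ler_piMr].
apply: ler_wpM2l; first by rewrite mulr_ge0.
by rewrite lerD2r ler_piMr// exprn_ile1.
Qed.

(** An event that does not depend on the mesh, so that the mesh can be refined while the left-hand
    side of the estimate stays fixed. *)
Definition cir_below_all : set Omega :=
  \bigcap_(m in [set m | (0 < m)%N]) cir_below m m.

Lemma measurable_cir_below_all : measurable cir_below_all.
Proof. by apply: bigcap_measurableType => m _; exact: measurable_cir_below. Qed.

Let Dp w : R := Num.max (X T w - Y T w) 0.

Lemma measurable_pos_diff : measurable_fun setT Dp.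
Proof.
by apply: measurable_maxr; [exact: measurable_funB|exact: measurable_cst].
Qed.

Let tgridm m : (0 < m)%N -> tgrid T m m = T.
Proof. by move=> m0; rewrite /tgrid mulrC divfK// pnatr_eq0 -lt0n. Qed.

Let pos_le m w : cir_below m m w -> (0 < m)%N -> 0 <= Dp w <= N.
Proof.
move=> Aw m0; have := cir_diff_le Aw; rewrite /cir_diff (tgridm m0) ler_norml => /andP[_ h].
by rewrite le_max lexx orbT/= ge_max h (ltW N0).
Qed.

(** The mesh is chosen inside the proof, depending on [n], [N] and [delta]; only the error of order
    1 / n, whose constant is free of [N], is left for later. *)
Lemma cut_comparison (n delta : R) : 0 < n -> 0 < delta ->
  2 * Ex P (fun w => \1_cir_below_all w * Dp w) <=
  2 * Num.max (x - y) 0 + ((x - y) ^+ 2 + 1 + T * (k + v * gamma ^+ 2 / 2)) / n + delta.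
Proof.
move=> n0 d0.
pose G := k * ((n * yam_a n)^-1 * N) + v * gamma ^+ 2 / 2 * ((n * yam_a n ^+ 2)^-1 * N).
pose S := step_err n T (k * N) (gamma * Num.sqrt N).
have K0 : 0 <= (n * yam_a n)^-1 by rewrite invr_ge0 mulr_ge0 ?ltW// yam_a_gt0.
have L0 : 0 <= (n * yam_a n ^+ 2)^-1 by rewrite invr_ge0 mulr_ge0 ?sqr_ge0// ltW.
have v0 : 0 <= v := normal_abs_moment_ge0 2.
have c30 : 0 <= c3 := normal_abs_moment_ge0 3.
have kN0 : 0 <= k * N by rewrite mulr_ge0 ?ltW.
have gN0 : 0 <= gamma * Num.sqrt N by rewrite mulr_ge0 ?sqrtr_ge0 ?ltW.
have G0 : 0 <= G.
  apply: addr_ge0; apply: mulr_ge0; rewrite ?(ltW k0) ?(mulr_ge0 K0 (ltW N0)) ?(mulr_ge0 L0 (ltW N0))//.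
  by rewrite divr_ge0// mulr_ge0// sqr_ge0.
have S0 : 0 <= S.
  apply: addr_ge0.
    by apply: mulr_ge0; [rewrite divr_ge0|exact: sqr_ge0].
  apply: mulr_ge0; first by rewrite mulr_ge0.
  apply: addr_ge0; first by rewrite exprn_ge0// mulr_ge0// ltW.
  by apply: mulr_ge0; [rewrite exprn_ge0|rewrite mulr_ge0// exprn_ge0// sqrtr_ge0].
(* The gap enters with weight T G through the summed steps and 2 through the final replacement of
   [cut_diff] by [cir_diff]; both together cost [delta / 2]. *)
pose d' := delta / (2 * (T * G + 2)).
have TG : 0 < T * G + 2 by rewrite ltr_wpDl// mulr_ge0// ltW.
have d'0 : 0 < d' by rewrite divr_gt0// mulr_gt0.
have [m1 gm] := cut_gap_cvg d'0.
pose m2 := (Num.trunc ((2 * S / delta) ^+ 2)).+1.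
pose m := maxn m1 m2.
have m0 : (0 < m)%N by rewrite leq_max orbT.
have m0' : m%:R != 0 :> R by rewrite pnatr_eq0 -lt0n.
have sm : S / Num.sqrt m%:R <= delta / 2.
  have r0 : 0 < Num.sqrt m%:R :> R by rewrite sqrtr_gt0 ltr0n.
  have q0 : 0 <= 2 * S / delta by rewrite divr_ge0 ?mulr_ge0// ltW.
  have : 2 * S / delta <= Num.sqrt m%:R.
    rewrite -[leLHS](ger0_norm q0) -sqrtr_sqr ler_wsqrtr//.
    apply: (le_trans (ltW (truncnS_gt _))); rewrite ler_nat; exact: leq_maxr.
  by rewrite !ler_pdivrMr//; lra.
have gaps i : (i < m)%N -> Ex P (cut_gap m i) <= d'.
  by move=> im; apply: gm => //; [exact: leq_maxl|exact: ltnW].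
have := cut_yam_sum n0 gaps; rewrite -/G -/S.
have := step_err_sum n0 kN0 gN0 m0; rewrite -/S.
rewrite [m%:R * (_ + _)]mulrDr mulrA (mulrC m%:R (T / _)) divfK//.
move=> se cy.
have iZ := intg_cut_diff m m; have iZ2 := intg_cut_diff_sqr m m.
have mZ := measurable_cut_diff m m.
have iy := intg_yam n0 mZ iZ2.
have ig := intg_cut_gap m m.
have iD : intg P (fun w => \1_cir_below_all w * Dp w).
  apply: (intg_bd P (M := N)).
    apply: measurable_funM; last exact: measurable_pos_diff.
    exact: measurable_indic measurable_cir_below_all.
  move=> w; rewrite indicE; case: (boolP (w \in _)) => [/set_mem Bw|_]; last by rewrite mul0r normr0 ltW.
  by rewrite mul1r; have /andP[p1 p2] := pos_le (Bw m m0) m0; rewrite ger0_norm.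
have [ni niE] : exists ni : R, ni = n^-1 by exists n^-1.
have yge z : `|z| - ni <= yam n z by rewrite niE; exact: yam_ge.
have ni0 : 0 <= ni by rewrite niE invr_ge0 ltW.
(* 2 D^+ = |D| + D is at most |Z| + Z plus twice the gap, and |Z| <= yam (Z) + 1 / n. Off the event
   the left side is 0 and the right side is nonnegative. *)
have key : Ex P (fun w => 2 * (\1_cir_below_all w * Dp w)) <=
    Ex P (fun w => (yam n (cut_diff m m w) + cut_diff m m w) + ni + 2 * cut_gap m m w).
  apply: le_Ex; [exact: intgZ|apply: intgD; [by apply: intgD; [exact: intgD|exact: intg_cst]|exact: intgZ]|].
  move=> w.
  have g0 : 0 <= cut_gap m m w by rewrite mulr_ge0.
  have y1 := yge (cut_diff m m w).
  have z0 : 0 <= `|cut_diff m m w| + cut_diff m m w.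
    by rewrite -[X in _ + X]opprK subr_ge0 -normrN ler_norm.
  rewrite indicE; case: (boolP (w \in _)) => [/set_mem Bw|_]; last first.
    by rewrite mul0r mulr0; lra.
  rewrite mul1r; move: g0; rewrite /cut_gap indicE mem_set; last exact: Bw.
  rewrite mul1r /cir_diff (tgridm m0) /Dp.
  move: y1 z0; move: (X T w - Y T w) (cut_diff m m w) (yam n _) => D z yz y1 z0 _.
  have := ler_norm z; have := ler_norm (D - z); rewrite (distrC D) => a1 a2.
  have := normr_ge0 (z - D).
  by case: (leP D 0) => D0; lra.
rewrite -(ExZ 2 iD); apply: (le_trans key).
rewrite (ExD (intgD (intgD iy iZ) (intg_cst P _)) (intgZ 2 ig)) (ExD (intgD iy iZ) (intg_cst P _)).
rewrite (ExD iy iZ) (ExZ 2 ig) Ex_cst.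
have gmm : Ex P (cut_gap m m) <= d' by apply: gm => //; exact: leq_maxl.
have yl : yam n (x - y) + (x - y) <= 2 * Num.max (x - y) 0 + (x - y) ^+ 2 / n.
  have := yam_le n0 (x - y); move: (x - y) (yam n _) => z yz.
  by case: (leP z 0) => z0; rewrite ?(ler0_norm z0) ?(gtr0_norm z0); lra.
have dE : T * (G * d') + 2 * d' = delta / 2 by rewrite /d'; field; rewrite gt_eqF.
rewrite -niE in cy yl *; move: cy se gmm dE yl sm.
clear gm; clearbody d' S G.
set b := k + v * gamma ^+ 2 / 2.
set x1 := Ex P (fun w => yam n _); set x2 := Ex P (cut_diff m m); set x3 := Ex P (cut_gap m m).
set x4 := _ / Num.sqrt _; set x5 := m%:R * _; set x6 := Num.max _ _; set x7 := (x - y) ^+ 2.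
set x8 := yam n _.
move: b x1 x2 x3 x4 x5 x6 x7 x8 (ni) => b x1 x2 x3 x4 x5 x6 x7 x8 n1 cy se gmm dE yl sm.
by lra.
Qed.

End truncated_comparison.

(** * Removal of the truncation and pathwise order *)

Section comparison.
Context {d : measure_display} {Omega : measurableType d} {R : realType}
  (P : probability Omega R).
Variable W : R -> {RV P >-> R}.
Hypothesis BM : brownian_motion W.

Variables (k theta gamma x y : R) (X Y : R -> {RV P >-> R}).
Hypotheses (k0 : 0 < k) (gamma0 : 0 < gamma).
Hypothesis cirX : cir_strong_solution k theta gamma W x X.
Hypothesis cirY : cir_strong_solution k theta gamma W y Y.

(** First n grows at a fixed level [N], then [N] grows by monotone convergence: each pair of paths
    is bounded on [0, T] and eventually lies below the level. *)
Lemma cir_comparison_pos (T : R) : 0 < T ->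
  (\int[P]_w (Num.max (X T w - Y T w) 0)%:E <= (Num.max (x - y) 0)%:E)%E.
Proof.
move=> T0.
pose B (N : nat) := cir_below_all X Y T N.+1%:R.
have N0 (N : nat) : 0 < N.+1%:R :> R by [].
have mB N : measurable (B N) by exact: (measurable_cir_below_all cirX cirY _ T0).
pose Dp w : R := Num.max (X T w - Y T w) 0.
have mD : measurable_fun setT Dp by exact: measurable_pos_diff.
have D0 w : 0 <= Dp w by rewrite le_max lexx orbT.
pose g (N : nat) w : R := \1_(B N) w * Dp w.
have g0 N w : 0 <= g N w by rewrite mulr_ge0.
have mg N : measurable_fun setT (g N).
  by apply: measurable_funM => //; exact: measurable_indic.
have Bmono N M : (N <= M)%N -> B N `<=` B M.
  move=> NM w Bw m m0 i im; have [Xl Yl] := Bw m m0 i im.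
  have NM' : N.+1%:R <= M.+1%:R :> R by rewrite ler_nat.
  by split; apply: le_trans NM'.
have gi N : intg P (g N).
  apply: (intg_bd P (M := N.+1%:R)) => // w; rewrite ger0_norm// /g indicE.
  case: (boolP (w \in _)) => [/set_mem Bw|_]; last by rewrite mul0r.
  rewrite mul1r /Dp; have [Xw Yw] := Bw 1%N isT 1%N (leqnn 1).
  have tT : tgrid T 1 1 = T by rewrite /tgrid mul1r divr1.
  rewrite tT in Xw Yw; rewrite ge_max (ltW (N0 N)) andbT.
  have := cir_ge0 cirY w (ltW T0); lra.
have Eg N : Ex P (g N) <= Num.max (x - y) 0.
  set c := (x - y) ^+ 2 + 1 + T * (k + normal_abs_moment 2 * gamma ^+ 2 / 2).
  have h (n delta : R) : 0 < n -> 0 < delta -> 2 * Ex P (g N) <= 2 * Num.max (x - y) 0 + c / n + delta.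
    by move=> n0 d0; exact: (cut_comparison BM k0 gamma0 cirX cirY T0 (N0 N) n0 d0).
  have c0 : 0 < c.
    rewrite ltr_wpDr ?ltr_wpDl ?sqr_ge0// mulr_ge0 ?(ltW T0)// addr_ge0 ?(ltW k0)//.
    by rewrite divr_ge0// mulr_ge0 ?sqr_ge0// normal_abs_moment_ge0.
  apply/ler_addgt0Pl => e e0.
  (* With n = c / e both errors equal [e], which the factor 2 on the left turns into a single
     [e]. *)
  have := h (c / e) e (divr_gt0 c0 e0) e0.
  have -> : c / (c / e) = e by field; rewrite !gt_eqF.
  by move: (Num.max _ _) (Ex _ _) => M E; lra.
have gcvg w : (fun N => (g N w)%:E) @ \oo --> (Dp w)%:E.
  have [C1 [C10 b1]] := path_bounded T (@cir_continuous _ _ _ _ _ _ _ _ _ _ cirX w).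
  have [C2 [C20 b2]] := path_bounded T (@cir_continuous _ _ _ _ _ _ _ _ _ _ cirY w).
  apply: cvg_near_cst.
  exists (Num.trunc (C1 + C2)) => // N /= hN; congr EFin; rewrite /g indicE mem_set ?mul1r//.
  have CN : C1 + C2 <= N.+1%:R.
    by apply: (le_trans (ltW (truncnS_gt _))); rewrite ler_nat ltnS.
  move=> m m0 i im; have t0 := tgrid_ge0 T0 m i; have tT := tgrid_leT T0 m0 im.
  split; apply: (le_trans (ler_norm _)).
    by apply: (le_trans (b1 _ t0 tT)); apply: le_trans CN; rewrite lerDl.
  by apply: (le_trans (b2 _ t0 tT)); apply: le_trans CN; rewrite lerDr.
have -> : (\int[P]_w (Dp w)%:E = \int[P]_w (limn (fun N => (g N w)%:E)))%E.
  by apply: eq_integral => w _; apply/esym/cvg_lim.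
rewrite monotone_convergence//.
- apply: lime_le.
    apply: ereal_nondecreasing_is_cvgn => N M NM; apply: ge0_le_integral => //; try exact/measurable_EFinP.
      by move=> w _; rewrite lee_fin.
    move=> w _; rewrite lee_fin ler_wpM2r// !indicE.
    case: (boolP (w \in B N)) => [/set_mem /(Bmono _ _ NM)/mem_set ->//|_].
    by rewrite ler0n.
  by apply: nearW => N; rewrite -EFin_Ex// lee_fin.
- by move=> N; exact/measurable_EFinP.
- by move=> N w _; rewrite lee_fin.
move=> w _ N M NM; rewrite lee_fin ler_wpM2r// !indicE.
case: (boolP (w \in B N)) => [/set_mem /(Bmono _ _ NM)/mem_set ->//|_].
by rewrite ler0n.
Qed.

(* Yamada-Watanabe: the drift is decreasing and the volatility is 1/2-Hoelder,
   so the local time term of the difference vanishes. *)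
Lemma cir_comparison (T : R) : 0 <= T ->
  (\int[P]_w (Num.max (X T w - Y T w) 0)%:E <= (Num.max (x - y) 0)%:E)%E.
Proof.
rewrite le_eqVlt => /orP[/eqP <-|]; last exact: cir_comparison_pos.
have [_ _ _ x0 _] := cirX; have [_ _ _ y0 _] := cirY.
rewrite (@ae_eq_integral _ _ _ P setT (cst (Num.max (x - y) 0)%:E))//.
- by rewrite integral_cst//= probability_setT mule1.
- by apply/measurable_EFinP; exact: measurable_pos_diff.
- by apply: filterS2 x0 y0 => w -> -> _.
Qed.

(** For x <= y the comparison bound is 0, and a nonnegative function with zero integral vanishes
    almost surely. *)
Lemma cir_monotone_at (T : R) : x <= y -> 0 <= T -> {ae P, forall w, X T w <= Y T w}.
Proof.
move=> xy T0; have := cir_comparison T0.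
rewrite max_r ?subr_le0// => h.
have D0 w : (0 <= (Num.max (X T w - Y T w) 0)%:E)%E by rewrite lee_fin le_max lexx orbT.
have mD : measurable_fun setT (fun w => (Num.max (X T w - Y T w) 0)%:E).
  by apply/measurable_EFinP; exact: measurable_pos_diff.
have : (\int[P]_w `|(Num.max (X T w - Y T w) 0)%:E| = 0)%E.
  under eq_integral do rewrite gee0_abs//.
  by apply/eqP; rewrite eq_le h integral_ge0.
move=> /(ae_eq_integral_abs P measurableT mD) H.
apply: filterS H => w /(_ I) [] /eqP; rewrite eq_le ge_max => /andP[/andP[]].
by rewrite subr_le0.
Qed.

End comparison.

(** * Discounting and monotonicity of the boundary *)

Section integral_minorants.
Context {d : measure_display} {Omega : measurableType d} {R : realType}
  (P : probability Omega R).
Import HBNNSimple.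
Implicit Types f g : Omega -> R.

Lemma integral_nnsfun_sup f : (forall w, 0 <= f w) ->
  (\int[P]_w (f w)%:E =
   ereal_sup [set \int[P]_w (h w)%:E | h in
     [set h : {nnsfun Omega >-> R} | forall w, (h w <= f w)%R]])%E.
Proof.
move=> f0; rewrite ge0_integralTE; last by move=> w; rewrite lee_fin.
congr ereal_sup; apply/seteqP; split => [_ [h /= hf <-]|_ [h /= hf <-]]; exists h => //.
- by rewrite integral_nnsfun// patch_setT.
- by rewrite integral_nnsfun// patch_setT.
Qed.

(* No measurability of f and g is needed: the integral of a nonnegative function
   is the supremum of the integrals of the simple functions below it. *)
Lemma ge0_ae_le_integral f g : (forall w, 0 <= f w) -> (forall w, 0 <= g w) ->
  {ae P, forall w, f w <= g w} ->
  (\int[P]_w (f w)%:E <= \int[P]_w (g w)%:E)%E.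
Proof.
move=> f0 g0 [N [mN N0 hN]]; rewrite !integral_nnsfun_sup//.
apply: ge_ereal_sup => _ [h /= hf <-].
have mNC : measurable (~` N) by exact: measurableC.
(* The simple minorant is set to 0 on the exceptional null set: its integral is unchanged and it now
   lies below [g] everywhere. *)
pose h' := proj_nnsfun h mNC.
have h'E w : h' w = h w * \1_(~` N) w by rewrite /h'/= mindicE indicE.
have -> : (\int[P]_w (h w)%:E = \int[P]_w (h' w)%:E)%E.
  apply: ae_eq_integral => //; try exact/measurable_EFinP.
  exists N; split => // w /= hw; apply: contrapT => Nw; apply: hw => _.
  by congr EFin; rewrite /= mindicE mem_set// mulr1.
apply: ereal_sup_ubound; exists h' => //= w; rewrite -[leLHS]/(h' w) h'E indicE.
case: (boolP (w \in ~` N)) => [/set_mem Nw|_]; last by rewrite mulr0.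
rewrite mulr1; apply: (le_trans (hf w)).
by apply: contrapT => fg; apply: Nw; apply: hN => /= /fg.
Qed.

End integral_minorants.

Section rational_times.
Context {R : realType}.

Lemma le_of_rat (g h : R -> R) :
  {within `[0, +oo[, continuous g} -> {within `[0, +oo[, continuous h} ->
  (forall q : rat, 0 <= ratr q :> R -> g (ratr q) <= h (ratr q)) ->
  forall s : R, 0 <= s -> g s <= h s.
Proof.
move=> cg ch gh s s0; rewrite leNgt; apply/negP => hg.
have cgh : {for s, continuous (fun u : R => g (Num.max u 0) - h (Num.max u 0))}.
  by apply: cvgB; exact: continuous_clamp.
have e0 : 0 < g s - h s by rewrite subr_gt0.
move/cvgrPdist_lt: cgh => /(_ _ e0) [e /= e1 he].
have [q] : exists q, ratr q \in `]s, (s + e)[ by apply: rat_in_itvoo; rewrite ltrDl.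
rewrite in_itv/= => /andP[sq qe].
have q0 : 0 <= ratr q :> R by exact: le_trans s0 (ltW sq).
have /he : ball_ Num.norm s e (ratr q) by rewrite /= distrC ltr_norml; apply/andP; split; lra.
rewrite /= !max_l// ltr_norml => /andP[_].
by have := gh q q0; lra.
Qed.

(** Codes that decode to nothing are sent to 0; the sequence is total and still reaches every
    rational. *)
Definition rat_enum (n : nat) : rat := odflt 0 (unpickle n).

Lemma rat_enum_surj q : exists n, rat_enum n = q.
Proof. by exists (pickle q); rewrite /rat_enum pickleK. Qed.

End rational_times.

(** * Measurability of the running supremum *)

Section running_supremum.
Context {d : measure_display} {Omega : measurableType d} {R : realType}.
Variable Y : R -> Omega -> R.
Hypothesis cY : forall w, {within `[0, +oo[, continuous (Y^~ w)}.

Lemma has_sup_path (t : R) w : 0 <= t -> has_sup [set Y u w | u in `[0, t]].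
Proof.
move=> t0; split; first by exists (Y 0 w), 0 => //=; rewrite in_itv/= lexx.
have [C [_ hC]] := path_bounded t (@cY w).
exists C => _ [u + <-]; rewrite /= in_itv/= => /andP[u0 ut].
exact: le_trans (ler_norm _) (hC _ u0 ut).
Qed.

Lemma measurable_path_sup (t : R) : 0 <= t -> (forall s : R, 0 <= s -> measurable_fun setT (Y s)) ->
  measurable_fun setT (fun w => sup [set Y u w | u in `[0, t]]).
Proof.
move=> t0 mY.
(* The rationals clamped to [0, t] are dense there, so by continuity the supremum over the interval
   is that of a sequence. *)
pose c (u : R) := Num.min (Num.max u 0) t.
have c0 u : 0 <= c u by rewrite le_min t0 le_max lexx orbT.
have ct u : c u <= t by rewrite ge_min lexx orbT.
pose h n w := Y (c (ratr (rat_enum n))) w.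
have -> : (fun w => sup [set Y u w | u in `[0, t]]) = (fun w => sups (h ^~ w) 0%N).
  apply/funext => w; have [ne ub] := has_sup_path w t0.
  apply/eqP; rewrite eq_le; apply/andP; split.
    apply: ge_sup => // _ [u + <-]; rewrite /= in_itv/= => /andP[u0 ut].
    have cc : {within `[0, +oo[, continuous (fun u => Y (c u) w)}.
      apply: continuous_subspaceT => v.
      have -> : (fun u => Y (c u) w) = (fun u => Y (Num.max (c u) 0) w).
        by apply/funext => z; rewrite (max_l (c0 z)).
      have cv : c u @[u --> v] --> c v.
        apply: (@continuous_min _ _ (fun u : R => Num.max u 0) (cst t)); last exact: cvg_cst.
        by apply: (@continuous_max _ _ id (cst 0)); [exact: cvg_id|exact: cvg_cst].
      exact: (cvg_comp _ _ cv (@continuous_clamp _ _ (@cY w) (c v))).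
    have := @le_of_rat _ (fun u => Y (c u) w) (cst (sups (h ^~ w) 0%N)) cc.
    have -> : Y u w = Y (c u) w by rewrite /c max_l// min_l.
    apply => //; first by apply: continuous_subspaceT => v; exact: cvg_cst.
    move=> q _; have [n <-] := rat_enum_surj q.
    apply: ub_le_sup; last by exists n.
    exists (sup [set Y u w | u in `[0, t]]) => _ [m _ <-].
    by apply: ub_le_sup => //; exists (c (ratr (rat_enum m))) => //=; rewrite in_itv/= c0 ct.
  apply: ge_sup; first by exists (h 0%N w), 0%N.
  move=> _ [n _ <-]; apply: ub_le_sup => //.
  by exists (c (ratr (rat_enum n))) => //=; rewrite in_itv/= c0 ct.
apply: measurable_fun_sups => [w _|n]; last exact: mY.
have [_ [M hM]] := has_sup_path w t0.
exists M => _ [n _ <-]; apply: hM.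
by exists (c (ratr (rat_enum n))) => //=; rewrite in_itv/= c0 ct.
Qed.

End running_supremum.

(** * The accumulated discount *)

Section discounting.
Context {d : measure_display} {Omega : measurableType d} {R : realType}.
Local Notation leb := (@lebesgue_measure R).
Variable rho : R -> R.
Hypotheses (crho : {within `[0, +oo[, continuous rho})
  (rho0 : forall r : R, 0 <= r -> 0 <= rho r)
  (rhomono : forall r1 r2 : R, 0 <= r1 -> r1 <= r2 -> rho r1 <= rho r2).

Definition discount (X : R -> Omega -> R) (t : R) (w : Omega) : R :=
  \int[leb]_(s in `[0, t]) rho (X s w).

Variable X : R -> Omega -> R.
Hypotheses (X0 : forall (s : R) w, 0 <= s -> 0 <= X s w)
  (cX : forall w, {within `[0, +oo[, continuous (X^~ w)}).

Lemma discount_rate_continuous w : {within `[0, +oo[, continuous (fun s => rho (X s w))}.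
Proof.
apply: (@subspace_eq_continuous _ _ _ (fun s => rho (Num.max (X s w) 0))).
  by move=> s; rewrite inE/= in_itv/= andbT => s0; rewrite max_l ?X0.
by move=> s; exact: (cvg_comp _ _ (@cX w s) (@continuous_clamp _ _ crho (X s w))).
Qed.

Lemma discount_rate_integrable (t : R) w :
  leb.-integrable `[0, t] (EFin \o (fun s => rho (X s w))).
Proof. exact: (path_integrable t (@discount_rate_continuous w)). Qed.

Lemma discount_add (s t : R) w (M : R) : 0 <= s -> s <= t ->
  (forall u : R, s <= u -> u <= t -> rho (X u w) <= M) ->
  discount X s w <= discount X t w <= discount X s w + M * (t - s).
Proof.
move=> s0 st uM; have t0 := le_trans s0 st.
have sst : `]s, t] `<=` (`[0, t] : set R).
  by move=> u; rewrite /= !in_itv/= => /andP[su ->]; rewrite andbT (le_trans s0)// ltW.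
have it := discount_rate_integrable t w.
have split_int : discount X t w = discount X s w + \int[leb]_(u in `]s, t]) rho (X u w).
  by rewrite /discount -(Rintegral_itvB it) ?bnd_simp// addrC subrK.
have ist : leb.-integrable `]s, t] (EFin \o (fun u => rho (X u w))) by exact: integrableS it.
rewrite split_int lerDl lerD2l; apply/andP; split.
  apply: Rintegral_ge0 => // u; rewrite /= in_itv/= => /andP[su _].
  by rewrite rho0// X0// (le_trans s0)// ltW.
apply: (@le_trans _ _ (\int[leb]_(u in `]s, t]) M)).
  apply: le_Rintegral => //.
    apply: measurable_bounded_integrable => //.
      by rewrite /= lebesgue_measure_itv/=; case: ifP => _; [rewrite -EFinD ltry|exact: ltry].
    by exists `|M|; split; [exact: num_real|move=> x Mx u _ /=; exact: ltW].
  by move=> u; rewrite /= in_itv/= => /andP[su ut]; apply: uM => //; exact: ltW.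
rewrite Rintegral_cst//= lebesgue_measure_itv/= lte_fin.
by case: ltP => //= ts; rewrite mulr0 (_ : t = s) ?subrr ?mulr0//; apply/eqP; rewrite eq_le ts st.
Qed.

Lemma discount0 w : discount X 0 w = 0.
Proof.
by rewrite /discount set_itv1 /Rintegral (@integral_Sset1 _ _ _ 0).
Qed.

Lemma measurable_wrt_discount (G : set (set Omega)) (t : R) : 0 <= t ->
  (forall s : R, 0 <= s -> s <= t -> measurable_wrt <<s G>> (X s)) ->
  measurable_wrt <<s G>> (discount X t).
Proof.
move=> t0 mX; apply/measurable_wrtP.
(* The process is frozen at time [t]: it is then measurable for [<<s G>>] at all times, as joint
   measurability requires, and agrees with [X] on [0, t]. *)
pose X' (s : R) (w : g_sigma_algebraType G) : R := X (Num.min s t) w.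
have mX' : forall s : R, 0 <= s -> measurable_fun setT (X' s).
  move=> s s0; apply/measurable_wrtP; apply: mX; first by rewrite le_min s0.
  by rewrite ge_min lexx orbT.
have cX' w : {within `[0, +oo[, continuous (X'^~ w)}.
  apply: (@subspace_eq_continuous _ _ _ (fun s => X (Num.max (Num.min s t) 0) w)).
    move=> s; rewrite inE/= in_itv/= andbT => s0.
    by rewrite /X' (max_l (_ : 0 <= Num.min s t))// le_min s0.
  apply: continuous_subspaceT => v.
  have cv : Num.min u t @[u --> v] --> Num.min v t.
    by apply: (@continuous_min _ _ id (cst t)); [exact: cvg_id|exact: cvg_cst].
  exact: (cvg_comp _ _ cv (@continuous_clamp _ _ (@cX w) (Num.min v t))).
have mj := measurable_process mX' cX'.
have mr : measurable_fun setT (fun x : R => rho (Num.max x 0)).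
  by apply: continuous_measurable_fun; exact: continuous_clamp crho.
have mf : measurable_fun setT (fun z : R * g_sigma_algebraType G =>
    rho (Num.max (X' (Num.max z.1 0) z.2) 0)).
  exact: (measurableT_comp mr mj).
have := @measurable_path_integral _ _ _ _ `[0, t] _ mf.
move=> /(_ _ _)/eq_measurable_fun; apply => //; last first.
  by move=> z; rewrite rho0// le_max lexx orbT.
move=> w _; apply: eq_Rintegral => s; rewrite inE/= in_itv/= => /andP[s0 st].
by rewrite /X' (max_l s0) (min_l st) max_l// X0.
Qed.

End discounting.

Section discount_order.
Context {d : measure_display} {Omega : measurableType d} {R : realType}.
Variable rho : R -> R.
Hypotheses (crho : {within `[0, +oo[, continuous rho})
  (rhomono : forall r1 r2 : R, 0 <= r1 -> r1 <= r2 -> rho r1 <= rho r2).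
Variables X Y : R -> Omega -> R.
Hypotheses (X0 : forall (s : R) w, 0 <= s -> 0 <= X s w)
  (cX : forall w, {within `[0, +oo[, continuous (X^~ w)})
  (Y0 : forall (s : R) w, 0 <= s -> 0 <= Y s w)
  (cY : forall w, {within `[0, +oo[, continuous (Y^~ w)}).

Lemma le_discount (t : R) w : (forall s : R, 0 <= s -> X s w <= Y s w) ->
  discount rho X t w <= discount rho Y t w.
Proof.
move=> XY; apply: le_Rintegral => //; [exact: (discount_rate_integrable crho X0 cX)|exact: (discount_rate_integrable crho Y0 cY)|].
by move=> s; rewrite /= in_itv/= => /andP[s0 _]; apply: rhomono; [exact: X0|exact: XY].
Qed.

End discount_order.

Section cir_order.
Context {d : measure_display} {Omega : measurableType d} {R : realType}
  (P : probability Omega R).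
Variable W : R -> {RV P >-> R}.
Hypothesis BM : brownian_motion W.

(** One null set serves all times: the order holds outside it at the countably many rational times,
    and continuity extends it. *)
Lemma cir_monotone (k theta gamma x y : R) (X Y : R -> {RV P >-> R}) :
  0 < k -> 0 < gamma ->
  cir_strong_solution k theta gamma W x X -> cir_strong_solution k theta gamma W y Y ->
  x <= y -> {ae P, forall w, forall s : R, 0 <= s -> X s w <= Y s w}.
Proof.
move=> k0 g0 cirX cirY xy.
have H : {ae P, forall w, forall n, 0 <= ratr (rat_enum n) :> R ->
    X (ratr (rat_enum n)) w <= Y (ratr (rat_enum n)) w}.
  apply/ae_foralln => n.
  have [q0|q0] := leP 0 (ratr (rat_enum n) : R).
    by have := cir_monotone_at BM k0 g0 cirX cirY xy q0; apply: filterS.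
  by apply: aeW.
apply: filterS H => w hw s s0.
apply: (@le_of_rat _ (fun s => X s w) (fun s => Y s w)) => //.
- exact: (@cir_continuous _ _ _ _ _ _ _ _ _ _ cirX w).
- exact: (@cir_continuous _ _ _ _ _ _ _ _ _ _ cirY w).
- by move=> q q0; have [n nq] := rat_enum_surj q; move: (hw n); rewrite nq; apply.
Qed.

End cir_order.

(** * Monotonicity of the value and of the boundary *)

Section value_function.
Context {d : measure_display} {Omega : measurableType d} {R : realType}
  (P : probability Omega R).
Variables (alpha mu sigma k theta gamma : R) (rho : R -> R)
  (B W : R -> {RV P >-> R}) (Rate : R -> R -> {RV P >-> R}).
Hypotheses (k0 : 0 < k) (gamma0 : 0 < gamma).
Hypotheses (BM : brownian_motion W)
  (cir : forall r : R, 0 <= r -> cir_strong_solution k theta gamma W r (Rate r))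
  (drho : discount_rate rho).
Local Notation pay := (payoff alpha mu sigma rho B Rate).
Local Notation val := (value alpha mu sigma rho B W Rate).
Local Notation bd := (boundary alpha mu sigma rho B W Rate).

Lemma payoff_ge0 (r z : R) tau w : 0 <= pay r z tau w.
Proof. by rewrite /payoff; case: (tau w) => // t; exact: expR_ge0. Qed.

Lemma le_payoff (r1 r2 z : R) tau : 0 <= r1 -> r1 <= r2 ->
  {ae P, forall w, pay r2 z tau w <= pay r1 z tau w}.
Proof.
move=> r10 r12; have r20 := le_trans r10 r12; have [crho _ rhomono _ _] := drho.
have := cir_monotone BM k0 gamma0 (cir r10) (cir r20) r12.
apply: filterS => w h; rewrite /payoff; case: (tau w) => // t.
rewrite ler_expR lerD2l lerN2.
have cX r w' : 0 <= r -> {within `[0, +oo[, continuous (fun s => Rate r s w')}.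
  by move=> rr; exact: (@cir_continuous _ _ _ _ _ _ _ _ _ _ (cir rr) w').
have X0 r (s : R) w' : 0 <= r -> 0 <= s -> 0 <= Rate r s w'.
  by move=> rr; exact: (cir_ge0 (cir rr)).
by apply: (@le_discount _ _ _ rho crho rhomono (fun s => Rate r1 s) (fun s => Rate r2 s)) => // *;
  [exact: X0|exact: cX|exact: X0|exact: cX].
Qed.

(** The admissible stopping times depend on [z] but not on the starting rate, so each one can be
    kept while the rate changes. *)
Lemma value_nonincreasing (r1 r2 z : R) : 0 <= r1 -> r1 <= r2 -> (val r2 z <= val r1 z)%E.
Proof.
move=> r10 r12; apply: ge_ereal_sup => _ [tau tau_st <-].
apply: (@le_trans _ _ 'E_P[pay r1 z tau]%E); last by apply: ereal_sup_ubound; exists tau.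
rewrite unlock; apply: ge0_ae_le_integral; [exact: payoff_ge0|exact: payoff_ge0|].
exact: le_payoff.
Qed.

Lemma boundary_nonincreasing (r1 r2 : R) : 0 <= r1 -> r1 <= r2 -> (bd r2 <= bd r1)%E.
Proof.
move=> r10 r12; apply: ereal_sup_le => _ [->|[z [az v1] <-]]; first by left.
have v2 := value_nonincreasing z r10 r12.
right; exists z; last by [].
split; first exact: az.
exact: (lt_le_trans v1 v2).
Qed.

End value_function.

(** * Right-continuity of the boundary *)

Section discount_gap.
Context {d : measure_display} {Omega : measurableType d} {R : realType}.
Local Notation leb := (@lebesgue_measure R).
Variables X Y : R -> Omega -> R.
Hypotheses (X0 : forall (s : R) w, 0 <= s -> 0 <= X s w)
  (cX : forall w, {within `[0, +oo[, continuous (X^~ w)})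
  (Y0 : forall (s : R) w, 0 <= s -> 0 <= Y s w)
  (cY : forall w, {within `[0, +oo[, continuous (Y^~ w)}).

Definition path_gap (T : R) (w : Omega) : R :=
  \int[leb]_(s in `[0, T]) Num.max (Y s w - X s w) 0.

Lemma path_gap_continuous w :
  {within `[0, +oo[, continuous (fun s => Num.max (Y s w - X s w) 0)}.
Proof.
have mc : continuous (fun x : R => Num.max x 0).
  by move=> x; apply: (@continuous_max _ _ id (cst 0)); [exact: cvg_id|exact: cvg_cst].
have dc : {within `[0, +oo[, continuous (fun s => Y s w - X s w)}.
  by move=> s; apply: cvgB; [exact: (@cY w s)|exact: (@cX w s)].
by move=> s; exact: (cvg_comp _ _ (dc s) (mc (Y s w - X s w))).
Qed.

Lemma path_gap_integrable (T : R) w :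
  leb.-integrable `[0, T] (EFin \o (fun s => Num.max (Y s w - X s w) 0)).
Proof. exact: (path_integrable T (@path_gap_continuous w)). Qed.

Lemma path_gap_ge0 (T : R) w : 0 <= path_gap T w.
Proof. by apply: Rintegral_ge0 => // s _; rewrite le_max lexx orbT. Qed.

Variable rho : R -> R.
Hypothesis drho : discount_rate rho.

Let crho : {within `[0, +oo[, continuous rho}. Proof. by case: drho. Qed.

(** For ordered paths the gap between the two discounts can only grow with the horizon; a random
    horizon bounded by T may thus be replaced by T. *)
Lemma le_discount_incr (t T : R) w : 0 <= t -> t <= T ->
  (forall s : R, 0 <= s -> X s w <= Y s w) ->
  discount rho Y t w - discount rho X t w <= discount rho Y T w - discount rho X T w.
Proof.
move=> t0 tT XY; have [_ _ rhomono _ _] := drho.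
have iX := discount_rate_integrable crho X0 cX T w.
have iY := discount_rate_integrable crho Y0 cY T w.
have eX : discount rho X T w - discount rho X t w = \int[leb]_(u in `]t, T]) rho (X u w).
  by rewrite /discount (Rintegral_itvB iX) ?bnd_simp.
have eY : discount rho Y T w - discount rho Y t w = \int[leb]_(u in `]t, T]) rho (Y u w).
  by rewrite /discount (Rintegral_itvB iY) ?bnd_simp.
have sst : `]t, T] `<=` (`[0, T] : set R).
  by move=> u; rewrite /= !in_itv/= => /andP[su ->]; rewrite andbT (le_trans t0)// ltW.
have jX : leb.-integrable `]t, T] (EFin \o (fun u => rho (X u w))) by exact: integrableS iX.
have jY : leb.-integrable `]t, T] (EFin \o (fun u => rho (Y u w))) by exact: integrableS iY.
have : \int[leb]_(u in `]t, T]) rho (X u w) <= \int[leb]_(u in `]t, T]) rho (Y u w).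
  apply: le_Rintegral => // u; rewrite /= in_itv/= => /andP[tu _].
  have u0 : 0 <= u by rewrite (le_trans t0)// ltW.
  by apply: rhomono; [exact: X0|exact: XY].
by rewrite -eX -eY; lra.
Qed.

End discount_gap.

Section discount_gap_bound.
Context {d : measure_display} {Omega : measurableType d} {R : realType}.
Local Notation leb := (@lebesgue_measure R).
Variable rho : R -> R.
Hypothesis drho : discount_rate rho.

(* sqrt a - sqrt b <= sqrt (a - b) <= e + (a - b) / e turns the last clause of
   discount_rate into a bound by the L^1 distance of the paths. *)
Lemma discount_rate_le (C : R) : exists M : R, 0 <= M /\ forall a b e : R, 0 <= b -> b <= a ->
  a <= C -> 0 < e -> rho a - rho b <= M * (e + (a - b) / e).
Proof.
have [_ _ _ _ [c3 [q [c30 hc]]]] := drho.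
exists (c3 * (1 + `|C| ^+ q)); split; first by rewrite mulr_ge0 ?addr_ge0 ?exprn_ge0// ltW.
move=> a b e b0; rewrite le_eqVlt => /orP[/eqP <-|ba] aC e0.
  rewrite !subrr mul0r addr0; apply: mulr_ge0; last exact: ltW.
  by apply: mulr_ge0; [exact: ltW|rewrite addr_ge0// exprn_ge0].
have a0 : 0 <= a := le_trans b0 (ltW ba).
apply: (le_trans (hc a b b0 ba)).
have sab : 0 <= Num.sqrt a - Num.sqrt b by rewrite subr_ge0 ler_wsqrtr// ltW.
apply: ler_pM => //; first by rewrite mulr_ge0 ?(ltW c30)// addr_ge0// exprn_ge0.
  rewrite ler_pM2l// lerD2l lerXn2r ?nnegrE//.
  by rewrite (le_trans aC) ?ler_norm.
have h : (Num.sqrt a - Num.sqrt b) ^+ 2 <= a - b.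
  by apply: (le_trans (sqrt_diff_sqr a0 b0)); rewrite ger0_norm// subr_ge0 ltW.
have : (Num.sqrt a - Num.sqrt b) * e <= e * e + (a - b).
  move: h; move: (_ - _) sab (a - b) => s s0 u h; nra.
rewrite -[e + _](mulfK (lt0r_neq0 e0)) ler_pdivlMr//; congr (_ <= _).
by field; rewrite gt_eqF.
Qed.

Variables X Y : R -> Omega -> R.
Hypotheses (X0 : forall (s : R) w, 0 <= s -> 0 <= X s w)
  (cX : forall w, {within `[0, +oo[, continuous (X^~ w)})
  (Y0 : forall (s : R) w, 0 <= s -> 0 <= Y s w)
  (cY : forall w, {within `[0, +oo[, continuous (Y^~ w)}).

Lemma discount_gap_bound (M C T e : R) w : 0 <= T -> 0 < e ->
  (forall a b e : R, 0 <= b -> b <= a -> a <= C -> 0 < e ->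
    rho a - rho b <= M * (e + (a - b) / e)) ->
  (forall s : R, 0 <= s -> s <= T -> X s w <= Y s w /\ Y s w <= C) ->
  discount rho Y T w - discount rho X T w <= M * (e * T + path_gap X Y T w / e).
Proof.
move=> T0 e0 hM XY; have [crho _ _ _ _] := drho.
have iX := discount_rate_integrable crho X0 cX T w.
have iY := discount_rate_integrable crho Y0 cY T w.
have ig := path_gap_integrable cX cY T w.
have ic : leb.-integrable `[0, T] (EFin \o cst (M * e)).
  by apply: (path_integrable T (f := cst (M * e))); apply: continuous_subspaceT => v; exact: cvg_cst.
have igZ := itv_integrableZ (M / e) ig.
rewrite /discount -RintegralB//.
apply: (@le_trans _ _ (\int[leb]_(s in `[0, T]) (M * e + M / e * Num.max (Y s w - X s w) 0))).
  apply: le_Rintegral => //; [exact: (integrableB _ iY iX)|exact: (itv_integrableD ic igZ)|].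
  move=> s; rewrite /= in_itv/= => /andP[s0 sT]; have [XY1 XY2] := XY s s0 sT.
  apply: (le_trans (hM _ _ e (X0 w s0) XY1 XY2 e0)).
  by rewrite max_l ?subr_ge0// mulrDr mulrA (mulrAC M).
rewrite (RintegralD _ ic igZ)// (RintegralZl _ _ ig)//.
rewrite [X in X + _](_ : _ = M * e * T); last exact: Rintegral_itv_cst.
rewrite -/(path_gap X Y T w).
rewrite le_eqVlt; apply/orP; left; apply/eqP.
by field; rewrite gt_eqF.
Qed.

End discount_gap_bound.

(** * Convergence of the discount from the right *)

Section expected_gap.
Context {d : measure_display} {Omega : measurableType d} {R : realType}
  (P : probability Omega R).
Local Notation leb := (@lebesgue_measure R).
Variables X Y : R -> Omega -> R.
Hypotheses (mX : forall s : R, 0 <= s -> measurable_fun setT (X s))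
  (mY : forall s : R, 0 <= s -> measurable_fun setT (Y s))
  (cX : forall w, {within `[0, +oo[, continuous (X^~ w)})
  (cY : forall w, {within `[0, +oo[, continuous (Y^~ w)}).

Let f (z : R * Omega) : R :=
  Num.max (Y (Num.max z.1 0) z.2 - X (Num.max z.1 0) z.2) 0.

Let mf : measurable_fun setT f.
Proof.
apply: measurable_maxr; last exact: measurable_cst.
by apply: measurable_funB; exact: measurable_process.
Qed.

Let f0 z : 0 <= f z. Proof. by rewrite le_max lexx orbT. Qed.

Let path_gapE (T : R) w : path_gap X Y T w = \int[leb]_(s in `[0, T]) f (s, w).
Proof.
by apply: eq_Rintegral => s; rewrite inE/= in_itv/= => /andP[s0 _]; rewrite /f/= (max_l s0).
Qed.

Lemma measurable_path_gap (T : R) : measurable_fun setT (path_gap X Y T).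
Proof.
have := @measurable_path_integral _ _ _ f `[0, T] (measurable_itv _) mf f0.
by apply: eq_measurable_fun => w _; rewrite path_gapE.
Qed.

(** Tonelli: the expectation is taken at each fixed time, where the hypothesis applies, before
    integrating over [0, T]. *)
Lemma integral_path_gap_le (T c : R) : 0 <= T -> 0 <= c ->
  (forall s : R, 0 <= s -> (\int[P]_w (Num.max (Y s w - X s w) 0)%:E <= c%:E)%E) ->
  (\int[P]_w (path_gap X Y T w)%:E <= (c * T)%:E)%E.
Proof.
move=> T0 c0 hc.
pose g (z : measurableTypeR R * Omega) : \bar R := (f z * \1_(`[0, T] : set (measurableTypeR R)) z.1)%:E.
have mT : measurable (`[0, T]%classic : set (measurableTypeR R)) by exact: measurable_itv.
have mg : measurable_fun setT g.
  apply/measurable_EFinP; apply: measurable_funM => //.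
  apply: (measurableT_comp (f := \1_(`[0, T]%classic) : measurableTypeR R -> R)).
    exact: measurable_indic.
  exact: measurable_fst.
have g0 z : (0 <= g z)%E by rewrite lee_fin mulr_ge0.
have E1 w : (path_gap X Y T w)%:E = (\int[leb]_s g (s, w))%E.
  rewrite /path_gap /Rintegral fineK; last exact: (integrable_fin_num _ (path_gap_integrable cX cY T w)).
  rewrite integral_mkcond; apply: eq_integral => s _; rewrite patchE /g/= indicE.
  case: ifPn => [|_]; last by rewrite mulr0.
  by rewrite inE/= in_itv/= => /andP[s0 _]; rewrite mulr1 /f/= (max_l s0).
under eq_integral do rewrite E1.
rewrite -(@fubini_tonelli _ _ _ _ _ leb P g mg g0).
apply: (@le_trans _ _ (\int[leb]_s (c%:E * (\1_(`[0, T] : set (measurableTypeR R)) s)%:E))%E).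
  apply: ge0_le_integral => //.
  - by move=> s _; exact: integral_ge0.
  - exact: (measurable_fun_fubini_tonelli_F g).
  - by apply: measurable_funeM; apply/measurable_EFinP; exact: measurable_indic.
  move=> s _; rewrite /g/= indicE; case: (boolP (s \in _)) => [|_]; last first.
    under eq_integral do rewrite mulr0.
    by rewrite integral0 mule0.
  rewrite inE/= in_itv/= => /andP[s0 sT]; rewrite mule1.
  under eq_integral do rewrite mulr1 /f/= (max_l s0).
  exact: hc.
rewrite ge0_integralZl//; last by apply/measurable_EFinP; exact: measurable_indic.
have lT : leb `[0, T] = T%:E.
  rewrite lebesgue_measure_itv/= lte_fin; case: ltP => T0'; first by rewrite -EFinD subr0.
  by congr EFin; apply/eqP; rewrite eq_le T0 T0'.
by rewrite integral_indic// setIT [X in (_ * X <= _)%E](_ : _ = T%:E).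
Qed.

End expected_gap.

Section monotone_L1.
Context {d : measure_display} {Omega : measurableType d} {R : realType}
  (P : probability Omega R).

(** Monotonicity avoids passing to a subsequence: by Markov's inequality the event that all terms
    stay above 1 / (k + 1) has probability at most c (k + 1) / (n + 1) for every n, hence 0. *)
Lemma ae_cvg0_of_integral (f : nat -> Omega -> R) (c : R) :
  (forall n, measurable_fun setT (f n)) -> (forall n w, 0 <= f n w) ->
  {ae P, forall w, forall n m, (n <= m)%N -> f m w <= f n w} ->
  (forall n, \int[P]_w (f n w)%:E <= (c / n.+1%:R)%:E)%E ->
  {ae P, forall w, f n w @[n --> \oo] --> 0}.
Proof.
move=> mf f0 fmono fc.
have fi n : intg P (f n).
  apply/integrableP; split; first exact/measurable_EFinP.
  under eq_integral do rewrite gee0_abs ?lee_fin//.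
  by apply: le_lt_trans (fc n) _; rewrite ltry.
have Efc n : Ex P (f n) <= c / n.+1%:R by rewrite -lee_fin EFin_Ex.
have c0 : 0 <= c by have := le_trans (Ex_ge0 P (f0 0%N)) (Efc 0%N); rewrite divr1.
pose N k := \bigcap_n [set w | k.+1%:R^-1 <= f n w].
have mN k : measurable (N k).
  by apply: bigcap_measurableType => n _; exact: measurable_level_ge.
have PN k : P (N k) = 0%E.
  rewrite -EFin_Pr//; congr EFin; apply/eqP; rewrite eq_le Pr_ge0 andbT.
  apply/ler_addgt0Pl => e e0; rewrite addr0.
  have k0 : 0 < k.+1%:R^-1 :> R by rewrite invr_gt0.
  have h n : Pr P (N k) <= c / n.+1%:R / k.+1%:R^-1.
    apply: (@le_trans _ _ (Ex P (f n) / k.+1%:R^-1)).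
      by apply: markov_Pr => // w Nw; exact: Nw.
    by rewrite ler_pM2r ?invr_gt0.
  pose n := Num.trunc (c * k.+1%:R / e).
  apply: (le_trans (h n)); rewrite invrK mulrAC ler_pdivrMr// mulrC -ler_pdivrMl//.
  have -> : e^-1 * (k.+1%:R * c) = c * k.+1%:R / e by rewrite mulrC (mulrC c).
  exact: (ltW (truncnS_gt _)).
have nN : {ae P, forall w, forall k, ~ N k w}.
  by apply/ae_foralln => k; exists (N k); split; [exact: mN|exact: PN|move=> w /= /contrapT].
apply: filterS2 nN fmono => w nw fw.
apply/cvgrPdist_le => e e0.
have [k _ ke] := near_infty_natSinv_lt (PosNum e0).
have ke' := ltW (ke k (leqnn k)).
have [n hn] : exists n, f n w < k.+1%:R^-1.
  apply: contrapT => hn; apply: (nw k) => n _ /=.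
  by rewrite leNgt; apply/negP => h; apply: hn; exists n.
exists n => // m /= nm; rewrite sub0r normrN ger0_norm//.
by apply: (le_trans (fw _ _ nm)); apply: (le_trans (ltW hn)); exact: ke'.
Qed.

End monotone_L1.

Section bounded_minorant.
Context {d : measure_display} {Omega : measurableType d} {R : realType}
  (P : probability Omega R).
Import HBNNSimple.

(** Replaces a payoff, which may be unbounded or of infinite expectation, by a bounded measurable
    minorant to which dominated convergence applies. *)
Lemma integral_gt_bounded (f : Omega -> R) (x : R) : (forall w, 0 <= f w) ->
  (x%:E < \int[P]_w (f w)%:E)%E ->
  exists (h : Omega -> R) (M : R), [/\ measurable_fun setT h, forall w, `|h w| <= M,
    forall w, 0 <= h w <= f w & x < Ex P h].
Proof.
move=> f0; rewrite integral_nnsfun_sup// => /ereal_sup_gt[_ [h /= hf <-]] xh.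
have [M [_ hM]] := simple_bounded h.
have hM' w : `|h w| <= `|M| + 1.
  by apply: hM => //; rewrite (le_lt_trans (ler_norm M)) ?ltrDl.
have mh : measurable_fun setT h by exact: measurable_funP.
exists h, (`|M| + 1); split => //; first by move=> w; rewrite hf andbT; exact: fun_ge0.
by rewrite -lte_fin EFin_Ex//; exact: (intg_bd P mh hM').
Qed.

End bounded_minorant.

(** * Right-continuity of the value and of the boundary *)

Section value_right_limit.
Context {d : measure_display} {Omega : measurableType d} {R : realType}
  (P : probability Omega R).
Variables (alpha mu sigma k theta gamma : R) (rho : R -> R)
  (B W : R -> {RV P >-> R}) (Rate : R -> R -> {RV P >-> R}).
Hypotheses (k0 : 0 < k) (gamma0 : 0 < gamma).
Hypotheses (BB : brownian_motion B) (BM : brownian_motion W)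
  (cir : forall r : R, 0 <= r -> cir_strong_solution k theta gamma W r (Rate r))
  (drho : discount_rate rho).
Local Notation pay := (payoff alpha mu sigma rho B Rate).
Local Notation val := (value alpha mu sigma rho B W Rate).
Local Notation bd := (boundary alpha mu sigma rho B W Rate).

Lemma drifted_BM_continuous w :
  {within `[0, +oo[, continuous (fun s => drifted_BM mu sigma B s w)}.
Proof.
have [_ cB _ _] := BB.
move=> s; apply: cvgD.
  apply: cvgM; first exact: cvg_cst.
  exact: (continuous_subspaceT (f := id) (fun x => cvg_id)).
by apply: cvgM; [exact: cvg_cst|exact: cB].
Qed.

Lemma measurable_drifted_BM (s : R) : measurable_fun setT (drifted_BM mu sigma B s).
Proof.
by apply: measurable_funD => //; apply: measurable_funM.
Qed.

Lemma measurable_Kprocess (z s : R) : 0 <= s ->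
  measurable_fun setT (Kprocess alpha mu sigma B z s).
Proof.
move=> s0; apply: measurable_funD => //; apply: measurable_funB; last exact: measurable_drifted_BM.
apply: measurable_maxr => //.
by apply: measurable_path_sup => //; [exact: drifted_BM_continuous|move=> u _; exact: measurable_drifted_BM].
Qed.

Lemma filtration2_measurable (z t : R) :
  augmented_filtration2 P (Kprocess alpha mu sigma B z) W t `<=` measurable.
Proof.
apply: sigma_measurable => _ [[[s ss [C mC <-]]|[s ss [C mC <-]]]|[]//].
  by apply: measurable_Kprocess => //; move: ss; rewrite /= in_itv/= => /andP[].
by rewrite setTI -[X in measurable X]setTI; exact: measurable_funP.
Qed.

Let Xc (r : R) w : 0 <= r -> {within `[0, +oo[, continuous (fun s => Rate r s w)}.
Proof. by move=> rr; exact: (@cir_continuous _ _ _ _ _ _ _ _ _ _ (cir rr) w). Qed.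

Let X0 (r s : R) w : 0 <= r -> 0 <= s -> 0 <= Rate r s w.
Proof. by move=> rr; exact: (cir_ge0 (cir rr)). Qed.

Let disc (r t : R) w : R := discount rho (fun s => Rate r s) t w.

Lemma measurable_discount (r t : R) : 0 <= r -> 0 <= t -> measurable_fun setT (disc r t).
Proof.
move=> r0 t0; have [crho rho0 _ _ _] := drho.
apply: (@mw_measurable _ _ _ P W t); apply: measurable_wrt_discount => //.
- by move=> s w; exact: X0.
- by move=> w; exact: Xc.
- move=> s s0 st; apply: measurable_wrtS (cir_adapted (cir r0) s0); exact: filtration_mono.
Qed.

Variable r : R.
Hypothesis r0 : 0 <= r.
(** The boundary being monotone, one sequence decreasing to [r] is enough; with this one the
    expected gap at each time is at most 1 / (n + 1). *)
Let rn (n : nat) : R := r + n.+1%:R^-1.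

Let rn_gt n : r < rn n. Proof. by rewrite ltrDl invr_gt0. Qed.
Let rn0 n : 0 <= rn n. Proof. exact: le_trans r0 (ltW (rn_gt n)). Qed.

Let rn_mono n m : (n <= m)%N -> rn m <= rn n.
Proof. by move=> nm; rewrite lerD2l lef_pV2 ?posrE// ler_nat. Qed.

Let ae_order : {ae P, forall w, forall n m, (n <= m)%N -> forall s : R, 0 <= s ->
  Rate r s w <= Rate (rn m) s w /\ Rate (rn m) s w <= Rate (rn n) s w}.
Proof.
have h1 : {ae P, forall w, forall n, forall s : R, 0 <= s -> Rate r s w <= Rate (rn n) s w}.
  by apply/ae_foralln => n; exact: (cir_monotone BM k0 gamma0 (cir r0) (cir (rn0 n)) (ltW (rn_gt n))).
have h2 : {ae P, forall w, forall n, forall s : R, 0 <= s -> Rate (rn n.+1) s w <= Rate (rn n) s w}.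
  by apply/ae_foralln => n; exact: (cir_monotone BM k0 gamma0 (cir (rn0 _)) (cir (rn0 n)) (rn_mono (leqnSn n))).
apply: filterS2 h1 h2 => w h1 h2 n m nm s s0; split; first exact: h1.
by apply: (homo_leq (f := fun n => Rate (rn n) s w) (r := fun x y => y <= x)) nm => //
  [x y z yx zy|i]; [exact: le_trans zy yx|exact: h2].
Qed.

Lemma path_gap_cvg0 (T : R) : 0 <= T ->
  {ae P, forall w, path_gap (Rate r) (Rate (rn n)) T w @[n --> \oo] --> 0}.
Proof.
move=> T0; apply: (@ae_cvg0_of_integral _ _ _ P _ T).
- by move=> n; apply: measurable_path_gap => // w; exact: Xc.
- by move=> n w; exact: path_gap_ge0.
- apply: filterS ae_order => w h n m nm.
  have cr w' : {within `[0, +oo[, continuous (fun s => Rate r s w')} by exact: Xc.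
  have cn l w' : {within `[0, +oo[, continuous (fun s => Rate (rn l) s w')} by exact: Xc.
  apply: le_Rintegral => //; [exact: (path_gap_integrable cr (@cn m) T w)|exact: (path_gap_integrable cr (@cn n) T w)|].
  move=> s; rewrite /= in_itv/= => /andP[s0 _]; have [a b] := h n m nm s s0.
  by rewrite !max_l ?subr_ge0 ?lerD2r// (le_trans a).
move=> n; rewrite mulrC; apply: integral_path_gap_le => //.
- by move=> w; exact: Xc.
- by move=> w; exact: Xc.
move=> s s0; have := cir_comparison BM k0 gamma0 (cir (rn0 n)) (cir r0) s0.
by rewrite /rn addrAC subrr add0r max_l.
Qed.

Lemma discount_cvg_right (T : R) : 0 <= T ->
  {ae P, forall w, disc (rn n) T w - disc r T w @[n --> \oo] --> 0}.
Proof.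
move=> T0; have [crho rho0 rhomono _ _] := drho.
apply: filterS2 ae_order (path_gap_cvg0 T0) => w h gap.
have [C [C0 hC]] := path_bounded T (Xc (w := w) (rn0 0%N)).
have [M [M0 hM]] := discount_rate_le drho C.
have XY n (s : R) : 0 <= s -> s <= T -> Rate r s w <= Rate (rn n) s w /\ Rate (rn n) s w <= C.
  move=> s0 sT; have [a b] := h 0%N n (leq0n n) s s0; split => //.
  by apply: (le_trans b); apply: (le_trans (ler_norm _)); exact: hC.
apply/cvgrPdist_le => e e0.
(* With smoothing parameter e' and a path gap below e'^2 the discount gap is at most M (e' T + e'),
   and e' = e / K brings it below [e]. *)
pose K := M * (T + 1) + 1.
have K0 : 0 < K by rewrite ltr_wpDl// mulr_ge0// addr_ge0.
pose e' := e / K.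
have e'0 : 0 < e' by rewrite divr_gt0.
have e2 : 0 < e' ^+ 2 by rewrite exprn_gt0.
move/cvgrPdist_le: gap => /(_ _ e2); apply: filterS => n.
rewrite !sub0r !normrN ger0_norm; last by exact: path_gap_ge0.
move=> gn.
have low : 0 <= disc (rn n) T w - disc r T w.
  rewrite subr_ge0; apply: (le_discount crho rhomono) => //.
  - by move=> s w'; exact: X0.
  - by move=> w'; exact: Xc.
  - by move=> s w'; exact: X0.
  - by move=> w'; exact: Xc.
  - by move=> s s0; have [] := h n n (leqnn n) s s0.
rewrite ger0_norm//.
have := @discount_gap_bound _ _ _ rho drho (fun s => Rate r s) (fun s => Rate (rn n) s) _ _ _ _ M C T e' w T0 e'0 hM (XY n).
move=> /(_ _ _ _ _)/le_trans; apply.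
- by move=> s w'; exact: X0.
- by move=> w'; exact: Xc.
- by move=> s w'; exact: X0.
- by move=> w'; exact: Xc.
apply: (@le_trans _ _ (M * (e' * T + e'))).
  by apply: ler_wpM2l => //; rewrite lerD2l ler_pdivrMr// -expr2.
have -> : e = e' * K by rewrite divfK// gt_eqF.
by rewrite /K; move: (ltW e'0) => ?; nra.
Qed.


(** A strict inequality leaves room for three successive losses: a bounded minorant of the payoff,
    stopping times bounded by some T, and the extra discount up to T caused by the larger rate. *)
Lemma value_gt1_right z : (1 < val r z)%E -> exists n, (1 < val (rn n) z)%E.
Proof.
move=> /ereal_sup_gt[_ [tau [tau0 tau_st] <-]].
rewrite unlock => /(integral_gt_bounded (payoff_ge0 _ _ _ _ _ _ _ _ _))[h [M [mh hM h0pay h1]]].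
have h0 w : 0 <= h w by have /andP[] := h0pay w.
have hpay w : h w <= pay r z tau w by have /andP[] := h0pay w.
pose A (n : nat) : set Omega := [set w | (tau w <= n%:R%:E)%E].
(* On the complement of all the [A n] the stopping time is infinite, the payoff is 0 and so is its
   minorant: cutting at a large time loses little. *)
have mA n : measurable (A n) by apply: filtration2_measurable; exact: tau_st.
pose g (n : nat) w : R := h w * \1_(A n) w.
have mg n : measurable_fun setT (g n) by apply: measurable_funM => //; exact: measurable_indic.
have gM n w : `|g n w| <= M.
  by rewrite normrM (le_trans _ (hM w))// ler_piMr// indicE; case: (_ \in _); rewrite ?normr1 ?normr0.
have gcvg : Ex P (g n) @[n --> \oo] --> Ex P h.
  apply: (@Ex_dominated _ _ _ P g h M) => //; apply: aeW => w.
  apply: cvg_near_cst; move: (tau0 w) (hpay w); rewrite /g /payoff.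
  case E : (tau w) => [t| |] // _ hw; last first.
    by exists 0%N => // n _; rewrite (_ : h w = 0) ?mul0r//; apply/eqP; rewrite eq_le hw h0.
  exists (Num.trunc t).+1 => // n /= tn.
  rewrite indicE mem_set ?mulr1// /A/= E lee_fin.
  by apply: (le_trans (ltW (truncnS_gt t))); rewrite ler_nat.
have [T1 gT] : exists n, 1 < Ex P (g n).
  by have [n _ /(_ n (leqnn n)) hn] := cvgr_gt _ gcvg _ h1; exists n.
pose T : R := T1%:R.
have T0 : 0 <= T by exact: ler0n.
pose D n w : R := disc (rn n) T w - disc r T w.
have mD n : measurable_fun setT (D n) by apply: measurable_funB; exact: measurable_discount.
(* The positive part keeps the factor at most 1 on every path, including the null set where the
   order of the rates may fail. *)
pose q n w : R := g T1 w * expR (- Num.max (D n w) 0).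
have mq n : measurable_fun setT (q n).
  apply: measurable_funM => //; apply: measurableT_comp => //.
  by apply: measurableT_comp => //; apply: measurable_maxr.
have g0 w : 0 <= g T1 w by rewrite mulr_ge0.
have qM n w : `|q n w| <= M.
  rewrite normrM (le_trans _ (gM T1 w))// ler_piMr//.
  by rewrite (ger0_norm (expR_ge0 _)) -expR0 ler_expR oppr_le0 le_max lexx orbT.
have qcvg : Ex P (q n) @[n --> \oo] --> Ex P (g T1).
  apply: (@Ex_dominated _ _ _ P q (g T1) M) => //.
  apply: filterS (discount_cvg_right T0) => w Dw.
  have mc : {for (0 : R), continuous (fun x : R => Num.max x 0)}.
    by apply: (@continuous_max _ _ id (cst 0)); [exact: cvg_id|exact: cvg_cst].
  have m0 : - Num.max 0 0 = 0 :> R by rewrite maxxx oppr0.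
  have Dw' : - Num.max (D n w) 0 @[n --> \oo] --> (- Num.max 0 0 : R).
    by apply: cvgN; exact: (cvg_comp _ _ Dw mc).
  rewrite m0 in Dw'.
  have Dw'' := cvg_comp _ _ Dw' (@continuous_expR R 0).
  rewrite expR0 in Dw''.
  rewrite -[X in _ --> X]mulr1; apply: cvgM; first exact: cvg_cst.
  exact: Dw''.
have [n qn] : exists n, 1 < Ex P (q n).
  by have [n _ /(_ n (leqnn n)) hn] := cvgr_gt _ qcvg _ gT; exists n.
exists n; apply: (@lt_le_trans _ _ 'E_P[pay (rn n) z tau]%E); last first.
  by apply: ereal_sup_ubound; exists tau.
rewrite unlock; apply: (@lt_le_trans _ _ (\int[P]_w (q n w)%:E)%E).
  by rewrite -EFin_Ex ?lte_fin//; exact: (intg_bd P (mq n) (qM n)).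
have q0 w : 0 <= q n w by rewrite mulr_ge0// expR_ge0.
apply: ge0_ae_le_integral => //; first by move=> w; exact: payoff_ge0.
apply: filterS ae_order => w ord.
rewrite /q /g indicE; case: (boolP (w \in A T1)) => [/set_mem|_]; last first.
  by rewrite mulr0 mul0r; exact: payoff_ge0.
rewrite /A/= mulr1; move: (tau0 w) (hpay w); rewrite /payoff.
case: (tau w) => [t| |] //; rewrite !lee_fin => t0 hw tT.
apply: (le_trans (ler_wpM2r (expR_ge0 _) hw)).
rewrite -expRD ler_expR -addrA lerD2l -opprD lerN2 /D.
have incr : disc (rn n) t w - disc r t w <= disc (rn n) T w - disc r T w.
  apply: le_discount_incr => //.
  - by move=> s w'; exact: X0.
  - by move=> w'; exact: Xc.
  - by move=> s w'; exact: X0.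
  - by move=> w'; exact: Xc.
  - by move=> s s0; have [] := ord n n (leqnn n) s s0.
rewrite -lerBlDl; apply: (le_trans incr); by rewrite le_max lexx.
Qed.

(** For a nonincreasing function the right limit is the supremum over x > r. Each [z] contributing
    to [bd r] already contributes to some [bd (rn n)], so this supremum reaches [bd r]. *)
Lemma boundary_right_continuous : bd x @[x --> r^'+] --> bd r.
Proof.
have mono : {in Interval (BRight r) (BInfty R false) &,
    {homo bd : n m / n <= m >-> (m <= n)%E}}.
  move=> x y; rewrite !in_itv/= !andbT => rx ry xy.
  by apply: (boundary_nonincreasing alpha mu sigma B k0 gamma0 BM cir drho) => //; rewrite (le_trans r0)// ltW.
have := nonincreasing_at_right_cvge (BInfty R false) _ mono.
rewrite bnd_simp => /(_ isT); congr (_ --> nbhs _).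
have rnI n : [set` Interval (BRight r) (BInfty R false)] (rn n).
  by rewrite /= in_itv/= rn_gt.
apply/eqP; rewrite eq_le; apply/andP; split.
  apply: ge_ereal_sup => _ [x xI <-]; move: xI; rewrite /= in_itv/= andbT => rx.
  by apply: (boundary_nonincreasing alpha mu sigma B k0 gamma0 BM cir drho) => //; exact: ltW.
apply: ge_ereal_sup => _ [->|[z [az /value_gt1_right[n v1]] <-]].
  apply: (@le_trans _ _ (bd (rn 0%N))); first by apply: ereal_sup_ubound; left.
  by apply: ereal_sup_ubound; exists (rn 0%N).
apply: (@le_trans _ _ (bd (rn n))).
  apply: ereal_sup_ubound; right; exists z; last by [].
  by split; [exact: az|exact: v1].
by apply: ereal_sup_ubound; exists (rn n).
Qed.

End value_right_limit.

(** * The boundary lies above alpha *)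

Section hitting_time.
Context {R : realType}.
Variables (a : R -> R) (t c M : R).
Hypotheses (t0 : 0 < t) (c0 : 0 < c) (M0 : 0 <= M) (a0 : a 0 = 0).
Hypothesis aM : forall s u : R, 0 <= s -> s <= u -> u <= t -> a s <= a u <= a s + M * (u - s).

(** Times beyond the cap [t] belong to the set, which is therefore never empty, so that its infimum
    is meaningful. *)
Definition hits : set R := [set s | 0 <= s /\ (t <= s \/ c <= a s)].
Definition hit : R := inf hits.

Let hits_t : hits t. Proof. by split; [exact: ltW|left]. Qed.
Let hits_lb : has_lbound hits. Proof. by exists 0 => s []. Qed.
Let M1 : 0 < M + 1. Proof. by rewrite ltr_wpDl. Qed.

Lemma hit_le s : hits s -> hit <= s.
Proof. by move=> hs; exact: ge_inf. Qed.

Lemma hit_ge0 : 0 <= hit.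
Proof. by apply: lb_le_inf; [exists t|move=> s []]. Qed.

Lemma hit_le_cap : hit <= t. Proof. exact: hit_le. Qed.

(** A Lipschitz function cannot jump over the level: if it exceeded [c] at [hit], it would already
    have reached it slightly earlier. *)
Lemma hit_level : a hit <= c.
Proof.
rewrite leNgt; apply/negP => ca.
have h0 : 0 < hit.
  rewrite lt_neqAle hit_ge0 andbT; apply/eqP => h0.
  by move: ca; rewrite -h0 a0 => /(lt_trans c0); rewrite ltxx.
pose del := (a hit - c) / (M + 1).
have del0 : 0 < del by rewrite divr_gt0// subr_gt0.
pose s := Num.max 0 (hit - del).
have s0 : 0 <= s by rewrite le_max lexx.
have sh : s < hit by rewrite gt_max h0 ltrBlDr ltrDl.
have hs : hits s.
  split => //; right; have /andP[_ h] := aM s0 (ltW sh) hit_le_cap.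
  have e1 : M * (hit - s) <= M * del.
    by rewrite ler_wpM2l// lerBlDl -lerBlDr le_max lexx orbT.
  have e2 : M * del <= a hit - c.
    have : (M + 1) * del = a hit - c by rewrite mulrC divfK// gt_eqF.
    by lra.
  by lra.
by have := le_lt_trans (hit_le hs) sh; rewrite ltxx.
Qed.

(** Reduces the event that the time has come to the value of [a] at [s] alone; this is what makes it
    a stopping time. *)
Lemma hit_leE s : 0 <= s -> hit <= s <-> t <= s \/ c <= a s.
Proof.
move=> s0; split; last by move=> h; exact: hit_le.
move=> hs; apply: contrapT => /not_orP[/negP ts /negP cs].
rewrite -ltNge in ts; rewrite -ltNge in cs.
(* Half of the minimum, so that neither the cap nor the level is reached up to [s + del], which
   forces [hit] beyond [s]. *)
pose del := Num.min (t - s) ((c - a s) / (M + 1)) / 2.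
have d1 : 0 < (c - a s) / (M + 1) by rewrite divr_gt0// subr_gt0.
have del0 : 0 < del by rewrite divr_gt0// lt_min subr_gt0 ts d1.
have del1 : del < t - s.
  have : Num.min (t - s) ((c - a s) / (M + 1)) <= t - s by rewrite ge_min lexx.
  by rewrite -subr_gt0 in ts; rewrite /del; lra.
have del2 : del < (c - a s) / (M + 1).
  have : Num.min (t - s) ((c - a s) / (M + 1)) <= (c - a s) / (M + 1) by rewrite ge_min lexx orbT.
  by rewrite /del; lra.
have sd : s <= s + del by rewrite lerDl ltW.
have sdt : s + del <= t by lra.
have /andP[_ h] := aM s0 sd sdt.
have e2 : M * del < c - a s.
  apply: (@le_lt_trans _ _ ((M + 1) * del)); first by rewrite ler_wpM2r ?lerDl// ltW.
  by rewrite mulrC -ltr_pdivlMr.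
have : s + del <= hit.
  apply: lb_le_inf; first by exists t.
  move=> u [u0 hu]; rewrite leNgt; apply/negP => us.
  case: hu => [tu|cu]; first by move: (lt_le_trans us sdt); rewrite ltNge tu.
  have /andP[h' _] := aM u0 (ltW us) sdt.
  by move: h; rewrite addrAC subrr add0r; lra.
by lra.
Qed.

Lemma hit_cap : a t < c -> hit = t.
Proof.
move=> atc; apply/eqP; rewrite eq_le hit_le_cap/= leNgt; apply/negP => ht.
have [/(_ (lexx _)) [th|cs] _] := hit_leE hit_ge0; first by move: ht; rewrite ltNge th.
have /andP[h _] := aM hit_ge0 (ltW ht) (lexx t).
by lra.
Qed.

End hitting_time.

Section independence_augmented.
Context {d : measure_display} {Omega : measurableType d} {R : realType}
  (P : probability Omega R).
Variables B W : R -> {RV P >-> R}.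
Hypothesis ind : independent_processes P B W.

Lemma indep_augmented (t : R) (D C : set Omega) :
  <<s process_events `[0, +oo[ B >> D -> augmented_filtration P W t C ->
  P (D `&` C) = (P D * P C)%E.
Proof.
move=> FD FC.
have mD : measurable D.
  by apply: sigma_measurable FD; exact: process_events_measurable.
have mG : process_events `[0, t] (fun s => W s) `<=` measurable by exact: process_events_measurable.
rewrite setIC muleC; apply: (indep_augment mG mD _ FC) => A FA.
rewrite setIC muleC; apply: ind => //.
apply: sub_smallest2r FA => // _ [s s0 [E mE <-]]; exists s => //; last by exists E.
by move: s0; rewrite /= !in_itv/= andbT => /andP[].
Qed.

End independence_augmented.

(** * A profitable waiting time just above alpha *)

Section boundary_above.
Context {d : measure_display} {Omega : measurableType d} {R : realType}
  (P : probability Omega R).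
Variables (alpha mu sigma k theta gamma : R) (rho : R -> R)
  (B W : R -> {RV P >-> R}) (Rate : R -> R -> {RV P >-> R}).
Hypotheses (mu0 : 0 < mu) (sigma0 : 0 < sigma).
Hypotheses (BB : brownian_motion B) (ind : independent_processes P B W)
  (cir : forall r : R, 0 <= r -> cir_strong_solution k theta gamma W r (Rate r))
  (drho : discount_rate rho).
Local Notation pay := (payoff alpha mu sigma rho B Rate).
Local Notation val := (value alpha mu sigma rho B W Rate).
Local Notation bd := (boundary alpha mu sigma rho B W Rate).
Variable r : R.
Hypothesis r0 : 0 <= r.

Let X (s : R) (w : Omega) : R := Rate r s w.
Let cX w : {within `[0, +oo[, continuous (X^~ w)}.
Proof. exact: (@cir_continuous _ _ _ _ _ _ _ _ _ _ (cir r0) w). Qed.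
Let X0 (s : R) w : 0 <= s -> 0 <= X s w.
Proof. exact: (cir_ge0 (cir r0)). Qed.
Let A (s : R) (w : Omega) : R := discount rho X s w.
(** A path started at [r] has rate below [rho r + 1 / 2] for a short while; the margin makes the
    discount accumulated up to a small time t strictly less than C t. *)
Let C : R := rho r + 1.
Let C0 : 0 < C.
Proof. by have [_ rho0 _ _ _] := drho; rewrite ltr_wpDl// rho0. Qed.

Let crho : {within `[0, +oo[, continuous rho}. Proof. by case: drho. Qed.
Let rho0 (x : R) : 0 <= x -> 0 <= rho x. Proof. by case: drho => _ h _ _ _; exact: h. Qed.

Let discount_lip (t : R) w : 0 <= t -> exists M : R, 0 <= M /\ forall s u : R, 0 <= s -> s <= u -> u <= t ->
  A s w <= A u w <= A s w + M * (u - s).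
Proof.
move=> t0; have [M [M0 hM]] := path_bounded t (discount_rate_continuous crho X0 cX (w := w)).
exists M; split => // s u s0 su ut; apply: discount_add => // v sv vu.
by apply: (le_trans (ler_norm _)); apply: hM; [exact: le_trans sv|exact: le_trans ut].
Qed.

Definition capped_time (t : R) (w : Omega) : \bar R := (hit (A^~ w) t (C * t))%:E.

Lemma mw_discount (G : set (set Omega)) (s : R) : 0 <= s ->
  process_events `[0, s] (fun u => W u) `|` null_sets P `<=` G ->
  measurable_wrt <<s G>> (A s).
Proof.
move=> s0 sub; apply: measurable_wrt_discount => // u u0 us.
apply: measurable_wrtS (cir_adapted (cir r0) u0).
apply: sub_smallest2r => // D hD; apply: sub; case: hD => [|h]; last by right.
move=> [v v0 h]; left; exists v => //; move: v0; rewrite /= !in_itv/= => /andP[-> vu].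
exact: le_trans us.
Qed.

(** The discount up to [s] is a functional of the rate, hence of W up to [s], so only the W part of
    the filtration is called upon and [z] is arbitrary. *)
Lemma capped_time_stopping (t z : R) : 0 < t ->
  stopping_time (augmented_filtration2 P (Kprocess alpha mu sigma B z) W) (capped_time t).
Proof.
move=> t0; have Ct : 0 < C * t by rewrite mulr_gt0.
have A00 w : A 0 w = 0 by exact: discount0.
split=> [w|s s0]; first by rewrite lee_fin; exact: hit_ge0.
have -> : [set w | (capped_time t w <= s%:E)%E] = [set w | t <= s \/ C * t <= A s w].
  apply/seteqP; split => w; have [M [M0 hM]] := discount_lip w (ltW t0);
    rewrite /capped_time/= lee_fin; by move/(hit_leE _ t0 M0 hM s0).
have [ts|ts] := leP t s.
  rewrite (_ : [set _ | _] = setT); last by apply/seteqP; split => // w _; left.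
  exact: (@measurableT _ (g_sigma_algebraType _)).
rewrite (_ : [set _ | _] = A s @^-1` `[C * t, +oo[); last first.
  apply/seteqP; split => w; rewrite /= in_itv/= andbT; first by case=> // /(lt_le_trans ts); rewrite ltxx.
  by right.
apply: (mw_preimage (mw_discount s0 _)) => //.
by move=> D [h|h]; [left; right|right].
Qed.

(* Waiting until time t, or until the accumulated discount reaches C t, costs
   a factor exp (- C t) only, while B gains 2 sqrt t with fixed probability. *)
Lemma payoff_ge (t : R) w : 0 < t -> B 0 w = 0 ->
  (mu + 1) * t <= sigma * Num.sqrt t ->
  expR (- (C * t)) * (1 + lam mu sigma * sigma * Num.sqrt t *
    \1_[set w | 2 * Num.sqrt t <= B t w - B 0 w /\ A t w < C * t] w) <=
  pay r (alpha + t) (capped_time t) w.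
Proof.
move=> t0 B0 small; have Ct : 0 < C * t by rewrite mulr_gt0.
have A00 : A 0 w = 0 by exact: discount0.
have [M [M0 hM]] := discount_lip w (ltW t0).
have l0 : 0 < lam mu sigma by rewrite /lam divr_gt0 ?mulr_gt0// exprn_gt0.
rewrite /payoff /capped_time/= -/(discount rho X _ w) -/(A _ w).
have Ale := hit_level t0 Ct M0 A00 hM.
set S := running_sup _ _ _ _ _; set th := hit _ _ _ in Ale S *.
have at1 : alpha + t - alpha = t by rewrite addrAC subrr add0r.
rewrite at1 indicE; case: (boolP (w \in _)) => [/set_mem[Bw Aw]|_]; last first.
  rewrite mulr0 addr0 mulr1 ler_expR.
  have : 0 <= lam mu sigma * (Num.max t S - t).
    by rewrite mulr_ge0 ?(ltW l0)// subr_ge0 le_max lexx.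
  by lra.
have th_t : th = t by exact: (hit_cap t0 M0 hM Aw).
have St : drifted_BM mu sigma B t w <= S.
  have [_ ub] := has_sup_path (fun w => @drifted_BM_continuous _ _ _ _ mu sigma _ BB w) w (ltW t0).
  by rewrite /S th_t; apply: ub_le_sup => //; exists t => //=; rewrite in_itv/= (ltW t0) lexx.
rewrite B0 subr0 in Bw.
(* On the good event S >= 2 sigma sqrt t - mu t; subtracting t and using (mu + 1) t <= sigma sqrt t
   leaves sigma sqrt t. *)
have g : sigma * Num.sqrt t <= Num.max t S - t.
  apply: (@le_trans _ _ (S - t)); last by rewrite lerB// le_max lexx orbT.
  have e1 := ler_wpM2l (ltW sigma0) Bw.
  move: St; rewrite /drifted_BM; move: e1 small.
  move: (Num.sqrt t) (B t w) S => q b S' e1 e2 e3; lra.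
rewrite mulr1 mulrC.
apply: (@le_trans _ _ (expR (lam mu sigma * (sigma * Num.sqrt t)) * expR (- (C * t)))).
  by rewrite ler_wpM2r ?expR_ge0// -mulrA expR_ge1Dx.
rewrite -expRD ler_expR; apply: lerD; first by rewrite ler_wpM2l// ltW.
by rewrite lerN2.
Qed.

(** By continuity of the path at time 0, where the rate starts from [r] almost surely; the threshold
    on n depends on the path. *)
Lemma discount_small : {ae P, forall w, \forall n \near \oo,
  A n.+1%:R^-1 w < C * n.+1%:R^-1}.
Proof.
have [_ _ _ Xr _] := cir r0; apply: filterS Xr => w Xw.
have cr := continuous_clamp (discount_rate_continuous crho X0 cX (w := w)).
have /cvgrPdist_lt := cr 0.
rewrite maxxx; have h2 : 0 < 2^-1 :> R by rewrite invr_gt0.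
move=> /(_ _ h2)[e /= e0 he].
have Xw' : X 0 w = r by exact: Xw.
have [N _ hN] := near_infty_natSinv_lt (PosNum e0).
exists N => // n nN; have tn := hN n nN; rewrite /= in tn.
have n0 : 0 < n.+1%:R^-1 :> R by rewrite invr_gt0.
set t := n.+1%:R^-1 in tn n0 *.
have rb u : 0 <= u -> u <= t -> rho (X u w) <= rho r + 2^-1.
  move=> u0 ut; have := he u; rewrite /= sub0r normrN (ger0_norm u0) => /(_ (le_lt_trans ut tn)).
  by rewrite (max_l u0) Xw' ltr_norml => /andP[h _]; move: h; lra.
have /andP[_] := discount_add crho rho0 X0 cX (lexx 0) (ltW n0) rb.
rewrite discount0// add0r subr0 => /le_lt_trans; apply.
by rewrite ltr_pM2r// /C; lra.
Qed.

Let tn (n : nat) : R := n.+1%:R^-1.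
Let tn0 n : 0 < tn n. Proof. by rewrite invr_gt0. Qed.
Let Ae (n : nat) : set Omega := [set w | A (tn n) w < C * tn n].

Let FAe n : augmented_filtration P W (tn n) (Ae n).
Proof.
rewrite (_ : Ae n = A (tn n) @^-1` `]-oo, C * tn n[); last first.
  by apply/seteqP; split => w; rewrite /= in_itv.
by apply: (mw_preimage (mw_discount (ltW (tn0 n)) _)).
Qed.

Let mAe n : measurable (Ae n). Proof. exact: (filtration_measurable (@FAe n)). Qed.

Let PrAe : \forall n \near \oo, 2^-1 < Pr P (Ae n).
Proof.
have h : Ex P (\1_(Ae n)) @[n --> \oo] --> Ex P (cst (1 : R)).
  apply: (@Ex_dominated _ _ _ P (fun n => \1_(Ae n)) (cst 1) 1) => //.
    by move=> n w; rewrite indicE; case: (_ \in _); rewrite ?normr1 ?normr0.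
  apply: filterS discount_small => w hw; apply: cvg_near_cst.
  by apply: filterS hw => n hn; rewrite indicE mem_set.
have lt1 : 2^-1 < Ex P (cst (1 : R)) by rewrite Ex_cst; lra.
have [N _ hN] := cvgr_gt _ h _ lt1; exists N => // n nN.
by have := hN n nN; rewrite /= (Ex_indic P (@mAe n)).
Qed.

Let p0 : R := normal_peak 1 * expR (- (9 / 2)).
Let p00 : 0 < p0.
Proof. by rewrite mulr_gt0 ?expR_gt0// normal_peak_gt0// oner_neq0. Qed.

Let De (t : R) : set Omega := [set w | 2 * Num.sqrt t <= B t w - B 0 w].

Let PrDe (t : R) : 0 < t -> p0 <= Pr P (De t).
Proof.
move=> t0; have mD : measurable (De t).
  by apply: measurable_level_ge; exact: measurable_funB.
rewrite -lee_fin EFin_Pr//.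
have s0 : 0 < Num.sqrt t by rewrite sqrtr_gt0.
have [_ _ hB _] := BB.
have := hB 0 t `[2 * Num.sqrt t, +oo[%classic (lexx 0) t0 (measurable_itv _).
rewrite subr0 /pushforward => hp.
have -> : P (De t) = normal_prob 0 (Num.sqrt t) `[2 * Num.sqrt t, +oo[.
  rewrite -hp; congr (P _); apply/seteqP; split => w; rewrite /De/= in_itv/= andbT//.
exact: normal_prob_tail_ge.
Qed.

Let PrDA n : Pr P (De (tn n) `&` Ae n) = Pr P (De (tn n)) * Pr P (Ae n).
Proof.
have mD : measurable (De (tn n)).
  by apply: measurable_level_ge; exact: measurable_funB.
apply/EFin_inj; rewrite EFinM !EFin_Pr//; last exact: measurableI.
apply: (indep_augmented ind _ (@FAe n)).
rewrite (_ : De (tn n) = (B (tn n) \- B 0) @^-1` `[2 * Num.sqrt (tn n), +oo[); last first.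
  by apply/seteqP; split => w; rewrite /De/= in_itv/= andbT.
have mB (s : R) : 0 <= s -> measurable_wrt <<s process_events `[0, +oo[ (fun u => B u) >> (B s).
  move=> s0 E BE; apply: sub_sigma_algebra; exists s => //; by rewrite /= in_itv/= andbT.
by apply: (mw_preimage (mwB (mB _ (ltW (tn0 n))) (mB 0 (lexx 0)))).
Qed.

Let aux1 (c q kk : R) : 0 < c -> 0 < q -> 0 < kk ->
  q * (2 * c * (1 + kk)) * q <= kk * 1 -> c * q * q <= 1.
Proof.
move=> c0 q0 kk0; have : 0 < c * q * q by rewrite !mulr_gt0.
have -> : q * (2 * c * (1 + kk)) * q = 2 * (c * q * q) * (1 + kk) by ring.
by move: (c * q * q) => y; nra.
Qed.

(** Used with q = sqrt t: the gain is linear in q, the discount loss quadratic. *)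
Let aux2 (c q kk : R) : 0 < c -> 0 < q -> 0 < kk -> q <= 1 ->
  q * (2 * c * (1 + kk)) <= kk -> 1 < (1 - c * q ^+ 2) * (1 + kk * q).
Proof.
move=> c0 q0 kk0 q1 h.
have -> : (1 - c * q ^+ 2) * (1 + kk * q) = 1 + q * (kk - c * q - c * kk * (q * q)) by ring.
rewrite ltrDl mulr_gt0//.
have : c * kk * (q * q) <= c * kk * q.
  by apply: ler_wpM2l; [rewrite mulr_ge0 ?ltW|rewrite ler_piMr// ltW].
have : 0 < c * q by rewrite mulr_gt0.
have : 0 < c * kk * q by rewrite !mulr_gt0.
by lra.
Qed.

Lemma value_gt1_above : exists2 t : R, 0 < t & (1 < val r (alpha + t))%E.
Proof.
have l0 : 0 < lam mu sigma by rewrite /lam divr_gt0 ?mulr_gt0// exprn_gt0.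
have lss0' := mulr_gt0 l0 sigma0.
(* [p0] bounds the probability of the gain from below and 1 / 2 that of a small discount; by
   independence the two multiply. *)
pose kap := lam mu sigma * sigma * (p0 / 2).
have kap0 : 0 < kap.
  by apply: mulr_gt0; [exact: mulr_gt0|exact: divr_gt0].
(* The three entries make sqrt t at most 1, let the gain beat the discount as in [aux2], and ensure
   the smallness condition of [payoff_ge]. *)
pose del := Num.min 1 (Num.min (kap / (2 * C * (1 + kap))) (sigma / (mu + 1))).
have k1 : 0 < 1 + kap by rewrite addr_gt0.
have m1 : 0 < mu + 1 by rewrite addr_gt0.
have ck : 0 < 2 * C * (1 + kap) by rewrite mulr_gt0// mulr_gt0.
have del0 : 0 < del by rewrite !lt_min ltr01 !divr_gt0.
have d2 : 0 < del ^+ 2 by rewrite exprn_gt0.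
have [n [nt nA]] : exists n, tn n < del ^+ 2 /\ 2^-1 < Pr P (Ae n).
  have [N _ hN] : \forall n \near \oo, tn n < del ^+ 2 /\ 2^-1 < Pr P (Ae n).
    by apply: filterS2 (near_infty_natSinv_lt (PosNum d2)) PrAe => n h1 h2; split.
  by exists N; exact: hN (leqnn N).
exists (tn n) => //; set t := tn n.
have t0 : 0 < t := tn0 n.
set s := Num.sqrt t.
have s0 : 0 < s by rewrite sqrtr_gt0.
have lss0 : 0 < lam mu sigma * sigma * s := mulr_gt0 lss0' s0.
have tE : t = s ^+ 2 by rewrite sqr_sqrtr// ltW.
have sd : s < del.
  by rewrite -(@ltr_pXn2r _ 2)// ?nnegrE ?(ltW s0) ?(ltW del0)// -tE.
have [s1 s2 s3] : [/\ s <= 1, s * (2 * C * (1 + kap)) <= kap & s * (mu + 1) <= sigma].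
  move: sd; rewrite !lt_min => /and3P[h1 h2 h3]; split; first exact: ltW.
    by rewrite -ler_pdivlMr// ltW.
  by rewrite -ler_pdivlMr// ltW.
have small : (mu + 1) * t <= sigma * s.
  by rewrite tE expr2 mulrA ler_wpM2r ?(ltW s0)// mulrC.
pose E := De t `&` Ae n.
have mD : measurable (De t) by apply: measurable_level_ge; exact: measurable_funB.
have mE : measurable E by exact: measurableI.
pose f w : R := expR (- (C * t)) * (1 + lam mu sigma * sigma * s * \1_E w).
have iE := intg_indic P mE.
have iE1 := intgD (intg_cst P 1) (intgZ (lam mu sigma * sigma * s) iE).
have fE : Ex P f = expR (- (C * t)) * (1 + lam mu sigma * sigma * s * Pr P E).
  by rewrite /f (ExZ _ iE1) (ExD (intg_cst P 1) (intgZ _ iE)) (ExZ _ iE) Ex_cst Ex_indic.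
have PE : p0 / 2 <= Pr P E.
  rewrite /E PrDA; apply: ler_pM => //; [exact: ltW|exact: PrDe|exact: ltW].
have f1 : 1 < Ex P f.
  rewrite fE; apply: (@lt_le_trans _ _ ((1 - C * t) * (1 + kap * s))); last first.
    apply: ler_pM.
    - rewrite subr_ge0 tE expr2 mulrA.
      have : s * (2 * C * (1 + kap)) * s <= kap * 1 by apply: ler_pM => //; [rewrite mulr_ge0// ltW|exact: ltW..].
      by apply: aux1.
    - by rewrite addr_ge0// mulr_ge0// ltW.
    - by apply: le_trans (expR_ge1Dx _).
    - rewrite lerD2l /kap mulrAC; apply: ler_wpM2l => //.
      exact: ltW lss0.
  by rewrite tE; apply: aux2.
apply: (@lt_le_trans _ _ 'E_P[pay r (alpha + t) (capped_time t)]%E); last first.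
  by apply: ereal_sup_ubound; exists (capped_time t) => //; exact: capped_time_stopping.
have iF : intg P f := intgZ (expR (- (C * t))) iE1.
rewrite unlock; apply: (@lt_le_trans _ _ (\int[P]_w (f w)%:E)%E).
  by rewrite -EFin_Ex ?lte_fin.
apply: ge0_ae_le_integral.
- move=> w; apply: mulr_ge0; first exact: expR_ge0.
  by rewrite addr_ge0//; apply: mulr_ge0 => //; exact: ltW lss0.
- by move=> w; exact: payoff_ge0.
have [Bz _ _ _] := BB; apply: filterS Bz => w B0.
exact: payoff_ge.
Qed.

Lemma boundary_gt : (alpha%:E < bd r)%E.
Proof.
have [t t0 v1] := value_gt1_above.
apply: (@lt_le_trans _ _ (alpha + t)%:E); first by rewrite lte_fin ltrDl.
apply: ereal_sup_ubound; right; exists (alpha + t); last by [].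
by split; [rewrite lerDl ltW|exact: v1].
Qed.

End boundary_above.

Theorem lemma3p8 (R : realType) (d : measure_display) (Omega : measurableType d)
    (P : probability Omega R) (alpha mu sigma k theta gamma : R) (rho : R -> R)
    (B W : R -> {RV P >-> R}) (Rate : R -> R -> {RV P >-> R}) :
  0 <= alpha -> 0 < mu -> 0 < sigma -> 0 < k -> 0 < theta -> 0 < gamma ->
  gamma ^+ 2 <= 2 * k * theta ->
  brownian_motion B -> brownian_motion W -> independent_processes P B W ->
  (forall r : R, 0 <= r -> cir_strong_solution k theta gamma W r (Rate r)) ->
  discount_rate rho ->
  let b := boundary alpha mu sigma rho B W Rate in
  [/\ forall r1 r2 : R, 0 <= r1 -> r1 <= r2 -> (b r2 <= b r1)%E,
      forall r : R, 0 <= r -> b x @[x --> r^'+] --> b r &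
      forall r : R, 0 <= r -> (alpha%:E < b r)%E].
Proof.
move=> _ mu0 sigma0 k0 _ gamma0 _ BB BW ind cir drho b; split.
- exact: (boundary_nonincreasing alpha mu sigma B k0 gamma0 BW cir drho).
- by move=> r r0; exact: (boundary_right_continuous k0 gamma0 BB BW cir drho r0).
- by move=> r r0; exact: (boundary_gt alpha mu0 sigma0 BB ind cir drho r0).
Qed.
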